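(* Let $\Omega$ be a nonempty open set in $\mathbb{R}^n$ that has the interior Lipschitz property. Let $s_1,s_2\in\mathbb{R}$ and $1<p_1,p_2<\infty$. Suppose that $(s_1,p_1,\Omega)$ and $(-s_1,p_1',\Omega)$ are smooth multiplication triples. If $s_2<0$, further assume that $(-s_2,p_2',\Omega)$ is a smooth multiplication triple. Moreover, suppose that $s_1,s_2,p_1,p_2$ are such that $W^{s_1,p_1}(U)$ is compactly embedded in $W^{s_2,p_2}(U)$ for all bounded open sets $U\subseteq\mathbb{R}^n$ with Lipschitz continuous boundary. Then every bounded sequence in $W^{s_1,p_1}_{loc}(\Omega)$ has a convergent subsequence in $W^{s_2,p_2}_{loc}(\Omega)$.
   Context: All functions are real-valued. For $1<p<\infty$, $p'$ denotes the conjugate exponent, $\frac1p+\frac1{p'}=1$. $C_c^\infty(\Omega)$ is the set of smooth functions with compact support in $\Omega$; $D'(\Omega)$ is the space of distributions on $\Omega$. A nonempty open set $\Omega\subseteq\mathbb{R}^n$ has the interior Lipschitz property if for each compact $K\subseteq\Omega$ there is a bounded open set $\Omega'\subseteq\Omega$ with Lipschitz continuous boundary such that $K\subseteq\Omega'$. Sobolev-Slobodeckij spaces: for $k\in\mathbb{N}_0$, $W^{k,p}(\Omega)=\{u\in L^p(\Omega):\|u\|_{W^{k,p}(\Omega)}:=\sum_{|\nu|\le k}\|\partial^\nu u\|_{L^p(\Omega)}<\infty\}$; for $0<\theta<1$, $|u|_{W^{\theta,p}(\Omega)}:=\big(\iint_{\Omega\times\Omega}\frac{|u(x)-u(y)|^p}{|x-y|^{n+\theta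 p}}dx\,dy\big)^{1/p}$; for $s=k+\theta$ with $k\in\mathbb{N}_0$, $0<\theta<1$, $W^{s,p}(\Omega)=\{u\in W^{k,p}(\Omega):\|u\|_{W^{s,p}(\Omega)}:=\|u\|_{W^{k,p}(\Omega)}+\sum_{|\nu|=k}|\partial^\nu u|_{W^{\theta,p}(\Omega)}<\infty\}$. $W^{s,p}_0(\Omega)$ is the closure of $C_c^\infty(\Omega)$ in $W^{s,p}(\Omega)$. For $s<0$, $W^{s,p}(\Omega)=(W^{-s,p'}_0(\Omega))^*$ with the dual norm, viewed as a subspace of $D'(\Omega)$ by restricting functionals to $C_c^\infty(\Omega)$. For $s\in\mathbb{R}$, $W^{s,p}_{loc}(\Omega)=\{u\in D'(\Omega):\varphi u\in W^{s,p}(\Omega)\ \forall\varphi\in C_c^\infty(\Omega)\}$, equipped with the topology induced by the family of seminorms $u\mapsto\|\varphi u\|_{W^{s,p}(\Omega)}$, $\varphi\in C_c^\infty(\Omega)$. The triple $(s,p,\Omega)$ is a smooth multiplication triple if for every $\varphi\in C_c^\infty(\Omega)$ the map $u\mapsto\varphi u$ is well-defined and bounded from $W^{s,p}(\Omega)$ to $W^{s,p}(\Omega)$. A subset $Y$ of a topological vector space is bounded if for every open neighborhood $U$ of the origin there is $t>0$ with $Y\subseteq tU$; a sequence is bounded if its set of terms is. *)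

(* Defs.v *)
From HB Require Import structures.
From mathcomp Require Import all_boot all_order all_algebra.
From mathcomp Require Import all_classical all_reals all_analysis.
Set Implicit Arguments.
Unset Strict Implicit.
Unset Printing Implicit Defensive.
Import Order.TTheory GRing.Theory Num.Theory.
Import numFieldNormedType.Exports.
Local Open Scope classical_set_scope.
Local Open Scope ring_scope.

Section measurable_rV.
Context {R : realType} (n : nat).

Let coord (i : 'I_n) (x : 'rV[R]_n) : measurableTypeR R := x ord0 i.

Let rV_set0 : g_sigma_preimage coord set0.
Proof. exact: sigma_algebra0. Qed.

Let rV_setC A : g_sigma_preimage coord A -> g_sigma_preimage coord (~` A).
Proof. exact: sigma_algebraC. Qed.

Let rV_bigcup (F : (set 'rV[R]_n)^nat) :
  (forall i, g_sigma_preimage coord (F i)) ->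
  g_sigma_preimage coord (\bigcup_i (F i)).
Proof. exact: sigma_algebra_bigcup. Qed.

(* The product sigma-algebra of the Borel sigma-algebra of R, that is, the
   Borel sigma-algebra of R^n. *)
HB.instance Definition _ := @isMeasurable.Build
  (measure_tuple_display default_measure_display) 'rV[R]_n
  (g_sigma_preimage coord) rV_set0 rV_setC rV_bigcup.

Lemma measurable_coord (i : 'I_n) :
  measurable_fun [set: 'rV[R]_n]
    (fun x : 'rV[R]_n => x ord0 i : measurableTypeR R).
Proof.
move=> _ Y mY; rewrite setTI; apply: sub_sigma_algebra => /=.
rewrite -bigcup_seq/=; exists i => /=; first by rewrite mem_index_enum.
by exists Y => //; rewrite setTI.
Qed.

End measurable_rV.

Lemma measurable_fun_coordP {R : realType} d (T : measurableType d) n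
    (f : T -> 'rV[R]_n) :
  (forall i, measurable_fun [set: T]
    (fun t => f t ord0 i : measurableTypeR R)) ->
  measurable_fun [set: T] f.
Proof.
move=> mf.
suff : preimage_set_system setT f measurable `<=` measurable.
  by move=> h _ A mA; apply: h; exists A.
rewrite [X in preimage_set_system _ _ X](_ : _ = g_sigma_preimage
  (fun i (x : 'rV[R]_n) => x ord0 i : measurableTypeR R))//.
rewrite -(g_sigma_preimage_comp _ f).
apply: smallest_sub; first exact: sigma_algebra_measurable.
case: n => [|n] in f mf *; first by rewrite big_ord0.
rewrite -bigcup_mkord_ord; apply: bigcup_sub => i Ii.
by move=> A [B mB <-]; exact: mf.
Qed.

Section lebesgue_step.
Local Open Scope ereal_scope.
Context {R : realType} (n : nat).
Variable mu : {sigma_finite_measure set 'rV[R]_n -> \bar R}.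

Definition rV_cons (xy : measurableTypeR R * 'rV[R]_n) : 'rV[R]_n.+1 :=
  row_mx (xy.1 : R)%:M xy.2.

Lemma measurable_rV_cons : measurable_fun setT rV_cons.
Proof.
apply: measurable_fun_coordP => i.
have [j ->|j ->] := split_ordP (i : 'I_(1 + n)).
  rewrite (_ : (fun t => _) = fst)//.
  by apply/funext => t; apply: etrans (row_mxEl _ _ _ _) _; rewrite !ord1 mxE.
rewrite (_ : (fun t => _) = (fun x : 'rV[R]_n => x ord0 j) \o snd).
  exact: measurableT_comp (measurable_coord _) _.
by apply/funext => t; exact: row_mxEr.
Qed.

Definition lebesgue_cons : set 'rV[R]_n.+1 -> \bar R :=
  pushforward ((@lebesgue_measure R) \x mu) rV_cons.

Let lebesgue_cons0 : lebesgue_cons set0 = 0.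
Proof. by rewrite /lebesgue_cons /pushforward preimage_set0 measure0. Qed.

Let lebesgue_cons_ge0 A : 0 <= lebesgue_cons A.
Proof. exact: integral_ge0. Qed.

Let lebesgue_cons_sigma_additive : semi_sigma_additive lebesgue_cons.
Proof.
exact: (@measure_semi_sigma_additive _ _ _
  (measure_function_pushforward__canonical__measure_function_Measure
  _ measurable_rV_cons)).
Qed.

HB.instance Definition _ := isMeasure.Build _ _ _ lebesgue_cons
  lebesgue_cons0 lebesgue_cons_ge0 lebesgue_cons_sigma_additive.

Let lebesgue_cons_sigma_finite : sigma_finite setT lebesgue_cons.
Proof.
have /sigma_finiteP[F [TF ndF Foo]] := sigma_finiteT (@lebesgue_measure R).
have /sigma_finiteP[G [TG ndG Goo]] := sigma_finiteT mu.
pose g (y : 'rV[R]_n.+1) : measurableTypeR R * 'rV[R]_n :=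
  (y ord0 ord0, rsubmx (y : 'rV[R]_(1 + n))).
have mg : measurable_fun setT g.
  apply: measurable_fun_pair; first exact: measurable_coord.
  apply: measurable_fun_coordP => i.
  rewrite (_ : (fun t => _) =
    (fun y : 'rV[R]_n.+1 => y ord0 (rshift 1 i))); last first.
    by apply/funext => t; rewrite mxE.
  exact: measurable_coord.
have gK xy : g (rV_cons xy) = xy.
  case: xy => x y; rewrite /g/rV_cons/=; congr pair; last exact: row_mxKr.
  rewrite (_ : ord0 = lshift n (ord0 : 'I_1)); last exact/val_inj.
  by apply: etrans (row_mxEl _ _ _ _) _; rewrite mxE eqxx mulr1n.
exists (fun k => g @^-1` (F k `*` G k)).
  apply/seteqP; split=> // y _.
  have [i _ Fi] : (\bigcup_i F i) (g y).1 by rewrite -TF.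
  have [j _ Gj] : (\bigcup_i G i) (g y).2 by rewrite -TG.
  exists (maxn i j) => //; split.
    by move: Fi; exact/subsetPset/ndF/leq_maxl.
  by move: Gj; exact/subsetPset/ndG/leq_maxr.
move=> k; have [mF Fk] := Foo k; have [mG Gk] := Goo k; split.
  by rewrite -[X in measurable X]setTI; apply: mg => //; exact: measurableX.
rewrite /lebesgue_cons /pushforward (_ : rV_cons @^-1` _ = F k `*` G k).
  by rewrite product_measure1E// lte_mul_pinfty// ge0_fin_numE.
rewrite -[LHS]/((g \o rV_cons) @^-1` _) (_ : g \o rV_cons = id)//.
by apply/funext => z; exact: gK.
Qed.

HB.instance Definition _ := Measure_isSigmaFinite.Build _ _ _ lebesgue_cons
  lebesgue_cons_sigma_finite.

End lebesgue_step.

Fixpoint lebesgue_rV (R : realType) (n : nat) :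
    {sigma_finite_measure set 'rV[R]_n -> \bar R} :=
  if n is n'.+1 then lebesgue_cons (lebesgue_rV R n')
  else (\d_(0 : 'rV[R]_0))%R.

Section domains.
Context {R : realType} {n : nat}.
Implicit Types (x y : 'rV[R]_n) (U Omega : set 'rV[R]_n).

(* The library norm on 'rV_n is the sup norm. *)
Definition enorm m (x : 'rV[R]_m) : R := Num.sqrt (\sum_i x ord0 i ^+ 2).

(* Near each boundary point, U is, in suitable orthogonal coordinates, the
   strict epigraph of a Lipschitz function of the n-1 other coordinates. *)
Definition lipschitz_boundary U : Prop :=
  forall x, (closure U `\` interior U) x ->
  exists (r L : R) (Q : 'M[R]_n) (j : 'I_n) (g : 'rV[R]_n.-1 -> R),
  [/\ 0 < r, Q *m Q^T = 1%:M,
      forall a b, `|g a - g b| <= L * enorm (a - b) &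
      forall y, enorm (y - x) < r ->
        (U y <-> g (col' j (y *m Q)) < (y *m Q) ord0 j)].

Definition interior_lipschitz Omega : Prop :=
  forall K, compact K -> K `<=` Omega ->
  exists Omega', [/\ open Omega', bounded_set Omega', lipschitz_boundary Omega',
    Omega' `<=` Omega & K `<=` Omega'].

End domains.

Section smooth.
Context {R : realType} {n : nat}.
Implicit Types (f g : 'rV[R]_n -> R) (Omega : set 'rV[R]_n).

Definition partial (i : 'I_n) f : 'rV[R]_n -> R :=
  fun x => 'D_(delta_mx ord0 i) f x.

Fixpoint Ck (k : nat) f : Prop :=
  continuous f /\
  if k is k'.+1 then
    forall i, (forall x, derivable f x (delta_mx ord0 i)) /\ Ck k' (partial i f)
  else True.

Definition smooth f : Prop := forall k, Ck k f.

Definition fsupp f : set 'rV[R]_n := closure [set x | f x != 0].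

(* C_c^oo(Omega), each function being extended by zero to R^n. *)
Definition is_test Omega f : Prop :=
  [/\ smooth f, compact (fsupp f) & fsupp f `<=` Omega].

Lemma Ck_cont k f : Ck k f -> continuous f.
Proof. by case: k => [|k] []. Qed.

Lemma CkS k f : Ck k.+1 f -> Ck k f.
Proof.
elim: k f => [|k ih] f [cf df]; first by split.
by split=> // i; have [d1 d2] := df i; split => //; exact: ih.
Qed.

Lemma Ck0 k : Ck k (0 : 'rV[R]_n -> R).
Proof.
elim: k => [|k ih]; first by split=> //; exact: cst_continuous.
split; first exact: cst_continuous.
move=> i; split=> [x|]; first exact: derivable_cst.
by rewrite (_ : partial i 0 = 0)//; apply/funext => x; exact: derive_cst.
Qed.

Lemma CkD k f g : Ck k f -> Ck k g -> Ck k (f + g).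
Proof.
elim: k f g => [|k ih] f g [cf df] [cg dg].
  by split=> // x; apply: continuousD; [exact: cf|exact: cg].
split; first by move=> x; apply: continuousD; [exact: cf|exact: cg].
move=> i; have [f1 f2] := df i; have [g1 g2] := dg i; split.
  by move=> x; exact: derivableD.
rewrite (_ : partial i _ = partial i f + partial i g); first exact: ih.
by apply/funext => x; exact: deriveD.
Qed.

Lemma CkM k f g : Ck k f -> Ck k g -> Ck k (f * g).
Proof.
elim: k f g => [|k ih] f g Cf Cg.
  case: Cf => cf _; case: Cg => cg _.
  by split=> // x; apply: continuousM; [exact: cf|exact: cg].
have [cf df] := Cf; have [cg dg] := Cg.
split; first by move=> x; apply: continuousM; [exact: cf|exact: cg].
move=> i; have [f1 f2] := df i; have [g1 g2] := dg i; split.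
  by move=> x; exact: derivableM.
rewrite (_ : partial i _ = f * partial i g + g * partial i f).
  by apply: CkD; apply: ih => //; exact: CkS.
by apply/funext => x; exact: deriveM.
Qed.

Lemma Ck_cst k (a : R) : Ck k (fun=> a).
Proof.
case: k => [|k]; first by split=> //; exact: cst_continuous.
split; first exact: cst_continuous.
move=> i; split=> [x|]; first exact: derivable_cst.
rewrite (_ : partial i _ = 0); first exact: Ck0.
by apply/funext => x; exact: derive_cst.
Qed.

Lemma partial_smooth i f : smooth f -> smooth (partial i f).
Proof. by move=> sf k; have [_ /(_ i)[]] := sf k.+1. Qed.

Lemma fsupp_partial i f : fsupp (partial i f) `<=` fsupp f.
Proof.
rewrite [X in _ `<=` X](closure_id _).1; last exact: closed_closure.
apply: closure_subset => x /=; apply: contra_neqP => /= nx.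
rewrite /partial (near_eq_derive _ (g := cst 0)) ?derive_cst//.
have : nbhs x (~` fsupp f).
  by apply: open_nbhs_nbhs; split => //; exact/closed_openC/closed_closure.
apply: filterS => y /= ny; apply/eqP; apply: contra_notT ny => ?.
exact: subset_closure.
Qed.

Lemma is_test_sub Omega f g : is_test Omega f -> smooth g ->
  fsupp g `<=` fsupp f -> is_test Omega g.
Proof.
move=> [_ cf fO] sg gf; split=> //; last exact: subset_trans fO.
exact: subclosed_compact (@closed_closure _ _) cf gf.
Qed.

Lemma is_testM Omega f g : is_test Omega f -> smooth g -> is_test Omega (f * g).
Proof.
move=> tf sg; apply: (is_test_sub tf).
  by case: tf => sf _ _ k; exact: CkM.
apply: closure_subset => x /=; apply: contra_neq => fx0.
by rewrite mulrfctE fx0 mul0r.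
Qed.

Lemma is_test_partial Omega i f : is_test Omega f -> is_test Omega (partial i f).
Proof.
move=> tf; apply: (is_test_sub tf); last exact: fsupp_partial.
by case: tf => sf _ _; exact: partial_smooth.
Qed.

Definition test_pred Omega : {pred 'rV[R]_n -> R^o} :=
  fun f => `[< is_test Omega f >].

Lemma test_pred_submod Omega : submod_closed (test_pred Omega).
Proof.
split.
  rewrite inE; have fs0 : fsupp (0 : 'rV[R]_n -> R) = set0.
    rewrite /fsupp (_ : [set x | _] = set0) ?closure0//.
    by apply/seteqP; split=> x //=; rewrite eqxx.
  by split; [move=> k; exact: Ck0|rewrite fs0; exact: compact0|rewrite fs0].
move=> a f g; rewrite !inE => -[sf cf fO] [sg cg gO].
have sub : fsupp (a *: f + g) `<=` fsupp f `|` fsupp g.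
  rewrite /fsupp -closureU; apply: closure_subset => x /=.
  apply: contra_neqP => /not_orP[/negP/negPn/eqP fx /negP/negPn/eqP gx].
  by rewrite -[LHS]/(a * f x + g x) fx gx mulr0 addr0.
split.
- move=> k; apply: CkD => //.
  rewrite (_ : a *: f = (fun=> a) * f)//.
  by apply: CkM => //; exact: Ck_cst.
- apply: subclosed_compact sub; first exact: closed_closure.
  exact: compactU.
- by apply: subset_trans sub _; rewrite subUset.
Qed.

End smooth.

HB.instance Definition _ (R : realType) (n : nat) (Omega : set 'rV[R]_n) :=
  GRing.isSubmodClosed.Build R ('rV[R]_n -> R^o) (test_pred Omega)
    (test_pred_submod Omega).

Section testfun.
Context {R : realType} {n : nat} (Omega : set 'rV[R]_n).

Record testfun := TestFun {
  testfun_val :> 'rV[R]_n -> R^o ;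
  testfunP : testfun_val \in test_pred Omega }.

HB.instance Definition _ := [isSub for testfun_val].
HB.instance Definition _ := [Choice of testfun by <:].
HB.instance Definition _ := [SubChoice_isSubLmodule of testfun by <:].

Lemma testfun_is_test (f : testfun) : is_test Omega f.
Proof. by have := testfunP f; rewrite inE. Qed.

Lemma tpartial_subproof i (f : testfun) : partial i f \in test_pred Omega.
Proof. by rewrite inE; apply/is_test_partial/testfun_is_test. Qed.

Definition tpartial i (f : testfun) : testfun := TestFun (tpartial_subproof i f).

Lemma tmul_subproof (f g : testfun) :
  (fun x => f x * g x) \in test_pred Omega.
Proof.
rewrite inE; apply: is_testM (testfun_is_test _) _.
by case: (testfun_is_test g).
Qed.

Definition tmul (f g : testfun) : testfun := TestFun (tmul_subproof f g).

Definition tderive (nu : 'I_n -> nat) (f : testfun) : testfun :=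
  foldr (fun i h => iter (nu i) (tpartial i) h) f (enum 'I_n).

End testfun.

Section sobolev.
Context {R : realType} {n : nat} (Omega : set 'rV[R]_n).
Implicit Types (phi psi : testfun Omega) (u v : testfun Omega -> R^o)
  (f : 'rV[R]_n -> R) (s p theta : R) (k : nat).
Local Notation mu := (lebesgue_rV R n).

Definition mindex_order (nu : 'I_n -> nat) : nat := \sum_i nu i.

(* Linearity, and continuity on each C_K^oo, K a compact subset of Omega. *)
Definition distribution u : Prop :=
  linear u /\
  forall K, compact K -> K `<=` Omega -> exists (C : R) (N : nat),
    forall phi (M : R), fsupp phi `<=` K ->
      (forall nu x, (mindex_order nu <= N)%N -> `|tderive nu phi x| <= M) ->
      `|u phi| <= C * M.

Definition dmul phi u : testfun Omega -> R^o := fun psi => u (tmul phi psi).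

Definition dderive (nu : 'I_n -> nat) u : testfun Omega -> R^o :=
  fun psi => (-1) ^+ mindex_order nu * u (tderive nu psi).

Definition regular f : testfun Omega -> R^o :=
  fun psi => \int[mu]_(x in Omega) (f x * psi x).

Local Open Scope ereal_scope.

Definition Lp_norm p f : \bar R := 'N[mu]_(p%:E)[EFin \o (f \_ Omega)].

Definition represents p f u : Prop :=
  [/\ measurable_fun Omega f, Lp_norm p f < +oo & u = regular f].

Definition slobodeckij p theta f : \bar R :=
  (\int[mu \x mu]_(z in Omega `*` Omega)
     (`|f z.1 - f z.2| `^ p /
      enorm (z.1 - z.2) `^ (n%:R + theta * p))%R%:E) `^ p^-1.

(* Functions are identified with the distributions they define. Two functions
   representing u agree almost everywhere on Omega, so each infimum below is
   over at most one value, and is +oo when u is not given by an L^p function. *)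
Definition dLp_norm p u : \bar R :=
  ereal_inf [set Lp_norm p f | f in [set f | represents p f u]].

Definition dslobodeckij p theta u : \bar R :=
  ereal_inf [set slobodeckij p theta f | f in [set f | represents p f u]].

(* The norm of W^{s,p}(Omega) for s >= 0, with value +oo outside the space. *)
Definition Wnorm_ge0 s p u : \bar R :=
  let k := Num.truncn s in
  let theta := (s - k%:R)%R in
  \sum_(nu : {ffun 'I_n -> 'I_k.+1} | (mindex_order (val \o nu) <= k)%N)
     dLp_norm p (dderive (val \o nu) u) +
  if theta == 0%R then 0 else
    \sum_(nu : {ffun 'I_n -> 'I_k.+1} | mindex_order (val \o nu) == k)
       dslobodeckij p theta (dderive (val \o nu) u).

Definition Wspace_ge0 s p : set (testfun Omega -> R^o) :=
  [set u | distribution u /\ Wnorm_ge0 s p u < +oo].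

Definition W0space s p : set (testfun Omega -> R^o) :=
  [set u | Wspace_ge0 s p u /\
    forall e : R, (0 < e)%R ->
      exists phi, Wnorm_ge0 s p (u - regular phi)%R < e%:E].

Definition conj_exp p : R := ((1 - p^-1)^-1)%R.

Definition linear_on (D : set (testfun Omega -> R^o))
    (F : (testfun Omega -> R^o) -> R) : Prop :=
  forall (a : R) v w, D v -> D w -> F (a *: v + w)%R = (a * F v + F w)%R.

Definition dual_norm s p (F : (testfun Omega -> R^o) -> R) : \bar R :=
  ereal_sup [set `|F v|%:E | v in
    [set v | W0space s p v /\ Wnorm_ge0 s p v <= 1]].

(* The norm of W^{s,p}(Omega) for s < 0, with value +oo outside the space: u is
   the restriction to test functions of a functional on W^{-s,p'}_0(Omega),
   which is unique by density when it is bounded. *)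
Definition Wnorm_lt0 s p u : \bar R :=
  ereal_inf [set dual_norm (- s) (conj_exp p) F | F in
    [set F | linear_on (W0space (- s) (conj_exp p)) F /\
             forall psi, F (regular psi) = u psi]].

Definition Wnorm s p u : \bar R :=
  if (0 <= s)%R then Wnorm_ge0 s p u else Wnorm_lt0 s p u.

Definition Wspace s p : set (testfun Omega -> R^o) :=
  [set u | distribution u /\ Wnorm s p u < +oo].

Definition smooth_mult_triple s p : Prop :=
  forall phi,
    (forall u, Wspace s p u -> Wspace s p (dmul phi u)) /\
    exists C : R, forall u, Wspace s p u ->
      Wnorm s p (dmul phi u) <= C%:E * Wnorm s p u.

End sobolev.

Definition compactly_embedded (R : realType) (n : nat) (U : set 'rV[R]_n)
    (s1 p1 s2 p2 : R) : Prop :=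
  [/\ @Wspace R n U s1 p1 `<=` Wspace s2 p2,
      exists C : R, forall u, @Wspace R n U s1 p1 u ->
        (Wnorm s2 p2 u <= C%:E * Wnorm s1 p1 u)%E &
      forall (u : nat -> testfun U -> R^o) (M : R),
        (forall i, Wspace s1 p1 (u i) /\ (Wnorm s1 p1 (u i) <= M%:E)%E) ->
        exists2 g : nat -> nat, {homo g : i j / (i < j)%N} &
        exists2 l, Wspace s2 p2 l &
          Wnorm s2 p2 (u (g i) - l)%R @[i --> \oo] --> 0%E].

Section local_space.
Context {R : realType} {n : nat} (s p : R) (Omega : set 'rV[R]_n).

Record Wloc := MkWloc {
  wloc_val :> testfun Omega -> R^o ;
  wloc_distribution : distribution wloc_val ;
  wlocP : forall phi, Wspace s p (dmul phi wloc_val) }.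

HB.instance Definition _ := gen_eqMixin Wloc.
HB.instance Definition _ := gen_choiceMixin Wloc.

Definition wloc_open (A : set Wloc) : Prop :=
  forall u : Wloc, A u ->
  exists2 e : R, 0 < e & exists l : seq (testfun Omega),
    forall v : Wloc,
      {in l, forall phi, (Wnorm s p (dmul phi (wloc_val v - wloc_val u)%R) < e%:E)%E} ->
      A v.

Let wloc_openT : wloc_open setT.
Proof. by move=> u _; exists 1 => //; exists [::]. Qed.

Let wloc_openI : setI_closed wloc_open.
Proof.
move=> A B oA oB u [/oA[e e0 [l lA]] /oB[e' e'0 [l' l'B]]].
exists (Num.min e e'); first by rewrite lt_min e0.
exists (l ++ l') => v H; split.
- apply: lA => phi phil; apply: lt_le_trans (H phi _) _.
    by rewrite mem_cat phil.
  by rewrite lee_fin ge_min lexx.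
- apply: l'B => phi phil; apply: lt_le_trans (H phi _) _.
    by rewrite mem_cat phil orbT.
  by rewrite lee_fin ge_min lexx orbT.
Qed.

Let wloc_open_bigU (I : Type) (F : I -> set Wloc) :
  (forall i, wloc_open (F i)) -> wloc_open (\bigcup_i F i).
Proof.
move=> oF u [i _ /(oF i)[e e0 [l lF]]]; exists e => //; exists l => v /lF Fv.
by exists i.
Qed.

HB.instance Definition _ :=
  isOpenTopological.Build Wloc wloc_openT wloc_openI wloc_open_bigU.

End local_space.

Definition wloc_bounded (R : realType) (n : nat) (s p : R)
    (Omega : set 'rV[R]_n) (Y : set (Wloc s p Omega)) : Prop :=
  forall U : set (Wloc s p Omega), open U ->
  (exists2 z : Wloc s p Omega, U z & wloc_val z = 0) ->
  exists2 t : R, 0 < t &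
    forall y, Y y ->
      exists2 w : Wloc s p Omega, U w & wloc_val y = t *: wloc_val w.

(* Main.v *)
(* A bounded sequence u_i is localized by a test function phi: phi u_i, restricted
   to a bounded Lipschitz set V with supp phi in V, is bounded in W^{s1,p1}(V), so
   a subsequence converges in W^{s2,p2}(V); multiplying by a cutoff chi, equal to 1
   near supp phi and supported in V, carries the limit back to Omega.

   For s1 < 0 the restriction estimate is dual to the bound
   |chi psi|_{W^{sigma,q}(Omega)} <= C |psi|_{W^{sigma,q}(V)}, psi in C_c^oo(V).
   By Leibniz, the top order part of the seminorm is controlled by the seminorm of
   psi because chi vanishes outside V, and the rest, being a test function, by
   W^{1,q}(R^n) in W^{theta,q}(R^n). For s2 >= 0 the extension by chi commutes with
   derivatives on distributions supported in supp phi; for s2 < 0 it is dual to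
   multiplication by chi on W^{-s2,p2'}(Omega).

   A diagonal argument over cutoffs phi_j exhausting Omega gives one subsequence
   converging in the sense of distributions. For every phi, any subsequence of
   phi u_{g i} has a further subsequence converging in W^{s2,p2}(Omega),
   necessarily to phi l, whence norm convergence of phi u_{g i} to phi l. *)
Require Import Defs.
From HB Require Import structures.
From mathcomp Require Import all_boot all_order all_algebra.
From mathcomp Require Import all_classical all_reals all_analysis.
From mathcomp Require Import measurable_realfun.
From mathcomp Require Import ring lra.
Import Order.TTheory GRing.Theory Num.Theory.
Import numFieldNormedType.Exports.
(* [distribution] is otherwise the law of a random variable. *)
Import Defs.
Local Open Scope classical_set_scope.
Local Open Scope ring_scope.
Set Implicit Arguments.
Unset Strict Implicit.
Unset Printing Implicit Defensive.

(** * Lebesgue measure on R^n *)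

Section measure_rV.
Context {R : realType}.

(** All norms are extended-real infima: over representing functions when s >= 0, over functionals on
    W_0 when s < 0. Two facts make them usable. A regular distribution determines its function
    almost everywhere ([regular_inj_ae]), so every representative computes the L^p norm. And for s <
    0, [Wnorm_lt0_bound] and [Wnorm_lt0_le] say that a linear w has norm at most A, where A >= 0,
    exactly when |w psi| <= A |psi| for all test functions psi; estimates of negative order thus
    become estimates on test functions.

    This is why the product estimate is stated for test functions: the lower-order Leibniz terms of
    chi psi have compact support in V, so they can be measured on all of R^n, by translation
    differences, without regard to the boundary of V or Omega.

    Limits found with different cutoffs are compared through pairings: for every order s, |w psi| is
    bounded by a constant times the norm of w ([Wnorm_pairing_bound]), so norm convergence forces
    convergence against each psi. The same bound shows that a limit on V is still supported where
    phi is, as the extension estimate requires. *)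

Lemma measurable_box n (A : 'I_n -> set R) :
  (forall i, measurable (A i)) ->
  measurable [set x : 'rV[R]_n | forall i, A i (x ord0 i)].
Proof.
move=> mA; rewrite (_ : [set x | _] =
    \bigcap_(i in setT) ((fun x : 'rV[R]_n => x ord0 i) @^-1` A i)); last first.
  by apply/seteqP; split=> x h i => [_|]; exact: h.
apply: fin_bigcap_measurable => // i _.
by rewrite -[X in measurable X]setTI; apply: measurable_coord => //; exact: mA.
Qed.

Lemma ball_rVE n (x : 'rV[R]_n) (e : R) : 0 < e ->
  ball x e = [set y | forall i, ball (x ord0 i) e (y ord0 i)].
Proof.
move=> e0; apply/seteqP; split=> y /=; first by case=> _ h i; apply: h.
by move=> h; split=> // i j; rewrite ord1.
Qed.

Lemma measurable_ball_rV n (x : 'rV[R]_n) (e : R) : measurable (ball x e).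
Proof.
have [e0|e0] := ltP 0 e; last first.
  rewrite (_ : ball x e = set0)//; apply/seteqP; split=> y //= -[].
  by rewrite ltNge e0.
rewrite ball_rVE//.
apply: (@measurable_box n (fun i => ball (x ord0 i) e)) => i.
by rewrite ball_itv; exact: measurable_itv.
Qed.

(** Countably many sup-norm balls, with rational centres and radii 1/(k+1), suffice to fill A, and
    each is a box. [F] returns the empty set for balls that stick out of A, so that the union runs
    over a countable type. *)
Lemma open_measurable_rV n (A : set 'rV[R]_n) : open A -> measurable A.
Proof.
move=> oA.
pose F (q : 'rV[rat]_n * nat) : set 'rV[R]_n :=
  let B := ball (map_mx ratr q.1 : 'rV[R]_n) q.2.+1%:R^-1 in
  if `[< B `<=` A >] then B else set0.
rewrite (_ : A = \bigcup_q F q); last first.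
  apply/seteqP; split=> [x Ax|x [q _]]; last first.
    by rewrite /F; case: ifPn => // /asboolP; apply.
  have /nbhs_ballP[e e0 xeA] : nbhs x A by exact: open_nbhs_nbhs.
  have [k] : exists k, k.+1%:R^-1 < e / 2.
    have e20 : 0 < e / 2 by rewrite divr_gt0.
    have [k _ hk] := near_infty_natSinv_lt (PosNum e20).
    by exists k; apply: hk => /=.
  move=> ke.
  have k0 : (0 : R) < k.+1%:R^-1 by rewrite invr_gt0.
  have /choice[q hq] : forall i, exists q : rat,
      `|x ord0 i - ratr q| < k.+1%:R^-1.
    move=> i; have [|q] := @rat_in_itvoo R (x ord0 i - k.+1%:R^-1) (x ord0 i).
      by rewrite ltrBlDr ltrDl.
    rewrite in_itv/= => /andP[q1 q2]; exists q.
    by rewrite ger0_norm ?subr_ge0 ?ltW// ltrBlDr -ltrBlDl.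
  exists (\row_i q i, k) => //.
  rewrite /F/=; case: ifPn => [_|/asboolP].
    by rewrite ball_rVE// => i; rewrite /ball/= !mxE distrC.
  case=> y; rewrite ball_rVE// => hy; apply: xeA.
  rewrite ball_rVE// => i; have := hy i; rewrite /ball/= !mxE => hyi.
  rewrite (splitr e) -(subrK (ratr (q i)) (x ord0 i)) -addrA.
  by rewrite (le_lt_trans (ler_normD _ _))// ltrD// (lt_trans _ ke)//.
apply: countable_bigcupT_measurable => // q.
by rewrite /F; case: ifPn => // _; exact: measurable_ball_rV.
Qed.

Lemma closed_measurable_rV n (A : set 'rV[R]_n) : closed A -> measurable A.
Proof.
by move=> cA; rewrite -(setCK A); apply: measurableC;
  apply: open_measurable_rV; exact: closed_openC.
Qed.

Lemma continuous_measurable_rV n (f : 'rV[R]_n -> R) :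
  continuous f -> measurable_fun setT f.
Proof.
move=> /continuousP cf; apply: (measurability _ (measurable_realfun.RGenOpens.measurableE R)) => //.
move=> _ [_ [a [b ->] <-]]; rewrite setTI.
by apply: open_measurable_rV; apply: cf; exact: interval_open.
Qed.

Lemma measurable_shift_rV n (h : 'rV[R]_n) :
  measurable_fun setT (fun x : 'rV[R]_n => x + h).
Proof.
apply: measurable_fun_coordP => i.
rewrite (_ : (fun _ => _) = (fun x : 'rV[R]_n => x ord0 i + h ord0 i)).
  by apply: measurable_funD => //; exact: measurable_coord.
by apply/funext => x; rewrite mxE.
Qed.

(** The image measure under the translation agrees with Lebesgue measure on half-open intervals,
    which determine it. *)
Lemma lebesgue_measure_shift (h : R) (A : set R) : measurable A ->
  lebesgue_measure ((fun x : R => x + h) @^-1` A) = lebesgue_measure A.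
Proof.
have ms : measurable_fun setT (fun x : measurableTypeR R => x + h : measurableTypeR R).
  by apply: (@measurable_funD _ (measurableTypeR R)).
move=> mA; pose m := measure_function_pushforward__canonical__measure_function_Measure
  (@lebesgue_measure R) ms.
rewrite [RHS](@lebesgue_measure_unique R m)// => X [[a b] /= ab <-] /=.
rewrite lebesgue_measure_itv/= /pushforward.
rewrite (_ : _ @^-1` _ = `]a - h, b - h]%classic).
  by rewrite lebesgue_measure_itv/= !lte_fin ltrD2r -!EFinB opprB addrA subrK.
apply/seteqP; split=> x /=; rewrite !in_itv/=;
 by rewrite -ltrBlDr -lerBrDr.
Qed.

(** A translation of R^(n+1) acts separately on the first coordinate and on the remaining n, so
    uniqueness of the product measure reduces the claim to rectangles. *)
Lemma lebesgue_rV_shift n (h : 'rV[R]_n) (A : set 'rV[R]_n) : measurable A ->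
  lebesgue_rV R n ((fun x => x + h) @^-1` A) = lebesgue_rV R n A.
Proof.
elim: n h A => [|n ih] h A mA.
  rewrite (_ : _ @^-1` _ = A)//.
  by apply/seteqP; split=> x /=; rewrite [h]thinmx0 addr0.
rewrite /= /lebesgue_cons /pushforward.
pose mu := lebesgue_rV R n.
pose T (z : measurableTypeR R * 'rV[R]_n) : measurableTypeR R * 'rV[R]_n :=
  (z.1 + h ord0 ord0, z.2 + rsubmx (h : 'rV[R]_(1 + n))).
have mT : measurable_fun setT T.
  apply: measurable_fun_pair.
    by apply: measurable_funD => //.
  exact: measurableT_comp (measurable_shift_rV _) _.
pose m' := measure_function_pushforward__canonical__measure_function_Measure
  ((@lebesgue_measure R) \x mu)%E mT.
have TE z : rV_cons z + h = rV_cons (T z).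
  case: z => x y; rewrite /T/rV_cons/=.
  apply/rowP => i; rewrite !mxE.
  case: splitP => k ik.
    by rewrite !ord1 !mxE !mulr1n; congr (_ + h _ _); apply/val_inj; rewrite /= ik ord1.
  by rewrite !mxE; congr (_ + h _ _); apply/val_inj; rewrite /= ik.
rewrite (_ : _ @^-1` _ = T @^-1` (@rV_cons R n @^-1` A)); last first.
  by apply/seteqP; split=> z /=; rewrite TE.
rewrite -[LHS]/(m' _) -[LHS](product_measure_unique (m1 := @lebesgue_measure R) (m2 := mu))//.
move=> B C mB mC; rewrite /m'/=/pushforward.
rewrite (_ : T @^-1` _ = ((fun x => x + h ord0 ord0) @^-1` B) `*`
   ((fun y => y + rsubmx (h : 'rV[R]_(1 + n))) @^-1` C))//.
rewrite product_measure1E; last 2 first.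
  rewrite -[X in measurable X]setTI.
  by apply: measurable_funD.
  rewrite -[X in measurable X]setTI.
  by apply: measurable_shift_rV.
  by congr (_ * _)%E; [exact: lebesgue_measure_shift|exact: ih].
by rewrite -[X in measurable X]setTI; exact: measurable_rV_cons.
Qed.

Lemma ge0_integral_rV_shift n (h : 'rV[R]_n) (f : 'rV[R]_n -> \bar R) :
  measurable_fun setT f -> (forall x, 0 <= f x)%E ->
  (\int[lebesgue_rV R n]_x f (x + h)%R = \int[lebesgue_rV R n]_x f x)%E.
Proof.
move=> mf f0.
have := @ge0_integral_pushforward _ _ _ _ R _ (measurable_shift_rV h)
  (lebesgue_rV R n) setT f measurableT mf (fun y _ => f0 y).
rewrite preimage_setT => <-.
apply: eq_measure_integral => [|ms A mA _]; first exact: measurable_shift_rV.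
exact: lebesgue_rV_shift.
Qed.

Lemma lebesgue_rV_cube n (r : R) : 0 <= r ->
  lebesgue_rV R n [set x | forall i, `|x ord0 i| <= r] = ((r *+ 2) ^+ n)%:E.
Proof.
move=> r0; elim: n => [|n ih].
  rewrite /= diracE expr0 mem_set//= => -[]//.
rewrite /= /lebesgue_cons /pushforward.
rewrite (_ : _ @^-1` _ = `[- r, r]%classic `*` [set x : 'rV[R]_n | forall i, `|x ord0 i| <= r]).
  rewrite product_measure1E//; last first.
    rewrite (_ : [set x | _] = [set x : 'rV[R]_n | forall i, `[- r, r]%classic (x ord0 i)]).
      by apply: (@measurable_box n (fun=> `[- r, r]%classic)) => i; exact: measurable_itv.
    by apply/seteqP; split => x /= h i; have := h i; rewrite ?in_itv/= ler_norml.
  rewrite ih exprS EFinM; congr (_ * _)%E.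
  rewrite -[LHS]/(@lebesgue_measure R `[- r, r]%classic) lebesgue_measure_itv/= lte_fin.
  have [r1|] := ltP (- r) r; first by rewrite -EFinB opprK mulr2n.
  move=> rr; rewrite (_ : r = 0) ?mul0rn//; lra.
apply/seteqP; split=> -[x y] /=.
  move=> h; split.
    have := h ord0; rewrite /rV_cons/= mxE; case: splitP => // k k0.
    by rewrite !ord1 mxE in_itv/= -ler_norml mulr1n.
  move=> i; have := h (rshift 1 i : 'I_(1 + n)).
  by rewrite (_ : rV_cons _ _ _ = y ord0 i)//; exact: row_mxEr.
rewrite in_itv/= -ler_norml => -[hx hy] i; rewrite /rV_cons mxE.
case: splitP => k ik; last exact: hy.
by rewrite !ord1 mxE mulr1n.
Qed.

End measure_rV.

(** * Test functions *)

Section smooth_bumps.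
Context {R : realType}.

(** Reduces partial derivatives to derivatives of functions of one real variable, where the chain
    rule and the mean value theorem are available. *)
Lemma is_derive_line n (f : 'rV[R]_n -> R) x v (t : R) d :
  is_derive t (1 : R) (fun h : R => f (h *: v + x)) d <->
  is_derive (t *: v + x) v f d.
Proof.
have E : (fun h : R => h^-1 *: (((fun h : R => f (h *: v + x)) \o shift t) (h *: (1 : R)) -
      f (t *: v + x))) =
    (fun h : R => h^-1 *: ((f \o shift (t *: v + x)) (h *: v) - f (t *: v + x))).
  apply/funext => h /=; congr (_ *: (f _ - f _)).
  by rewrite [h *: 1]mulr1 scalerDl addrA.
split=> -[d1 d2]; split.
- by move: d1; rewrite /derivable E.
- by move: d2; rewrite /derive E.
- by rewrite /derivable E.
- by rewrite /derive E.
Qed.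

(** Handles the flat point 0 of [flat_exp], where no formula holds on both sides: the bound forces f
    0 = 0 and difference quotients of size C |h|. *)
Lemma is_derive_square_bound (f : R -> R) (C : R) :
  (forall x, `|f x| <= C * x ^+ 2) -> is_derive (0 : R) (1 : R) f 0.
Proof.
move=> fC; have f0 : f 0 = 0.
  by apply/eqP; rewrite -normr_le0; have := fC 0; rewrite expr0n mulr0.
have C0 : 0 <= C by have := fC 1; rewrite expr1n mulr1; exact: le_trans.
suff h : h^-1 *: ((f \o shift 0) (h *: (1 : R)) - f 0) @[h --> 0^'] --> (0 : R).
  by split; [exact: cvgP h|exact: cvg_lim h].
apply/cvgr0Pnorm_lt => e e0.
have Ce : 0 < e / (C + 1) by rewrite divr_gt0// ltr_wpDl.
near=> h.
have h0 : h != 0 by near: h; exact: nbhs_dnbhs_neq.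
rewrite /= f0 subr0 addr0 [h *: 1]mulr1 [_ *: _]mulrC normrM normfV.
rewrite ltr_pdivrMr ?normr_gt0//; apply: le_lt_trans (fC h) _.
rewrite -real_normK ?num_real// expr2 mulrA ltr_pM2r ?normr_gt0//.
have : `|h| < e / (C + 1).
  by near: h; apply: dnbhs0_lt.
rewrite ltr_pdivlMr ?ltr_wpDl//; apply: le_lt_trans.
by rewrite mulrC ler_wpM2l// lerDl.
Unshelve. all: by end_near. Qed.

(** The powers x^-m are carried along with exp(-1/x) so that the family is closed under
    differentiation. *)
Definition flat_exp (m : nat) (x : R) : R :=
  if 0 < x then x ^- m * expR (- x^-1) else 0.

(** The exponential series gives exp(1/x) >= x^-(m+2) / (m+2)!, which absorbs x^-m and leaves a
    factor x^2. *)
Lemma flat_exp_bound m x : `|flat_exp m x| <= (m.+2)`!%:R * x ^+ 2.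
Proof.
rewrite /flat_exp; case: ifPn => x0; last by rewrite normr0 mulr_ge0// sqr_ge0.
rewrite ger0_norm; last by rewrite mulr_ge0 ?expR_ge0// invr_ge0 exprn_ge0// ltW.
have x'0 : 0 <= x^-1 by rewrite invr_ge0 ltW.
have := expR_ge1Dxn m.+1 x'0.
move=> /(le_trans (ler_wpDl ler01 (lexx _))) h.
rewrite expRN -invfM -[leLHS]mul1r.
rewrite ler_pdivrMr ?mulr_gt0 ?exprn_gt0 ?expR_gt0//.
apply: (@le_trans _ _ ((m.+2)`!%:R * x ^+ 2 * (x ^+ m * (x^-1 ^+ m.+2 / m.+2`!%:R)))).
  rewrite exprVn !exprS.
  rewrite le_eqVlt; apply/orP; left; apply/eqP.
  have fn0 : (m.+2)`!%:R != 0 :> R by rewrite pnatr_eq0 -lt0n fact_gt0.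
  have xn0 : x != 0 by rewrite gt_eqF.
  have xm0 : x ^+ m != 0 by rewrite expf_neq0.
  by field; rewrite fn0 xn0 xm0.
apply: ler_wpM2l; first by rewrite mulr_ge0 ?sqr_ge0.
by apply: ler_wpM2l => //; rewrite exprn_ge0// ltW.
Qed.

Lemma is_derive_flat_exp m (x : R) : is_derive x (1 : R) (flat_exp m)
  (- m%:R * flat_exp m.+1 x + flat_exp m.+2 x).
Proof.
have [x0|x0|<-] := ltgtP 0 x.
- apply: (@near_eq_is_derive _ _ _ (fun x : R => x ^- m * expR (- x^-1))).
    near=> y; rewrite /flat_exp ifT//; near: y; exact: lt_nbhsr.
  rewrite /flat_exp x0.
  have xn0 : x != 0 by rewrite gt_eqF.
  have dV : is_derive x (1 : R) (fun x : R => x^-1) (- x ^- 2).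
    apply: (is_derive_eq (@is_deriveV R id x 1 1 xn0 (is_derive_id _ _))).
    by rewrite [_ *: _]mulr1.
  have dE : is_derive x (1 : R) (fun x => expR (- x^-1)) (expR (- x^-1) * x ^- 2).
    apply: (is_derive_eq
      (@is_derive1_comp R expR (fun x => - x^-1) x _ _ (is_derive_expR _) (is_deriveN dV))).
    by rewrite opprK.
  have dm : is_derive x (1 : R) (fun x : R => x ^- m) (- m%:R * x ^- m.+1).
    case: m => [|m].
      rewrite (_ : (fun _ => _) = cst 1); last by apply/funext => y; rewrite expr0 invr1.
      by apply: is_derive_eq; rewrite ?oppr0 ?mul0r.
    have xm1 : x ^+ m.+1 != 0 by rewrite expf_neq0.
    have dX : is_derive x (1 : R) (fun x : R => x ^+ m.+1) (m.+1%:R * x ^+ m).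
      rewrite (_ : (fun _ => _) = (id : R -> R) ^+ m.+1); last first.
        by apply/funext => y; rewrite exprfctE.
      apply: (is_derive_eq (@is_deriveX R R id m.+1 x 1 1 (is_derive_id _ _))).
      by rewrite [_ *: _]mulr1.
    apply: (is_derive_eq (@is_deriveV R (fun x => x ^+ m.+1) x _ 1 xm1 dX)).
    rewrite [_ *: _]mulrA !exprS.
    have xm0 : x ^+ m != 0 by rewrite expf_neq0.
    by field; rewrite xn0 xm0.
  apply: (is_derive_eq (is_deriveM dm dE)).
  have xm0 : x ^+ m != 0 by rewrite expf_neq0.
  rewrite /= ![_ *: _]mulrA !exprS.
  by field; rewrite xn0 xm0.
- apply: (@near_eq_is_derive _ _ _ (cst 0)).
    near=> y; rewrite /flat_exp ifF//; apply/negbTE; rewrite -leNgt ltW//.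
    by near: y; exact: lt_nbhsl.
  rewrite /flat_exp ltNge (ltW x0)/= mulr0 addr0; exact: is_derive_cst.
- rewrite /flat_exp !ltxx mulr0 addr0.
  apply: is_derive_square_bound; exact: flat_exp_bound.
Unshelve. all: by end_near. Qed.

Lemma continuous_flat_exp m : continuous (flat_exp m).
Proof.
move=> x; apply: differentiable_continuous; apply/derivable1_diffP.
by have [] := is_derive_flat_exp m x.
Qed.

Lemma flat_exp_ge0 m x : 0 <= flat_exp m x.
Proof.
rewrite /flat_exp; case: ifPn => // x0.
by rewrite mulr_ge0 ?expR_ge0// invr_ge0 exprn_ge0// ltW.
Qed.

Lemma flat_exp_gt0 m x : (0 < flat_exp m x) = (0 < x).
Proof.
rewrite /flat_exp; case: ifPn => x0; last by rewrite ltxx.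
by rewrite mulr_gt0 ?expR_gt0// invr_gt0 exprn_gt0.
Qed.

(** The index m is generalised in the induction on k because each derivative raises it to m+1 and
    m+2. *)
Lemma Ck_flat_exp n k m (i : 'I_n) (a b : R) :
  Ck k (fun y : 'rV[R]_n => flat_exp m (a * y ord0 i + b)).
Proof.
elim: k m => [|k ih] m.
  split=> // x; apply: (@continuous_comp _ _ _ (fun y : 'rV[R]_n => a * y ord0 i + b)).
    apply: continuousD; last exact: cst_continuous.
    apply: continuousM; first exact: cst_continuous.
    exact: coord_continuous.
  exact: continuous_flat_exp.
split; first exact: Ck_cont (ih m).
move=> j.
pose c : R := a * (delta_mx ord0 j : 'rV[R]_n) ord0 i.
have dj x : is_derive x (delta_mx ord0 j : 'rV[R]_n)
    (fun y : 'rV[R]_n => flat_exp m (a * y ord0 i + b))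
    ((- m%:R * flat_exp m.+1 (a * x ord0 i + b) + flat_exp m.+2 (a * x ord0 i + b)) * c).
  rewrite -[x in is_derive x](add0r x) -(scale0r (delta_mx ord0 j : 'rV[R]_n)).
  apply/is_derive_line.
  rewrite (_ : (fun _ => _) = flat_exp m \o (fun h : R => h * c + (a * x ord0 i + b))); last first.
    by apply/funext => h /=; rewrite mxE [X in _ * (X + _)]mxE; congr flat_exp; rewrite /c; ring.
  apply: is_derive1_comp.
    by rewrite mul0r add0r; exact: is_derive_flat_exp.
  apply: (is_derive_eq (is_deriveD (@is_deriveM R R id (cst c) 0 1 1 0
    (is_derive_id _ _) (is_derive_cst _ _ _)) (is_derive_cst _ _ _))).
  by rewrite /= !addr0 [_ *: _]mulr0 add0r [_ *: _]mulr1.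
split=> [x|]; first by have [] := dj x.
rewrite (_ : partial j _ = (fun=> c) * ((fun=> - m%:R) *
   (fun x => flat_exp m.+1 (a * x ord0 i + b)) + (fun x => flat_exp m.+2 (a * x ord0 i + b)))); last first.
  by apply/funext => x; rewrite /partial (derive_val (is_derive := dj x)) mulrC.
by apply: CkM; [exact: Ck_cst|apply: CkD => //; apply: CkM => //; exact: Ck_cst].
Qed.

Lemma CkV n k (f : 'rV[R]_n -> R) : (forall x, f x != 0) -> Ck k f ->
  Ck k (fun x => (f x)^-1).
Proof.
move=> f0; elim: k => [|k ih] Cf.
  by have cf := Ck_cont Cf; split=> // x; exact: (continuousV (f0 x) (cf x)).
have [cf df] := Cf.
split; first by move=> x; exact: (continuousV (f0 x) (cf x)).
move=> i; have [d1 d2] := df i; split.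
  by move=> x; exact: derivableV.
have Ci := ih (CkS Cf).
rewrite (_ : partial i _ = (fun=> -1) * ((fun x => (f x)^-1) * (fun x => (f x)^-1)) * partial i f).
  by apply: CkM => //; apply: CkM; [exact: Ck_cst|exact: CkM].
apply/funext => x; rewrite /partial deriveV//.
by rewrite !mulrfctE/= -exprVn expr2 mulN1r.
Qed.

Lemma Ck_prod n k (I : Type) (r : seq I) (F : I -> 'rV[R]_n -> R) :
  (forall i, Ck k (F i)) -> Ck k (fun x => \prod_(i <- r) F i x).
Proof.
move=> CF; elim: r => [|i r ih].
  rewrite (_ : (fun _ => _) = fun=> 1); first exact: Ck_cst.
  by apply/funext => x; rewrite big_nil.
rewrite (_ : (fun _ => _) = F i * (fun x => \prod_(i <- r) F i x)); first exact: CkM.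
by apply/funext => x; rewrite big_cons.
Qed.

(** The usual smooth transition from 0 on t <= 0 to 1 on t >= 1; the denominator is positive since t
    or 1 - t is. *)
Definition smooth_step (t : R) : R := flat_exp 0 t / (flat_exp 0 t + flat_exp 0 (1 - t)).

Lemma smooth_step_den t : 0 < flat_exp 0 t + flat_exp 0 (1 - t).
Proof.
have [t0|t0] := ltP 0 t.
  by rewrite ltr_pwDl ?flat_exp_gt0 ?flat_exp_ge0.
by rewrite ltr_wpDl ?flat_exp_ge0// flat_exp_gt0; lra.
Qed.

Lemma smooth_step_ge0 t : 0 <= smooth_step t.
Proof. by rewrite divr_ge0 ?flat_exp_ge0// ltW// smooth_step_den. Qed.

Lemma smooth_step_le1 t : smooth_step t <= 1.
Proof. by rewrite ler_pdivrMr ?smooth_step_den// mul1r lerDl flat_exp_ge0. Qed.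

Lemma smooth_step_gt0 t : (0 < smooth_step t) = (0 < t).
Proof. by rewrite pmulr_lgt0 ?invr_gt0 ?smooth_step_den// flat_exp_gt0. Qed.

Lemma smooth_step1 t : 1 <= t -> smooth_step t = 1.
Proof.
move=> t1; rewrite /smooth_step [X in _ + X](_ : _ = 0) ?addr0 ?divff//.
  by rewrite gt_eqF// flat_exp_gt0; lra.
by rewrite /flat_exp ifF//; apply/negbTE; rewrite -leNgt; lra.
Qed.

Lemma Ck_smooth_step n k (i : 'I_n) (a b : R) :
  Ck k (fun y : 'rV[R]_n => smooth_step (a * y ord0 i + b)).
Proof.
rewrite (_ : (fun _ => _) = (fun y : 'rV[R]_n => flat_exp 0 (a * y ord0 i + b)) *
  (fun y => (flat_exp 0 (a * y ord0 i + b) + flat_exp 0 (- a * y ord0 i + (1 - b)))^-1)); last first.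
  by apply/funext => y /=; rewrite /smooth_step !mulrfctE; congr (_ / (_ + flat_exp _ _)); ring.
apply: CkM; first exact: Ck_flat_exp.
apply: CkV.
  move=> x; rewrite gt_eqF// (_ : - a * _ + _ = 1 - (a * x ord0 i + b)); last by ring.
  exact: smooth_step_den.
by apply: CkD; exact: Ck_flat_exp.
Qed.

Lemma exists_ball_bump n (c : 'rV[R]_n) (r : R) : 0 < r ->
  exists f : 'rV[R]_n -> R, [/\ smooth f, forall x, 0 <= f x <= 1,
    forall x, ball c (r / 2) x -> f x = 1 & forall x, (0 < f x) <-> ball c r x].
Proof.
move=> r0.
(* In coordinate i the two arguments are 2 + (2/r)(x_i - c_i) and 2 - (2/r)(x_i - c_i): both
   positive exactly when |x_i - c_i| < r, both at least 1 exactly when |x_i - c_i| <= r/2. Sup-norm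
   balls are cubes, so the product over i has the required shape. *)
pose f (x : 'rV[R]_n) := \prod_(i < n)
  (smooth_step (2 / r * x ord0 i + (2 - 2 / r * c ord0 i)) *
   smooth_step (- (2 / r) * x ord0 i + (2 + 2 / r * c ord0 i))).
have r20 : 0 < 2 / r by rewrite divr_gt0.
have r2r : 2 / r * r = 2 by rewrite mulfVK// gt_eqF.
exists f; split.
- move=> k; apply: Ck_prod => i.
  by apply: (CkM (f := fun x => smooth_step _) (g := fun x => smooth_step _)); exact: Ck_smooth_step.
- move=> x; rewrite prodr_ge0 /=; last by move=> i _; rewrite mulr_ge0 ?smooth_step_ge0.
  apply: prodr_ile1 => i _; rewrite mulr_ge0 ?smooth_step_ge0//=.
  by rewrite mulr_ile1 ?smooth_step_ge0 ?smooth_step_le1.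
- move=> x; rewrite ball_rVE ?divr_gt0// => cx; rewrite /f big1// => i _.
  have := cx i; rewrite /ball/= ltr_norml => /andP[c1 c2].
  by rewrite !smooth_step1 ?mul1r//; nra.
- move=> x; rewrite ball_rVE//; split.
    move=> fx i; have : 0 < smooth_step (2 / r * x ord0 i + (2 - 2 / r * c ord0 i)) *
      smooth_step (- (2 / r) * x ord0 i + (2 + 2 / r * c ord0 i)).
      rewrite lt_neqAle mulr_ge0 ?smooth_step_ge0// andbT eq_sym; apply/eqP => E.
      by move: fx; rewrite /f (bigD1 i)//= E mul0r ltxx.
    have [s0|] := ltP 0 (smooth_step (2 / r * x ord0 i + (2 - 2 / r * c ord0 i))); last first.
      move=> s0; rewrite (_ : smooth_step (2 / r * x ord0 i + _) = 0) ?mul0r ?ltxx//.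
      by apply/eqP; rewrite eq_le s0 smooth_step_ge0.
    rewrite (pmulr_rgt0 _ s0) smooth_step_gt0; move: s0; rewrite smooth_step_gt0.
    rewrite /ball/= ltr_norml; nra.
  move=> h; apply: prodr_gt0 => i _; have := h i.
  by rewrite /ball/= ltr_norml => /andP[h1 h2]; rewrite mulr_gt0// smooth_step_gt0; nra.
Qed.

End smooth_bumps.

(** * Bounds, Taylor estimates and commuting derivatives *)

Section test_functions.
Context {R : realType} {n : nat}.
Implicit Types (f g : 'rV[R]_n -> R) (x y h : 'rV[R]_n) (O : set 'rV[R]_n).
Local Notation basis i := (delta_mx ord0 i : 'rV[R]_n).

Lemma coord_le_norm x i : `|x ord0 i| <= `|x|.
Proof.
rewrite [leRHS]mx_normrE.
exact: (le_bigmax_cond _ (fun ij : 'I_1 * 'I_n => `|x ij.1 ij.2|) (j := (ord0, i))).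
Qed.

Lemma norm_le_coord x (r : R) : 0 <= r -> (forall i, `|x ord0 i| <= r) -> `|x| <= r.
Proof.
move=> r0 xr; rewrite [leLHS]mx_normrE; apply: bigmax_le => // -[i j] _ /=.
by rewrite ord1.
Qed.

(** In the Slobodeckij kernel the Euclidean norm stands in the denominator, so this direction bounds
    the kernel by sup norms, whose balls have explicit measure. *)
Lemma norm_le_enorm x : `|x| <= enorm x.
Proof.
apply: norm_le_coord => [|i]; first exact: sqrtr_ge0.
rewrite -(sqrtr_sqr (x ord0 i)) ler_sqrt ?sumr_ge0// => [|j _]; last exact: sqr_ge0.
by rewrite (bigD1 i)//= lerDl sumr_ge0// => j _; exact: sqr_ge0.
Qed.

Lemma is_test_lin O (a : R) f g : is_test O f -> is_test O g -> is_test O (a *: (f : _ -> R^o) + g).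
Proof.
move=> tf tg; have := (test_pred_submod O).2 a f g.
by rewrite !inE; apply.
Qed.

Lemma is_test0 O : is_test O (0 : 'rV[R]_n -> R).
Proof. by have := (@test_pred_submod R n O).1; rewrite inE. Qed.

Lemma is_testD O f g : is_test O f -> is_test O g -> is_test O (f + g).
Proof. by move=> tf tg; rewrite -[f](@scale1r _ ('rV[R]_n -> R^o)); exact: is_test_lin. Qed.

Lemma is_testZ O (a : R) f : is_test O f -> is_test O (a *: (f : _ -> R^o)).
Proof.
by move=> tf; rewrite -[_ *: _]addr0; apply: is_test_lin => //; exact: is_test0.
Qed.

Lemma is_test_subset O O' f : O `<=` O' -> is_test O f -> is_test O' f.
Proof. by move=> OO' [sf cf fO]; split=> //; exact: subset_trans OO'. Qed.

Lemma smooth_continuous f : smooth f -> continuous f.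
Proof. by move=> /(_ 0%N) /Ck_cont. Qed.

Lemma smoothM f g : smooth f -> smooth g -> smooth (f * g).
Proof. by move=> sf sg k; exact: CkM. Qed.

Lemma smoothD f g : smooth f -> smooth g -> smooth (f + g).
Proof. by move=> sf sg k; exact: CkD. Qed.

Lemma smooth_cst (a : R) : smooth (fun _ : 'rV[R]_n => a).
Proof. by move=> k; exact: Ck_cst. Qed.

Lemma smooth_derivable f i x : smooth f -> derivable f x (basis i).
Proof. by move=> /(_ 1%N) [_ /(_ i)[]]. Qed.

Lemma fsupp_eq0 f x : ~ fsupp f x -> f x = 0.
Proof.
by move=> nfx; apply/eqP; apply: contra_notT nfx => fx0; exact: subset_closure.
Qed.

Lemma fsupp_subset f (A : set 'rV[R]_n) : closed A -> (forall x, f x != 0 -> A x) -> fsupp f `<=` A.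
Proof.
move=> cA fA; rewrite [X in _ `<=` X](closure_id _).1//.
exact: closure_subset.
Qed.

Lemma is_test_bounded_supp O f : is_test O f ->
  exists2 r : R, 0 <= r & forall x, f x != 0 -> `|x| <= r.
Proof.
move=> [_ cf _]; have [M [_ hM]] := compact_bounded cf.
exists (`|M| + 1); first by rewrite addr_ge0.
move=> x fx0; apply: (hM (`|M| + 1)); last exact: subset_closure.
by rewrite (le_lt_trans (ler_norm _))// ltrDl.
Qed.

Lemma is_test_bounded O f : is_test O f ->
  exists2 B : R, 0 <= B & forall x, `|f x| <= B.
Proof.
move=> [sf cf fO]; have := smooth_continuous sf => cof.
have : compact [set f x | x in fsupp f].
  by apply: continuous_compact => //; apply: continuous_subspaceT.
move=> /compact_bounded [M [_ hM]].
exists (`|M| + 1); first by rewrite addr_ge0.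
move=> x; have [fx|/fsupp_eq0 ->] := pselect (fsupp f x); last by rewrite normr0 addr_ge0.
apply: (hM (`|M| + 1)); last by exists x.
by rewrite (le_lt_trans (ler_norm _))// ltrDl.
Qed.

Lemma smooth_MVT f x i (t : R) : smooth f ->
  exists2 c : R, `|c| <= `|t| & f (t *: basis i + x) - f x = t * partial i f (c *: basis i + x).
Proof.
move=> sf; pose g (h : R) := f (h *: basis i + x).
have dg (s : R) : is_derive s (1 : R) g (partial i f (s *: basis i + x)).
  apply/is_derive_line; split => //; exact: smooth_derivable.
have cg (A : set R) : {within A, continuous g}.
  apply: continuous_subspaceT => s; apply: differentiable_continuous.
  by apply/derivable1_diffP; have [] := dg s.
have [t0|t0] := leP 0 t.
  have [c] := @MVT_segment _ g (fun s => partial i f (s *: basis i + x)) 0 t t0 (fun s _ => dg s) (cg _).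
  rewrite in_itv/= => /andP[c0 ct]; rewrite /g scale0r add0r subr0 mulrC => E.
  by exists c => //; rewrite !ger0_norm.
have [c] := @MVT_segment _ g (fun s => partial i f (s *: basis i + x)) t 0 (ltW t0) (fun s _ => dg s) (cg _).
rewrite in_itv/= => /andP[ct c0]; rewrite /g scale0r add0r sub0r => E.
exists c; first by rewrite (ler0_norm c0) (ltr0_norm t0) lerN2.
by apply/eqP; rewrite -eqr_opp opprB E; apply/eqP; ring.
Qed.

(** Two mean value theorems: the inner point lies within |t| of x, and B bounds the second
    derivative. That B is independent of x is what allows the remainder to be integrated. *)
Lemma test_taylor1 O f i : is_test O f -> exists2 B : R, 0 <= B &
  forall x (t : R), `|f (t *: basis i + x) - f x - t * partial i f x| <= B * t ^+ 2.
Proof.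
move=> tf; have [B B0 hB] := is_test_bounded (is_test_partial i (is_test_partial i tf)).
have [sf _ _] := tf.
exists B => // x t; have [c ct ->] := smooth_MVT x i t sf.
have [d dc E] := smooth_MVT x i c (partial_smooth i sf).
rewrite -mulrBr E !normrM mulrC.
rewrite -[t ^+ 2]real_normK ?num_real// expr2 mulrA ler_wpM2r// mulrC.
by apply: ler_pM => //; exact: hB.
Qed.

Lemma norm_basis_scale i (t : R) : `|t *: basis i| <= `|t|.
Proof.
apply: norm_le_coord => // j; rewrite !mxE/=.
by case: (j == i); rewrite ?mulr1 ?mulr0 ?normr0.
Qed.

Lemma partial_shift f v i x : partial i (fun y => f (y + v)) x = partial i f (x + v).
Proof.
rewrite /partial /derive; set F := (X in lim (X @ _)); set G := (X in _ = lim (X @ _)).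
by rewrite (_ : F = G)//; apply/funext => h; rewrite /F/G /= addrA.
Qed.

Lemma derivable_shift f v w x : derivable f (x + v) w -> derivable (fun y => f (y + v)) x w.
Proof.
rewrite /derivable; set F := (X in cvg (X @ _)); set G := (X in _ -> cvg (X @ _)).
by rewrite (_ : F = G)//; apply/funext => h; rewrite /F/G /= addrA.
Qed.

Lemma smooth_shift f v : smooth f -> smooth (fun y => f (y + v)).
Proof.
move=> sf k; elim: k f sf => [|k ih] f sf.
  split=> // x; apply: (@continuous_comp _ _ _ (fun y => y + v)); last exact: smooth_continuous.
  by apply: continuousD => //; exact: cst_continuous.
have cf : continuous (fun y => f (y + v)) by exact: Ck_cont (ih f sf).
split=> // i; split=> [x|].
  by apply: derivable_shift; exact: smooth_derivable.
rewrite (_ : partial i _ = fun y => partial i f (y + v)); last first.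
  by apply/funext => x; exact: partial_shift.
by apply: ih; exact: partial_smooth.
Qed.

Lemma partialB f g i x : smooth f -> smooth g ->
  partial i (fun y => f y - g y) x = partial i f x - partial i g x.
Proof.
by move=> sf sg; rewrite /partial (deriveB (f := f) (g := g))//; exact: smooth_derivable.
Qed.

Lemma smoothB f g : smooth f -> smooth g -> smooth (fun y => f y - g y).
Proof.
move=> sf sg; rewrite (_ : (fun _ => _) = f + (fun=> -1) * g).
  by apply: smoothD => //; apply: smoothM => //; exact: smooth_cst.
by apply/funext => y; rewrite /= -[RHS]/(f y + -1 * g y) mulN1r.
Qed.

(* Both iterated derivatives are values of the same second difference quotient
   at points near x. *)
Lemma partialC f i j : smooth f -> partial i (partial j f) = partial j (partial i f).
Proof.
move=> sf; apply/funext => x.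
have key (a b : 'I_n) (t : R) : exists2 z : 'rV[R]_n, `|z| <= `|t| + `|t| &
    f (t *: basis a + x + t *: basis b) - f (t *: basis a + x) -
      (f (x + t *: basis b) - f x) = t * (t * partial b (partial a f) (z + x)).
  have sg := smoothB (smooth_shift (t *: basis b) sf) sf.
  have [c ct ->] := smooth_MVT x a t sg.
  rewrite partialB//; last exact: smooth_shift.
  rewrite partial_shift.
  have [d dt] := smooth_MVT (c *: basis a + x) b t (partial_smooth a sf).
  rewrite (addrC (t *: _)) => ->; exists (d *: basis b + c *: basis a).
    by rewrite (le_trans (ler_normD _ _))// lerD// (le_trans (norm_basis_scale _ _)).
  by rewrite -(addrA (d *: _)).
apply/eqP; rewrite -subr_eq0 -normr_le0; apply/ler_addgt0Pl => e e0.
rewrite addr0.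
have e20 : 0 < e / 2 by rewrite divr_gt0.
have cont (k l : 'I_n) : exists2 d : R, 0 < d & forall z, `|z| < d ->
    `|partial k (partial l f) x - partial k (partial l f) (z + x)| < e / 2.
  have := smooth_continuous (partial_smooth k (partial_smooth l sf)).
  move=> /(_ x) /cvgrPdist_lt /(_ _ e20) /nbhs_ballP [d d0 hd].
  exists d => // z zd; apply: hd; rewrite -ball_normE /ball_/= opprD addrCA subrr addr0.
  by rewrite normrN.
have [d1 d10 h1] := cont i j; have [d2 d20 h2] := cont j i.
have [t t0] : exists2 t : R, 0 < t & t + t < Num.min d1 d2.
  have m0 : 0 < Num.min d1 d2 by rewrite lt_min d10.
  by exists (Num.min d1 d2 / 3); [rewrite divr_gt0|lra].
rewrite lt_min => /andP[td1 td2].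
have [z1 z1t E1] := key j i t; have [z2 z2t E2] := key i j t.
have {}E1 : partial i (partial j f) (z1 + x) = partial j (partial i f) (z2 + x).
  have tn0 : t != 0 by rewrite gt_eqF.
  have E12 : t * (t * partial i (partial j f) (z1 + x)) = t * (t * partial j (partial i f) (z2 + x)).
    apply: etrans (esym E1) (etrans _ E2).
    rewrite [x + t *: basis i]addrC [x + t *: basis j]addrC [t *: basis j + x + _]addrAC.
    by rewrite [t *: basis j + t *: basis i]addrC [t *: basis i + t *: basis j + x]addrAC; ring.
  exact: (mulfI tn0 (mulfI tn0 E12)).
rewrite (gtr0_norm t0) in z1t; rewrite (gtr0_norm t0) in z2t.
have {}h1 := h1 z1 (le_lt_trans z1t td1).
have {}h2 := h2 z2 (le_lt_trans z2t td2).
move: h1 h2 E1.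
move: (partial i _ x) (partial j _ x) (partial i _ (z1 + x)) (partial j _ (z2 + x)).
move=> a b c d; rewrite !ltr_norml ler_norml => /andP[h1 h2] /andP[h3 h4] E.
by apply/andP; split; lra.
Qed.

End test_functions.

(** * Iterated derivatives and the Leibniz rule *)

Section iterated_partials.
Context {R : realType} {n : nat}.
Implicit Types (f g : 'rV[R]_n -> R) (x y h : 'rV[R]_n) (O : set 'rV[R]_n) (s t : seq 'I_n).
Local Notation basis i := (delta_mx ord0 i : 'rV[R]_n).

(** Derivatives are indexed by lists of directions instead of multi-indices, so that the Leibniz
    rule becomes an induction on the list. [pder_tderive] translates back. *)
Definition pder s f : 'rV[R]_n -> R := foldr (@partial R n) f s.

Lemma pder_cat s t f : pder (s ++ t) f = pder s (pder t f).
Proof. exact: foldr_cat. Qed.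

Lemma pder_smooth s f : smooth f -> smooth (pder s f).
Proof. by move=> sf; elim: s => //= i s ih; exact: partial_smooth. Qed.

Lemma pder_is_test O s f : is_test O f -> is_test O (pder s f).
Proof. by move=> sf; elim: s => //= i s ih; exact: is_test_partial. Qed.

Lemma pder_partial s i f : smooth f -> pder s (partial i f) = partial i (pder s f).
Proof.
move=> sf; elim: s => //= j s ->.
by rewrite partialC//; exact: pder_smooth.
Qed.

Lemma pder_perm s t f : smooth f -> perm_eq s t -> pder s f = pder t f.
Proof.
move=> sf; elim: s t => [|i s ih] t; first by rewrite perm_sym => /perm_nilP ->.
move=> st; have : i \in t by rewrite -(perm_mem st) mem_head.
move=> it; case: (splitPr it) st => t1 t2 st.
have {}st : perm_eq s (t1 ++ t2).
  rewrite -(perm_cons i) (perm_trans st)//.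
  by rewrite -cat1s perm_catCA.
by rewrite /= (ih _ st) !pder_cat /= -pder_partial//; exact: pder_smooth.
Qed.

Lemma partialD f g i : smooth f -> smooth g -> partial i (f + g) = partial i f + partial i g.
Proof. by move=> sf sg; apply/funext => x; apply: deriveD; exact: smooth_derivable. Qed.

Lemma partialM f g i : smooth f -> smooth g ->
  partial i (f * g) = partial i f * g + f * partial i g.
Proof.
move=> sf sg; apply/funext => x.
rewrite {1}/partial deriveM; [|exact: smooth_derivable..].
by rewrite addrC -[RHS]/(partial i f x * g x + f x * partial i g x) [partial i f x * _]mulrC.
Qed.

(** All ways of distributing the entries of s over two factors. Repeated pairs take the place of
    binomial coefficients. *)
Fixpoint leibniz s : seq (seq 'I_n * seq 'I_n) :=
  if s is i :: s' then
    [seq (i :: ab.1, ab.2) | ab <- leibniz s'] ++ [seq (ab.1, i :: ab.2) | ab <- leibniz s']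
  else [:: ([::], [::])].

Lemma leibniz_size s ab : ab \in leibniz s -> (size ab.1 + size ab.2 = size s)%N.
Proof.
elim: s ab => [|i s ih] ab /=; first by rewrite inE => /eqP ->.
by rewrite mem_cat => /orP[|] /mapP[cd /ih <- ->]; rewrite /= ?addnS ?addSn.
Qed.

Lemma sum_smooth (I : eqType) (r : seq I) (F : I -> 'rV[R]_n -> R) :
  (forall i, i \in r -> smooth (F i)) -> smooth (\sum_(i <- r) F i).
Proof.
move=> sF; rewrite big_seq; elim/big_ind: _ => //; first by move=> k; exact: Ck0.
by move=> f g; exact: smoothD.
Qed.

Lemma partial_sum (I : eqType) (r : seq I) (F : I -> 'rV[R]_n -> R) i :
  (forall j, smooth (F j)) ->
  partial i (\sum_(j <- r) F j) = \sum_(j <- r) partial i (F j).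
Proof.
move=> sF; elim: r => [|j r ih].
  by rewrite !big_nil; apply/funext => x; exact: derive_cst.
by rewrite !big_cons partialD// ?ih//; exact: sum_smooth.
Qed.

Lemma pderM s f g : smooth f -> smooth g ->
  pder s (f * g) = \sum_(ab <- leibniz s) pder ab.1 f * pder ab.2 g.
Proof.
move=> sf sg; elim: s => [|i s ih] /=; first by rewrite big_seq1.
rewrite ih partial_sum; last by move=> ab; apply: smoothM; exact: pder_smooth.
rewrite big_cat/= !big_map -big_split/=; apply: eq_bigr => ab _.
by rewrite partialM//; exact: pder_smooth.
Qed.

(** Equality near x is equality near every y close to x ([near_join]), which is what one more
    differentiation in the induction requires. *)
Lemma pder_near_eq s f g x : (\forall y \near x, f y = g y) ->
  \forall y \near x, pder s f y = pder s g y.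
Proof.
elim: s => //= i s ih fg.
have {}ih : \forall y \near x, \forall z \near y, pder s f z = pder s g z.
  exact/near_join/ih/fg.
by apply: filterS ih => y; exact: near_eq_derive.
Qed.

(** The list of directions in the order in which [tderive] applies them. *)
Definition canonical_seq (nu : 'I_n -> nat) : seq 'I_n :=
  flatten [seq nseq (nu i) i | i <- enum 'I_n].

Lemma size_canonical_seq nu : size (canonical_seq nu) = mindex_order nu.
Proof.
rewrite size_flatten /shape -map_comp sumnE big_map big_enum /=.
by apply: eq_bigr => i _; rewrite size_nseq.
Qed.

Lemma canonical_seq_perm s : perm_eq s (canonical_seq (fun i => count_mem i s)).
Proof.
apply/allP => i _ /=; apply/eqP.
rewrite count_flatten -map_comp sumnE big_map big_enum /= (bigD1 i)//= count_nseq /= eqxx mul1n.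
by rewrite big1 ?addn0// => j ji; rewrite count_nseq /= (negbTE ji) mul0n.
Qed.

Lemma tderiveE O (nu : 'I_n -> nat) (psi : testfun O) :
  tderive nu psi = pder (canonical_seq nu) psi :> (_ -> _).
Proof.
rewrite /tderive /canonical_seq; elim: (enum _) => //= i r ih.
rewrite pder_cat -ih; move: (foldr _ _ _) => phi.
by elim: (nu i) => //= k ->.
Qed.

Lemma mindex_order_count s : mindex_order (fun i => count_mem i s) = size s.
Proof. by rewrite -size_canonical_seq; apply/esym/perm_size/canonical_seq_perm. Qed.

Lemma pder_tderive O s (psi : testfun O) :
  pder s psi = tderive (fun i => count_mem i s) psi :> (_ -> _).
Proof.
rewrite tderiveE; apply: pder_perm (canonical_seq_perm s).
by case: (testfun_is_test psi).
Qed.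

End iterated_partials.

(** * Lipschitz bounds and cutoff functions *)

Section cutoffs.
Context {R : realType} {n : nat}.
Implicit Types (f g : 'rV[R]_n -> R) (x y h : 'rV[R]_n) (O : set 'rV[R]_n).

(** Summed over the list [enum 'I_n], so that increments along a path of coordinate segments can be
    treated by induction on the list. *)
Lemma row_sum_basis h : h = \sum_(i <- enum 'I_n) h ord0 i *: (delta_mx ord0 i : 'rV[R]_n).
Proof. by rewrite big_enum/= {1}(row_sum_delta h). Qed.

(** Going from y to x one coordinate at a time, the mean value theorem gives the Lipschitz bound;
    boundedness gives the constant one. The combination with min(1, |x - y|) is the form that
    [kernel] integrates. *)
Lemma test_lipschitz O f : is_test O f -> exists2 C : R, 0 <= C &
  forall x y, `|f x - f y| <= C * Num.min 1 `|x - y|.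
Proof.
move=> tf; have [B B0 hB] := is_test_bounded tf.
have [sf _ _] := tf.
have /choice[D hD] : forall i : 'I_n, exists D : R, 0 <= D /\ forall x, `|partial i f x| <= D.
  by move=> i; have [D D0 hD] := is_test_bounded (is_test_partial i tf); exists D.
pose S := \sum_(i <- enum 'I_n) D i.
have S0 : 0 <= S by apply: sumr_ge0 => i _; case: (hD i).
have L x h : `|f (h + x) - f x| <= S * `|h|.
  rewrite {1}(row_sum_basis h) /S; elim: (enum _) => [|i r ih].
    by rewrite !big_nil add0r subrr normr0 mul0r.
  rewrite !big_cons mulrDl -addrA.
  set z := _ + x in ih *.
  rewrite -(subrK (f z) (f _)) -addrA (le_trans (ler_normD _ _))//.
  apply: lerD => //; have [c _ ->] := smooth_MVT z i (h ord0 i) sf.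
  rewrite normrM mulrC; apply: ler_pM => //; last exact: coord_le_norm.
  by case: (hD i).
exists (Num.max (B + B) S) => [|x y]; first by rewrite le_max S0 orbT.
rewrite -{1}(subrK y x) /Order.min; case: ifPn => _.
  rewrite mulr1 le_max; apply/orP; left.
  by rewrite (le_trans (ler_normB _ _))// lerD.
by rewrite (le_trans (L _ _))// ler_wpM2r// le_max lexx orbT.
Qed.

(** Finitely many half-radius balls cover K. Bumps are joined by f + g - f g = 1 - (1 - f)(1 - g),
    which stays in [0, 1] and equals 1 wherever f or g does; the union of the half-radius balls is
    the neighbourhood V. *)
Lemma exists_cutoff (K O : set 'rV[R]_n) : compact K -> open O -> K `<=` O ->
  exists f, [/\ is_test O f, (forall x, 0 <= f x <= 1) &
    exists V, [/\ open V, K `<=` V & forall x, V x -> f x = 1]].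
Proof.
move=> cK oO KO.
have /choice[r hr] : forall x, exists r : R, 0 < r /\ (O x -> closed_ball x r `<=` O).
  move=> x; have [Ox|nOx] := pselect (O x); last by exists 1; split.
  have /nbhs_closedballP[r hr] : nbhs x O by exact: open_nbhs_nbhs.
  by exists r%:num.
have r0 x : 0 < r x by case: (hr x).
have r20 x : 0 < r x / 2 by rewrite divr_gt0.
have finite_case (s : seq 'rV[R]_n) : (forall x, x \in s -> O x) ->
    exists f, [/\ is_test O f, (forall x, 0 <= f x <= 1) &
      forall x y, x \in s -> ball x (r x / 2) y -> f y = 1].
  elim: s => [|x s ih] sO.
    exists 0; split=> //; first exact: is_test0.
    by move=> y; rewrite lexx ler01.
  have [|f [tf f01 f1]] := ih; first by move=> y ys; apply: sO; rewrite inE ys orbT.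
  have [g [sg g01 g1 gb]] := exists_ball_bump x (r0 x).
  have gsupp : fsupp g `<=` closed_ball x (r x).
    apply: fsupp_subset; first exact: closed_ball_closed.
    move=> y gy; apply: subset_closed_ball; apply/gb.
    by rewrite lt_neqAle eq_sym gy; case/andP: (g01 y).
  have Ox : O x by apply: sO; rewrite mem_head.
  have tg : is_test O g.
    split=> //; last by apply: subset_trans gsupp _; case: (hr x) => _; apply.
    apply: bounded_closed_compact; last exact: closed_closure.
    exists (`|x| + r x); split; first exact: num_real.
    move=> M hM y /gsupp; rewrite closed_ballE// /closed_ball_/= => yx.
    apply: le_trans (ltW hM); rewrite -(subrK x y) addrC.
    by rewrite (le_trans (ler_normD _ _))// lerD2l distrC.
  have tfg : is_test O (f + (-1) *: ((f * g : _ -> R) : _ -> R^o)).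
    by apply: is_testD => //; apply: is_testZ; exact: is_testM.
  exists ((f + (-1) *: ((f * g : _ -> R) : _ -> R^o)) + g); split.
  - exact: is_testD.
  - move=> y; rewrite -[(_ + _) y]/(f y + (-1) * (f y * g y) + g y).
    by have := f01 y; have := g01 y => /andP[? ?] /andP[? ?]; apply/andP; split; nra.
  - move=> y z; rewrite inE -[(_ + _) z]/(f z + (-1) * (f z * g z) + g z) => /orP[/eqP -> /g1 ->|ys yz].
      by ring.
    by rewrite (f1 y z)//; ring.
have := cK; rewrite compact_cover => /(_ _ K (fun x => ball x (r x / 2))).
case=> [x Kx|x Kx|D DK cov].
- exact: ball_open.
- by exists x => //; exact: ballxx.
have [|f [tf f01 f1]] := finite_case (finmap.enum_fset D).
  by move=> x /DK; rewrite inE => /KO.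
exists f; split=> //.
exists (\bigcup_(x in [set x | x \in finmap.enum_fset D]) ball x (r x / 2)); split=> //.
- by apply: bigcup_open => x _; exact: ball_open.
- by move=> y [x xD xy]; exact: f1 xy.
Qed.

End cutoffs.

(** * Slobodeckij seminorms of functions *)

Section slobodeckij_kernel.
Context {R : realType} {n : nat}.
Local Notation mu := (lebesgue_rV R n).
Implicit Types (h x y : 'rV[R]_n).

Lemma cube_norm (r : R) : 0 <= r ->
  [set x : 'rV[R]_n | forall i, `|x ord0 i| <= r] = [set x | `|x| <= r].
Proof.
move=> r0; apply/seteqP; split=> x /=; first exact: norm_le_coord.
by move=> xr i; apply: le_trans xr; exact: coord_le_norm.
Qed.

Lemma measurable_norm_le (r : R) : measurable [set x : 'rV[R]_n | `|x| <= r].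
Proof.
apply: closed_measurable_rV.
rewrite (_ : [set _ | _] = Num.Def.normr @^-1` [set y : R | y <= r])//.
apply: closed_comp; last exact: closed_le.
by move=> x _; exact: norm_continuous.
Qed.

Lemma lebesgue_norm_le (r : R) : 0 <= r ->
  mu [set x | `|x| <= r] = ((r *+ 2) ^+ n)%:E.
Proof. by move=> r0; rewrite -cube_norm// lebesgue_rV_cube. Qed.

(** G is dominated by the sum over j of [c j] times the indicator of the cube of radius [rho j]; the
    integrals of the summands are bounded by a geometric series. *)
Lemma integral_cube_cover_lty (G : 'rV[R]_n -> R) (c rho : nat -> R) (a r : R) :
  measurable_fun setT G -> (forall h, 0 <= G h) ->
  (forall j, 0 <= c j) -> (forall j, 0 <= rho j) ->
  0 <= a -> 0 < r < 1 -> (forall j, c j * (rho j *+ 2) ^+ n <= a * r ^+ j) ->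
  (forall h, G h != 0 -> exists j, `|h| <= rho j /\ G h <= c j) ->
  (\int[mu]_h (G h)%:E < +oo)%E.
Proof.
move=> mG G0 c0 rho0 a0 /andP[r0 r1] cr cov.
pose B j := [set x : 'rV[R]_n | `|x| <= rho j].
pose F j (h : 'rV[R]_n) := ((c j)%:E * (\1_(B j) h)%:E)%E.
have F0 j h : (0 <= F j h)%E by rewrite mule_ge0// lee_fin.
have mF j : measurable_fun setT (F j).
  apply: measurable_funeM; apply/measurable_EFinP; apply: measurable_indic.
  exact: measurable_norm_le.
apply: (@le_lt_trans _ _ (\int[mu]_h \sum_(0 <= j <oo) F j h)%E).
  apply: ge0_le_integral => //.
  - by move=> h _; rewrite lee_fin.
  - exact/measurable_EFinP.
  - by apply: ge0_emeasurable_sum => // j h _ _; exact: F0.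
  - move=> h _; have [->|/cov[j [hj Gc]]] := eqVneq (G h) 0.
      by apply: nneseries_ge0 => j _ _; exact: F0.
    apply: le_trans (nneseries_lim_ge j.+1 _); last by move=> k _ _; exact: F0.
    rewrite big_nat_recr//= (@le_trans _ _ (F j h))//.
      by rewrite /F indicE mem_set// mule1 lee_fin.
    by rewrite leeDr// sume_ge0// => k _; exact: F0.
rewrite integral_nneseries//.
apply: (@le_lt_trans _ _ (a / (1 - r))%:E); last exact: ltry.
apply: lime_le.
  by apply: is_cvg_nneseries => k _ _; apply: integral_ge0 => h _; exact: F0.
apply: nearW => m; apply: (@le_trans _ _ (series (geometric a r) m)%:E); last first.
  by rewrite lee_fin; apply: geometric_le_lim => //; rewrite ger0_norm// ltW.
rewrite /series/= -sumEFin; apply: lee_sum => k _.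
rewrite ge0_integralZl//; last 2 first.
  by apply/measurable_EFinP; apply: measurable_indic; exact: measurable_norm_le.
  by rewrite lee_fin.
rewrite integral_indic//; last exact: measurable_norm_le.
rewrite [X in (_ * X)%E](_ : _ = ((rho k *+ 2) ^+ n)%:E); last by rewrite setIT; exact: lebesgue_norm_le.
rewrite -EFinM lee_fin; exact: cr.
Qed.

(** Up to a constant, this dominates |f(x + h) - f(x)|^p / |h|^q when f is bounded and Lipschitz.
    With q = n + theta p it behaves like |h|^(p - q) near 0 and |h|^(-q) at infinity, both
    integrable when 0 < theta < 1. *)
Definition kernel (p q : R) h : R := Num.min 1 `|h| `^ p / enorm h `^ q.

Lemma kernel_ge0 p q h : 0 <= kernel p q h.
Proof. by rewrite divr_ge0 ?powR_ge0. Qed.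

Lemma kernelN p q h : kernel p q (- h) = kernel p q h.
Proof.
rewrite /kernel normrN /enorm; congr (_ / Num.sqrt _ `^ _).
by apply: eq_bigr => i _; rewrite mxE sqrrN.
Qed.

Lemma measurable_enorm : measurable_fun setT (@enorm R n).
Proof.
rewrite (_ : @enorm R n = Num.sqrt \o (fun x : 'rV[R]_n => \sum_i x ord0 i ^+ 2))//.
apply: measurableT_comp.
  by apply: continuous_measurable_fun; exact: sqrt_continuous.
apply: measurable_sum => i; apply: measurable_funX; exact: measurable_coord.
Qed.

Lemma measurable_minnorm : measurable_fun setT (fun h => Num.min 1 `|h|).
Proof.
apply: measurable_minr => //.
by apply: continuous_measurable_rV => x; exact: norm_continuous.
Qed.

Lemma measurable_kernel p q : measurable_fun setT (kernel p q).
Proof.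
apply: measurable_funM.
  apply: (@measurableT_comp _ _ _ _ _ _ (fun x : R => x `^ p)).
    exact: measurable_powR.
  exact: measurable_minnorm.
rewrite (_ : (fun _ => _) = (fun x => enorm x `^ (- q))); last first.
  by apply/funext => x; rewrite powRN.
apply: (@measurableT_comp _ _ _ _ _ _ (fun x : R => x `^ (- q))).
  exact: measurable_powR.
exact: measurable_enorm.
Qed.

Lemma powR_exprC (x : R) (j : nat) (q : R) : 0 <= x -> (x ^+ j) `^ q = (x `^ q) ^+ j.
Proof.
by move=> x0; rewrite -powR_mulrn// -powRrM mulrC powRrM powR_mulrn// powR_ge0.
Qed.

Lemma gt0_powR_lt1 (q : R) : q < 0 -> 0 < 2 `^ q < 1 :> bool.
Proof.
move=> q0; rewrite powR_gt0//=.
have := ler_powR (ler1n R 2) (ltW q0); rewrite powRr0 le_eqVlt => /predU1P[|//].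
move=> /(congr1 (fun a : R => a `^ q^-1)); rewrite -powRrM mulfV ?lt_eqF// powRr1// powR1 => /eqP.
by rewrite -subr_eq0 -[X in X - 1 == 0]/(1 + 1) addrK oner_eq0.
Qed.

Lemma exp2_unbounded (x : R) : exists k, x < 2 ^+ k.
Proof.
have [k hk] : exists k : nat, `|x| < k%:R.
  by exists (Num.bound `|x|); exact: archi_boundP.
exists k; rewrite (le_lt_trans (ler_norm _))// (lt_trans hk)//.
by rewrite -natrX ltr_nat ltn_expl.
Qed.

(* Dyadic cubes: on [2^-(j+1) < |h| <= 2^-j] and on [2^j < |h| <= 2^(j+1)] the
   kernel times the volume of the cube is a geometric sequence. *)
Lemma integral_kernel_lty (p theta : R) : 1 < p -> 0 < theta < 1 ->
  (\int[mu]_h (kernel p (n%:R + theta * p) h)%:E < +oo)%E.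
Proof.
move=> p1 /andP[t0 t1]; set q := n%:R + theta * p.
have p0 : 0 < p by lra.
have q0 : 0 < q by rewrite ltr_wpDl// mulr_gt0.
pose B := [set h : 'rV[R]_n | `|h| <= 1].
have mB : measurable B by exact: measurable_norm_le.
pose G1 h := kernel p q h * \1_B h; pose G2 h := kernel p q h * \1_(~` B) h.
have mG1 : measurable_fun setT G1.
  by apply: measurable_funM; [exact: measurable_kernel|exact: measurable_indic].
have mG2 : measurable_fun setT G2.
  by apply: measurable_funM; [exact: measurable_kernel|apply: measurable_indic; exact: measurableC].
have G10 h : 0 <= G1 h by rewrite mulr_ge0// kernel_ge0.
have G20 h : 0 <= G2 h by rewrite mulr_ge0// kernel_ge0.
rewrite (_ : (fun h => (kernel p q h)%:E) = (fun h => (G1 h)%:E + (G2 h)%:E)%E); last first.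
  apply/funext => h; rewrite /G1/G2 -EFinD -mulrDr !indicE in_setC.
  by case: (h \in B); rewrite ?addr0 ?add0r mulr1.
rewrite ge0_integralD//; last 4 first.
  by move=> h _; rewrite lee_fin.
  exact/measurable_EFinP.
  by move=> h _; rewrite lee_fin.
  exact/measurable_EFinP.
have h0_enorm h : h != 0 -> 0 < `|h| by rewrite normr_gt0.
have half0 : 0 < (2^-1 : R) by rewrite invr_gt0.
have lbound h (a : R) : 0 < a -> a <= `|h| -> (enorm h `^ q)^-1 <= (a `^ q)^-1.
  move=> a0 ah; have ae := le_trans ah (norm_le_enorm h).
  have e0 := lt_le_trans a0 ae.
  rewrite lef_pV2 ?posrE ?powR_gt0//.
  by apply: ge0_ler_powR => //; rewrite ?nnegrE ?ltW.
have V2 (k : nat) (s : R) : (2^-1 ^+ k) `^ s = (2 `^ (- s)) ^+ k :> R.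
  by rewrite powR_exprC ?ltW// -powR_inv1// -powRrM mulN1r.
apply: lte_add_pinfty.
(* Near the origin the exponents of 2^j add up to -p + q - n = -(1 - theta) p, negative because
   theta < 1. *)
- apply: (@integral_cube_cover_lty _
    (fun j => (2^-1 ^+ j) `^ p * ((2^-1 ^+ j.+1) `^ q)^-1) (fun j => 2^-1 ^+ j)
    (2 `^ q * 2 ^+ n) (2 `^ (- ((1 - theta) * p)))) => //.
  + by apply: gt0_powR_lt1; rewrite oppr_lt0 mulr_gt0// subr_gt0.
  + move=> j; rewrite !V2 (powRN 2 q) (exprVn (2 `^ q)) invrK exprSr -(mulr_natr (2^-1 ^+ j)) exprMn exprAC.
    rewrite le_eqVlt; apply/orP; left; apply/eqP.
    rewrite [2 `^ (- ((1 - theta) * p))](_ : _ = 2 `^ (- p) * 2 `^ q * 2^-1 ^+ n); last first.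
      rewrite exprVn -powR_mulrn// -powRN -!powRD; last 2 first.
        by rewrite pnatr_eq0 implybT.
        by rewrite pnatr_eq0 implybT.
      by congr (_ `^ _); rewrite /q; ring.
    by rewrite !exprMn; ring.
  + move=> h; rewrite /G1 indicE; case: (boolP (h \in B)); last by rewrite mulr0 eqxx.
    rewrite inE /B/= mulr1 => h1 k0.
    have h0 : 0 < `|h|.
      rewrite normr_gt0; apply: contra_neq k0 => ->.
      by rewrite /kernel normr0 minEle ler10 powR0 ?mul0r// gt_eqF.
    have ex : exists j, 2^-1 ^+ j.+1 < `|h|.
      have [k hk] := exp2_unbounded `|h|^-1; exists k.
      by rewrite exprVn invf_plt ?posrE ?exprn_gt0// (lt_le_trans hk)// ler_eXn2l// ltr1n.
    have [j hj jmin] := ex_minnP ex.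
    have hj' : `|h| <= 2^-1 ^+ j.
      case: j hj jmin => [|j] hj jmin; first by rewrite expr0.
      by rewrite leNgt; apply/negP => /jmin; rewrite ltnn.
    exists j; split => //.
    apply: ler_pM; rewrite ?powR_ge0 ?invr_ge0 ?powR_ge0//.
      apply: ge0_ler_powR; rewrite ?nnegrE ?exprn_ge0 ?(ltW p0) ?(ltW half0)//.
      by rewrite ge_min hj' orbT.
    by apply: lbound; rewrite ?exprn_gt0// ltW.
(* Away from the origin they add up to n - q = -theta p, negative because theta > 0. The factor 4^n
   comes from the side 2 * 2^(j+1) of the cube. *)
- apply: (@integral_cube_cover_lty _
    (fun j => ((2 ^+ j) `^ q)^-1) (fun j => 2 ^+ j.+1)
    (4 ^+ n) (2 `^ (- (theta * p)))) => //.
  + by apply: gt0_powR_lt1; rewrite oppr_lt0 mulr_gt0.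
  + move=> j; rewrite powR_exprC// -exprVn -powRN exprS -(mulr_natr (2 * _)).
    rewrite le_eqVlt; apply/orP; left; apply/eqP.
    rewrite [2 `^ (- (theta * p))](_ : _ = 2 `^ (- q) * 2 ^+ n); last first.
      rewrite -powR_mulrn// -!powRD; last by rewrite pnatr_eq0 implybT.
      by congr (_ `^ _); rewrite /q; ring.
    rewrite [2 * 2 ^+ j * 2](_ : _ = 4 * 2 ^+ j); last by ring.
    by rewrite !exprMn -!exprM mulnC; ring.
  + move=> h; rewrite /G2 indicE in_setC; case: (boolP (h \in B)); first by rewrite mulr0 eqxx.
    rewrite notin_setE /B/= mulr1 => /negP; rewrite -ltNge => h1 k0.
    have ex : exists j, `|h| <= 2 ^+ j.+1.
      have [k hk] := exp2_unbounded `|h|; exists k.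
      by rewrite (le_trans (ltW hk))// ler_eXn2l// ltr1n.
    have [j hj jmin] := ex_minnP ex.
    have hj' : 2 ^+ j <= `|h|.
      case: j hj jmin => [|j] hj jmin; first by rewrite expr0 ltW.
      by rewrite leNgt; apply/negP => /ltW /jmin; rewrite ltnn.
    exists j; split => //.
    rewrite /kernel minEle (ltW h1) powR1 mul1r.
    by apply: lbound; rewrite ?exprn_gt0.
Qed.

End slobodeckij_kernel.

(** * L^p norms of functions *)

Section Lnorm_facts.
Context d {T : measurableType d} {R : realType} (m : {measure set T -> \bar R}) (p : R).
Hypothesis p1 : 1 < p.
Implicit Types f g : T -> R.
Local Notation N f := ('N[m]_(p%:E)[EFin \o f%R])%E.

Let p0 : 0 < p. Proof. exact: lt_trans p1. Qed.

Lemma lee_poweR (x y : \bar R) (r : R) : 0 <= r -> (0 <= x)%E -> (x <= y)%E -> (x `^ r <= y `^ r)%E.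
Proof.
move=> r0 x0 xy; apply: gt0_ler_poweR => //.
  by rewrite in_itv/= x0 leey.
by rewrite in_itv/= (le_trans x0 xy) leey.
Qed.

Lemma LnormE f : N f = ((\int[m]_x (`|f x| `^ p)%:E) `^ p^-1)%E.
Proof.
rewrite unlock /Lnorm; congr (_ `^ _)%E; exact: eq_integral.
Qed.

Lemma measurable_powR_norm f : measurable_fun setT f ->
  measurable_fun setT (fun x => (`|f x| `^ p)%:E).
Proof.
move=> mf; apply/measurable_EFinP.
apply: (@measurableT_comp _ _ _ _ _ _ (fun x : R => x `^ p)); first exact: measurable_powR.
exact: measurableT_comp.
Qed.

Lemma le_Lnorm f g : measurable_fun setT f -> measurable_fun setT g ->
  (forall x, `|f x| <= `|g x|) -> (N f <= N g)%E.
Proof.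
move=> mf mg fg; rewrite !LnormE; apply: lee_poweR.
- by rewrite invr_ge0 ltW.
- by apply: integral_ge0 => x _; rewrite lee_fin powR_ge0.
- apply: ge0_le_integral => //.
  + exact: measurable_powR_norm.
  + exact: measurable_powR_norm.
  + by move=> x _; rewrite lee_fin; apply: ge0_ler_powR => //; rewrite ?nnegrE ?(ltW p0).
Qed.

Lemma Lnorm_scale (a : R) f : measurable_fun setT f ->
  N (fun x => a * f x) = (`|a|%:E * N f)%E.
Proof.
move=> mf; rewrite !LnormE.
under eq_integral do rewrite normrM powRM// EFinM.
rewrite ge0_integralZl//; last exact: measurable_powR_norm.
rewrite poweRM ?lee_fin ?powR_ge0//; last by apply: integral_ge0 => x _; rewrite lee_fin powR_ge0.
by rewrite poweR_EFin -powRrM mulfV ?gt_eqF// powRr1.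
Qed.

Lemma Lnorm_triangle f g : measurable_fun setT f -> measurable_fun setT g ->
  (N (fun x => f x + g x) <= N f + N g)%E.
Proof. by move=> mf mg; apply: minkowski_EFin => //; exact: ltW. Qed.

Lemma Lnorm_eq f g : f =1 g -> N f = N g.
Proof. by move=> fg; congr Lnorm; apply/funext => x /=; rewrite fg. Qed.

End Lnorm_facts.

Section Lp_norm_facts.
Context {R : realType} {n : nat} (p : R).
Hypothesis p1 : 1 < p.
Local Notation mu := (lebesgue_rV R n).
Implicit Types (f g : 'rV[R]_n -> R) (O V : set 'rV[R]_n).
Local Notation N f := ('N[mu]_(p%:E)[EFin \o f%R])%E.

Let p0 : 0 < p. Proof. exact: lt_trans p1. Qed.

Lemma Lp_norm_ge0 O f : (0 <= Lp_norm O p f)%E.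
Proof. exact: Lnorm_ge0. Qed.

Lemma Lp_norm_setT f : Lp_norm setT p f = N f.
Proof. by rewrite /Lp_norm; apply: Lnorm_eq => x; rewrite patchE in_setT. Qed.

(** The comparison is asked only where f is nonzero, so the lemma serves both for restricting to a
    smaller set and for extending by zero to a larger one. *)
Lemma le_Lp_norm O V f g : measurable O -> measurable V ->
  measurable_fun O f -> measurable_fun V g ->
  (forall x, O x -> f x != 0 -> V x /\ `|f x| <= `|g x|) -> (Lp_norm O p f <= Lp_norm V p g)%E.
Proof.
move=> mO mV /(measurable_restrictT _ mO) mf /(measurable_restrictT _ mV) mg fg.
apply: le_Lnorm => // x; rewrite !patchE; case: ifPn => [|_]; last by rewrite normr0.
rewrite inE => Ox; have [->|fx] := eqVneq (f x) 0; first by rewrite normr0.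
by have [Vx ?] := fg x Ox fx; rewrite mem_set.
Qed.

Lemma Lp_normZ O (a : R) f : measurable O -> measurable_fun O f ->
  Lp_norm O p (fun x => a * f x) = (`|a|%:E * Lp_norm O p f)%E.
Proof.
move=> mO /(measurable_restrictT _ mO) mf; rewrite -Lnorm_scale//.
apply: Lnorm_eq => x; rewrite !patchE; case: ifPn => //; by rewrite mulr0.
Qed.

Lemma Lp_normD O f g : measurable O -> measurable_fun O f -> measurable_fun O g ->
  (Lp_norm O p (fun x => f x + g x)%R <= Lp_norm O p f + Lp_norm O p g)%E.
Proof.
move=> mO /(measurable_restrictT _ mO) mf /(measurable_restrictT _ mO) mg.
rewrite /Lp_norm; apply: le_trans _ (Lnorm_triangle _ p1 mf mg).
rewrite le_eqVlt; apply/orP; left; apply/eqP; apply: Lnorm_eq => x.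
by rewrite !patchE; case: ifPn; rewrite ?addr0.
Qed.

Lemma Lp_norm_cube_lty (B r : R) : 0 <= B -> 0 <= r ->
  (N (fun x => B * \1_[set x : 'rV[R]_n | `|x| <= r] x)%R < +oo)%E.
Proof.
move=> B0 r0; rewrite LnormE; apply: poweR_lty.
under eq_integral.
  move=> x _; rewrite (_ : `|_| `^ p = B `^ p * \1_[set x : 'rV[R]_n | `|x| <= r] x).
    rewrite EFinM; over.
  rewrite indicE; case: (x \in _); rewrite ?mulr1 ?ger0_norm//.
    by rewrite !mulr0 powR0// gt_eqF.
  by rewrite mulr0.
rewrite /= ge0_integralZl//; last 2 first.
  by apply/measurable_EFinP; apply: measurable_indic; exact: measurable_norm_le.
  by rewrite lee_fin powR_ge0.
rewrite integral_indic//; last exact: measurable_norm_le.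
rewrite [X in (_ * X)%E](_ : _ = ((r *+ 2) ^+ n)%:E); last by rewrite setIT; exact: lebesgue_norm_le.
by rewrite -EFinM ltry.
Qed.

Lemma test_measurable O f : is_test O f -> measurable_fun setT f.
Proof. by move=> [sf _ _]; apply: continuous_measurable_rV; exact: smooth_continuous. Qed.

Lemma test_Lnorm_lty O f : is_test O f -> (N f < +oo)%E.
Proof.
move=> tf; have [B B0 fB] := is_test_bounded tf.
have [r r0 fr] := is_test_bounded_supp tf.
apply: le_lt_trans (Lp_norm_cube_lty B0 r0).
apply: le_Lnorm => //; first exact: test_measurable tf.
  by apply: measurable_funM => //; apply: measurable_indic; exact: measurable_norm_le.
move=> x; have [->|fx0] := eqVneq (f x) 0; first by rewrite normr0.
by rewrite indicE mem_set ?mulr1 ?(ger0_norm B0)//=; exact: fr.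
Qed.

Lemma Lnorm_shift f (h : 'rV[R]_n) : measurable_fun setT f -> N (fun x => f (x + h)) = N f.
Proof.
move=> mf; rewrite !LnormE; apply: (congr1 (fun z => z `^ p^-1)%E).
rewrite -[RHS](ge0_integral_rV_shift h)//.
exact: measurable_powR_norm.
Qed.

End Lp_norm_facts.

(** * The Slobodeckij seminorm as an L^p norm on the product space *)

Section slobodeckij_facts.
Context {R : realType} {n : nat} (p theta : R).
Hypothesis p1 : 1 < p.
Hypothesis theta01 : 0 < theta < 1.
Local Notation mu := (lebesgue_rV R n).
Local Notation mu2 := (mu \x mu)%E.
Implicit Types (f g : 'rV[R]_n -> R) (O V : set 'rV[R]_n) (x y h : 'rV[R]_n).
Local Notation N f := ('N[mu]_(p%:E)[EFin \o f%R])%E.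
Local Notation N2 f := ('N[mu2]_(p%:E)[EFin \o f%R])%E.
Local Notation q := (n%:R + theta * p).

Let p0 : 0 < p. Proof. exact: lt_trans p1. Qed.

Lemma restrict0E O f x : (f \_ O) x = if x \in O then f x else 0.
Proof. exact: patchE. Qed.

Definition slob_weight h : R := enorm h `^ (- (q / p)).

Lemma slob_weight_pow h : slob_weight h `^ p = (enorm h `^ q)^-1.
Proof. by rewrite /slob_weight -powRrM -powRN mulNr divfK ?gt_eqF. Qed.

Lemma slob_weight_ge0 h : 0 <= slob_weight h.
Proof. exact: powR_ge0. Qed.

(** The seminorm is the L^p norm of this quotient ([slobE]), so that Minkowski's inequality,
    homogeneity and monotonicity of L^p norms apply to it. Restricting f to O makes the quotient
    measurable everywhere when f is measurable on O. *)
Definition slob_quotient O f (z : 'rV[R]_n * 'rV[R]_n) : R :=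
  ((f \_ O) z.1 - (f \_ O) z.2) * slob_weight (z.1 - z.2) * \1_(O `*` O) z.

Lemma slobE O f : slobodeckij O p theta f = N2 (slob_quotient O f).
Proof.
rewrite LnormE /slobodeckij; apply: (congr1 (fun z => z `^ p^-1)%E).
rewrite [LHS]integral_mkcond; apply: eq_integral => -[x y] _.
rewrite patchE /slob_quotient indicE; case: ifPn => [|_]; last first.
  by rewrite mulr0 normr0 powR0// gt_eqF.
rewrite inE /= => -[Ox Oy]; rewrite mulr1 normrM powRM// (ger0_norm (slob_weight_ge0 _)).
by rewrite slob_weight_pow !restrict0E !mem_set.
Qed.

Lemma measurable_diff_rV :
  measurable_fun setT (fun z : 'rV[R]_n * 'rV[R]_n => z.1 - z.2).
Proof.
apply: measurable_fun_coordP => i.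
rewrite (_ : (fun _ => _) = (fun z : 'rV[R]_n * 'rV[R]_n => z.1 ord0 i - z.2 ord0 i)).
  apply: measurable_funB.
    exact: measurableT_comp (measurable_coord i) measurable_fst.
  exact: measurableT_comp (measurable_coord i) measurable_snd.
by apply/funext => z; rewrite !mxE.
Qed.

Lemma measurable_slob_weight : measurable_fun setT slob_weight.
Proof.
apply: (@measurableT_comp _ _ _ _ _ _ (fun x : R => x `^ (- (q / p)))).
  exact: measurable_powR.
exact: measurable_enorm.
Qed.

Lemma measurable_slob_quotient O f : measurable O -> measurable_fun O f ->
  measurable_fun setT (slob_quotient O f).
Proof.
move=> mO /(measurable_restrictT _ mO) mf.
apply: measurable_funM; last by apply: measurable_indic; exact: measurableX.
apply: measurable_funM; last exact: measurableT_comp measurable_slob_weight measurable_diff_rV.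
apply: measurable_funB.
  exact: measurableT_comp mf measurable_fst.
exact: measurableT_comp mf measurable_snd.
Qed.

Lemma le_slob O V f : measurable O -> measurable V -> V `<=` O -> measurable_fun O f ->
  (slobodeckij V p theta f <= slobodeckij O p theta f)%E.
Proof.
move=> mO mV VO mf; rewrite !slobE; apply: le_Lnorm => //.
- apply: measurable_slob_quotient => //; exact: measurable_funS mf.
- exact: measurable_slob_quotient.
move=> [x y]; rewrite /slob_quotient !indicE.
have [/set_mem[/= Vx Vy]|_] := boolP ((x, y) \in V `*` V); last by rewrite mulr0 normr0.
have Ox := VO _ Vx; have Oy := VO _ Vy.
by rewrite mem_set//= !restrict0E !mem_set.
Qed.

Lemma slobD O f g : measurable O -> measurable_fun O f -> measurable_fun O g ->
  (slobodeckij O p theta (fun x => f x + g x)%R <=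
   slobodeckij O p theta f + slobodeckij O p theta g)%E.
Proof.
move=> mO mf mg; rewrite !slobE.
apply: le_trans _ (Lnorm_triangle _ p1 (measurable_slob_quotient mO mf) (measurable_slob_quotient mO mg)).
rewrite le_eqVlt; apply/orP; left; apply/eqP; apply: Lnorm_eq => -[x y].
rewrite /slob_quotient /= !restrict0E.
by case: (x \in O); case: (y \in O); ring.
Qed.

Lemma slobZ O (a : R) f : measurable O -> measurable_fun O f ->
  slobodeckij O p theta (fun x => a * f x) = (`|a|%:E * slobodeckij O p theta f)%E.
Proof.
move=> mO mf; rewrite !slobE -Lnorm_scale//; last exact: measurable_slob_quotient.
apply: Lnorm_eq => -[x y]; rewrite /slob_quotient /= !restrict0E.
by case: (x \in O); case: (y \in O); ring.
Qed.

Definition kernel_root h : R := Num.min 1 `|h| * slob_weight h.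

Lemma min1_norm_ge0 h : 0 <= Num.min 1 `|h|.
Proof. by rewrite le_min ler01/=. Qed.

Lemma kernel_root_ge0 h : 0 <= kernel_root h.
Proof. by rewrite mulr_ge0 ?slob_weight_ge0// min1_norm_ge0. Qed.

Lemma kernel_root_pow h : kernel_root h `^ p = kernel p q h.
Proof.
by rewrite powRM ?slob_weight_ge0// ?min1_norm_ge0// slob_weight_pow.
Qed.

(** The L^p norm of [kernel_root]. By [integral_kernel_lty] the integral is finite, so [fine] loses
    nothing. *)
Definition kernel_const : R := fine ((\int[mu]_h (kernel p q h)%:E) `^ p^-1)%E.

Lemma kernel_constE : (kernel_const%:E = (\int[mu]_h (kernel p q h)%:E) `^ p^-1)%E.
Proof.
rewrite fineK// ge0_fin_numE ?poweR_ge0// poweR_lty//.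
exact: integral_kernel_lty.
Qed.

Lemma kernel_const_ge0 : 0 <= kernel_const.
Proof. by rewrite fine_ge0// poweR_ge0. Qed.

Lemma measurable_kernel_root : measurable_fun setT kernel_root.
Proof. by apply: measurable_funM; [exact: measurable_minnorm|exact: measurable_slob_weight]. Qed.

Lemma integral_kernel_shift x : (\int[mu]_y (kernel p q (x - y))%:E = \int[mu]_h (kernel p q h)%:E)%E.
Proof.
under eq_integral do rewrite -kernelN opprB.
apply: (ge0_integral_rV_shift (- x) (f := fun h => (kernel p q h)%:E)).
  by apply/measurable_EFinP; exact: measurable_kernel.
by move=> h; rewrite lee_fin kernel_ge0.
Qed.

(** Integrating first over the second variable, translation invariance turns the inner integral into
    a constant, whatever the first variable. *)
Lemma Lnorm_kernel_fst g : measurable_fun setT g ->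
  N2 (fun z => kernel_root (z.1 - z.2) * g z.1) = (kernel_const%:E * N g)%E.
Proof.
move=> mg; rewrite !LnormE kernel_constE.
have mk : measurable_fun setT (fun z : 'rV[R]_n * 'rV[R]_n => kernel_root (z.1 - z.2) * g z.1).
  apply: measurable_funM; last exact: measurableT_comp mg measurable_fst.
  exact: measurableT_comp measurable_kernel_root measurable_diff_rV.
rewrite fubini_tonelli1; last 2 first.
  exact: measurable_powR_norm.
  by move=> z; rewrite lee_fin powR_ge0.
rewrite -poweRM; last 2 first.
  by apply: integral_ge0 => h _; rewrite lee_fin kernel_ge0.
  by apply: integral_ge0 => h _; rewrite lee_fin powR_ge0.
apply: (congr1 (fun z => z `^ p^-1)%E).
rewrite -ge0_integralZl//; last 2 first.
  exact: measurable_powR_norm.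
  by apply: integral_ge0 => h _; rewrite lee_fin kernel_ge0.
apply: eq_integral => x _; rewrite /fubini_F /=.
under eq_integral do rewrite normrM powRM// (ger0_norm (kernel_root_ge0 _)) kernel_root_pow EFinM.
have mkx : measurable_fun setT (fun y : 'rV[R]_n => (kernel p q (x - y))%:E).
  apply/measurable_EFinP; apply: measurableT_comp (measurable_kernel _ _) _.
  apply: measurable_fun_coordP => i.
  rewrite (_ : (fun _ => _) = (fun t : 'rV[R]_n => x ord0 i - t ord0 i)); last first.
    by apply/funext => t; rewrite !mxE.
  by apply: measurable_funB => //; exact: measurable_coord.
have kx0 y : setT y -> (0 <= (kernel p q (x - y))%:E)%E by rewrite lee_fin kernel_ge0.
have g0 : (0 <= (`|g x| `^ p)%:E)%E by rewrite lee_fin powR_ge0.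
by rewrite (ge0_integralZr mu measurableT mkx kx0 g0) integral_kernel_shift.
Qed.

Lemma Lnorm_kernel_snd g : measurable_fun setT g ->
  N2 (fun z => kernel_root (z.1 - z.2) * g z.2) = (kernel_const%:E * N g)%E.
Proof.
move=> mg; rewrite !LnormE kernel_constE.
have mk : measurable_fun setT (fun z : 'rV[R]_n * 'rV[R]_n => kernel_root (z.1 - z.2) * g z.2).
  apply: measurable_funM; last exact: measurableT_comp mg measurable_snd.
  exact: measurableT_comp measurable_kernel_root measurable_diff_rV.
rewrite fubini_tonelli2; last 2 first.
  exact: measurable_powR_norm.
  by move=> z; rewrite lee_fin powR_ge0.
rewrite -poweRM; last 2 first.
  by apply: integral_ge0 => h _; rewrite lee_fin kernel_ge0.
  by apply: integral_ge0 => h _; rewrite lee_fin powR_ge0.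
apply: (congr1 (fun z => z `^ p^-1)%E).
rewrite -ge0_integralZl//; last 2 first.
  exact: measurable_powR_norm.
  by apply: integral_ge0 => h _; rewrite lee_fin kernel_ge0.
apply: eq_integral => x _; rewrite /fubini_G /=.
under eq_integral do rewrite normrM powRM// (ger0_norm (kernel_root_ge0 _)) kernel_root_pow EFinM.
have mkx : measurable_fun setT (fun y : 'rV[R]_n => (kernel p q (y - x))%:E).
  apply/measurable_EFinP; apply: measurableT_comp (measurable_kernel _ _) _.
  exact: measurable_shift_rV.
have kx0 y : setT y -> (0 <= (kernel p q (y - x))%:E)%E by rewrite lee_fin kernel_ge0.
have g0 : (0 <= (`|g x| `^ p)%:E)%E by rewrite lee_fin powR_ge0.
rewrite (ge0_integralZr mu measurableT mkx kx0 g0).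
apply: (congr1 (fun z => z * (`|g x| `^ p)%:E)%E).
apply: (ge0_integral_rV_shift (- x) (f := fun h => (kernel p q h)%:E)).
  by apply/measurable_EFinP; exact: measurable_kernel.
by move=> h; rewrite lee_fin kernel_ge0.
Qed.

(* With [f] extended by zero outside [V], a point outside [V] contributes only
   through [chi x - chi y], so the same Leibniz estimate covers all pairs. *)
Lemma slob_mul_extend O V (chi f : 'rV[R]_n -> R) (C : R) :
  measurable O -> measurable V -> V `<=` O ->
  measurable_fun setT chi -> measurable_fun V f -> 0 <= C ->
  (forall x, `|chi x| <= C) ->
  (forall x y, `|chi x - chi y| <= C * Num.min 1 `|x - y|) ->
  (forall x, ~ V x -> chi x = 0) ->
  (slobodeckij O p theta (fun x => chi x * f x)%R <=
    C%:E * (slobodeckij V p theta f + (2 * kernel_const)%:E * Lp_norm V p f))%E.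
Proof.
move=> mO mV VO mchi mf C0 chiC chiL chi0.
have mf0 : measurable_fun setT (f \_ V) by exact/(measurable_restrictT _ mV).
rewrite !slobE.
have mk1 : measurable_fun setT (fun z : 'rV[R]_n * 'rV[R]_n => kernel_root (z.1 - z.2) * `|(f \_ V) z.1|).
  apply: measurable_funM.
    exact: measurableT_comp measurable_kernel_root measurable_diff_rV.
  exact: measurableT_comp (measurableT_comp mf0 measurable_fst).
have mk2 : measurable_fun setT (fun z : 'rV[R]_n * 'rV[R]_n => kernel_root (z.1 - z.2) * `|(f \_ V) z.2|).
  apply: measurable_funM.
    exact: measurableT_comp measurable_kernel_root measurable_diff_rV.
  exact: measurableT_comp (measurableT_comp mf0 measurable_snd).
have mq : measurable_fun setT (fun z => `|slob_quotient V f z|).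
  exact: measurableT_comp (measurable_slob_quotient mV mf).
have mchif : measurable_fun O (fun x => chi x * f x).
  apply/(measurable_restrictT _ mO).
  rewrite (_ : _ \_ _ = fun x => chi x * (f \_ V) x); first exact: measurable_funM.
  apply/funext => x; rewrite !restrict0E.
  have [Vx|/negP Vx] := boolP (x \in V); first by rewrite mem_set//; apply: VO; rewrite inE in Vx.
  by rewrite chi0 ?mul0r; [case: ifP|move=> Vx'; apply: Vx; rewrite inE].
pose H (z : 'rV[R]_n * 'rV[R]_n) := C * ((`|slob_quotient V f z| +
  kernel_root (z.1 - z.2) * `|(f \_ V) z.1|) + kernel_root (z.1 - z.2) * `|(f \_ V) z.2|).
have H_ge0 z : 0 <= H z.
  apply: mulr_ge0 => //; apply: addr_ge0; last by rewrite mulr_ge0// kernel_root_ge0.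
  by apply: addr_ge0 => //; rewrite mulr_ge0// kernel_root_ge0.
have mH0 := measurable_funD (measurable_funD mq mk1) mk2.
apply: (@le_trans _ _ (N2 H)).
  apply: le_Lnorm => //; first exact: measurable_slob_quotient.
    exact: measurable_funM.
  move=> [x y]; rewrite (ger0_norm (H_ge0 _)).
  rewrite {1}/slob_quotient /= indicE; case: (boolP (_ \in O `*` O)); last first.
    by rewrite mulr0 normr0.
  rewrite /H /slob_quotient /= indicE inE /= => -[Ox Oy]; rewrite mulr1 !restrict0E !(mem_set Ox) !(mem_set Oy).
  rewrite normrM (ger0_norm (slob_weight_ge0 _)) /kernel_root.
  have w0 := slob_weight_ge0 (x - y); move: (slob_weight _) w0 => w w0.
  have m0 := min1_norm_ge0 (x - y); have L := chiL x y; have Cx := chiC x.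
  move: (Num.min 1 _) m0 L => m m0 L.
  have [Vx|nVx] := boolP (x \in V); have [Vy|nVy] := boolP (y \in V).
  - rewrite (mem_set (conj (set_mem Vx) (set_mem Vy) : (V `*` V) (x, y))).
    rewrite mulr1 normrM (ger0_norm w0).
    have -> : chi x * f x - chi y * f y = chi x * (f x - f y) + (chi x - chi y) * f y by ring.
    apply: (@le_trans _ _ ((C * `|f x - f y| + C * m * `|f y|) * w)).
      rewrite ler_wpM2r// (le_trans (ler_normD _ _))// !normrM lerD// ler_wpM2r//.
    have : 0 <= `|f x| * (C * m * w) by rewrite !mulr_ge0.
    by lra.
  - rewrite [chi y]chi0 ?mul0r ?subr0; last by move=> Vy; rewrite mem_set in nVy.
    rewrite [chi y]chi0 ?subr0 in L; last by move=> Vy; rewrite mem_set in nVy.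
    rewrite normr0 mulr0 addr0 normrM.
    apply: (@le_trans _ _ (C * m * `|f x| * w)); first by rewrite ler_wpM2r// ler_wpM2r.
    have : 0 <= C * `|f x * w * ((x, y) \in V `*` V)%:R| by rewrite mulr_ge0.
    by lra.
  - rewrite [chi x]chi0 ?mul0r ?sub0r; last by move=> Vx; rewrite mem_set in nVx.
    rewrite [chi x]chi0 ?sub0r in L; last by move=> Vx; rewrite mem_set in nVx.
    rewrite normr0 mulr0 addr0 normrN normrM; rewrite normrN in L.
    apply: (@le_trans _ _ (C * m * `|f y| * w)); first by rewrite ler_wpM2r// ler_wpM2r.
    have : 0 <= C * `|- f y * w * ((x, y) \in V `*` V)%:R| by rewrite mulr_ge0.
    by lra.
  - rewrite [chi x]chi0 ?mul0r ?sub0r; last by move=> Vx; rewrite mem_set in nVx.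
    rewrite [chi y]chi0 ?mul0r ?subr0; last by move=> Vy; rewrite mem_set in nVy.
    by rewrite oppr0 normr0 mul0r mulr_ge0// !addr_ge0// mulr_ge0// mulr_ge0.
rewrite /H Lnorm_scale// (ger0_norm C0); apply: lee_wpmul2l; first by rewrite lee_fin.
apply: le_trans (Lnorm_triangle _ p1 (measurable_funD mq mk1) mk2) _.
have mfn : measurable_fun setT (fun x => `|(f \_ V) x|) by exact: measurableT_comp.
have fn : (N (fun x => `|(f \_ V) x|) <= Lp_norm V p f)%E.
  by apply: le_Lnorm => // x; rewrite normr_id.
rewrite (Lnorm_kernel_snd mfn) mulr_natl mulr2n EFinD.
rewrite ge0_muleDl ?lee_fin ?kernel_const_ge0// [leRHS]addeA.
apply: leeD; last by apply: lee_wpmul2l => //; rewrite lee_fin kernel_const_ge0.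
apply: le_trans (Lnorm_triangle _ p1 mq mk1) _.
apply: leeD; first by apply: le_Lnorm => // [|z]; [exact: measurable_slob_quotient|rewrite normr_id].
rewrite (Lnorm_kernel_fst mfn).
by apply: lee_wpmul2l => //; rewrite lee_fin kernel_const_ge0.
Qed.

End slobodeckij_facts.

(** * Translation differences in L^p *)

Section translation_differences.
Context {R : realType} {n : nat} (p : R).
Hypothesis p1 : 1 < p.
Local Notation mu := (lebesgue_rV R n).
Local Notation mu2 := (mu \x mu)%E.
Implicit Types (f g : 'rV[R]_n -> R) (O V : set 'rV[R]_n) (x y h : 'rV[R]_n).
Local Notation N f := ('N[mu]_(p%:E)[EFin \o f%R])%E.
Local Notation N2 f := ('N[mu2]_(p%:E)[EFin \o f%R])%E.
Local Notation basis i := (delta_mx ord0 i : 'rV[R]_n).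

Let p0 : 0 < p. Proof. exact: lt_trans p1. Qed.

(** The L^p modulus of continuity; translation invariance of the measure makes it subadditive in
    h. *)
Definition Lp_diff f h : \bar R := N (fun x => f (x + h) - f x).

Lemma measurable_shift_fun f h : measurable_fun setT f -> measurable_fun setT (fun x => f (x + h)).
Proof. by move=> mf; exact: measurableT_comp mf (measurable_shift_rV h). Qed.

Lemma measurable_diff_fun f h : measurable_fun setT f -> measurable_fun setT (fun x => f (x + h) - f x).
Proof. by move=> mf; apply: measurable_funB => //; exact: measurable_shift_fun. Qed.

Lemma Lp_diff_ge0 f h : (0 <= Lp_diff f h)%E.
Proof. exact: Lnorm_ge0. Qed.

Lemma Lp_diff0 f : Lp_diff f 0 = 0%E.
Proof.
rewrite /Lp_diff (_ : EFin \o _ = cst 0%E) ?Lnorm0//.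
  by rewrite eqe gt_eqF.
by apply/funext => x /=; rewrite addr0 subrr.
Qed.

Lemma Lp_diffD f a b : measurable_fun setT f ->
  (Lp_diff f (a + b)%R <= Lp_diff f a + Lp_diff f b)%E.
Proof.
move=> mf; have := Lnorm_triangle mu p1 (measurable_diff_fun a mf)
  (measurable_shift_fun a (measurable_diff_fun b mf)).
rewrite (Lnorm_shift p a (measurable_diff_fun b mf)); apply: le_trans.
rewrite le_eqVlt; apply/orP; left; apply/eqP; apply: Lnorm_eq => x.
by rewrite (addrA x); ring.
Qed.

Lemma Lp_diffMn f h k : measurable_fun setT f ->
  (Lp_diff f (h *+ k) <= k%:R%:E * Lp_diff f h)%E.
Proof.
move=> mf; elim: k => [|k ih]; first by rewrite mulr0n Lp_diff0 mul0e.
rewrite mulrS (le_trans (Lp_diffD _ _ mf))// -[k.+1%:R]/((1 + k)%:R) natrD EFinD ge0_muleDl ?lee_fin//.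
by rewrite mul1e leeD2l.
Qed.

Lemma Lp_diff_le2 f h : measurable_fun setT f -> (Lp_diff f h <= 2%:E * N f)%E.
Proof.
move=> mf; have mNf : measurable_fun setT (fun x => -1 * f x) by exact: measurable_funM.
have := Lnorm_triangle mu p1 (measurable_shift_fun h mf) mNf.
rewrite Lnorm_scale// Lnorm_shift// normrN normr1 mul1e => H.
rewrite -[2%:E]/((1 + 1)%:E) EFinD ge0_muleDl ?lee_fin// mul1e; apply: le_trans H.
by rewrite le_eqVlt; apply/orP; left; apply/eqP; apply: Lnorm_eq => x; rewrite mulN1r.
Qed.

(** The translation is cut into k+1 equal steps. Each step is its first-order part plus a Taylor
    error quadratic in the step length, so by subadditivity the total error is of order 1/(k+1) and
    disappears in the limit. *)
Lemma Lp_diff_basis O f i (t : R) : is_test O f ->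
  (Lp_diff f (t *: basis i) <= `|t|%:E * N (partial i f))%E.
Proof.
move=> tf; have tdf := is_test_partial i tf.
have mf := test_measurable tf; have mdf := test_measurable tdf.
have [B B0 hB] := test_taylor1 i tf.
have [r r0 fr] := is_test_bounded_supp tf.
have [r' r'0 dfr] := is_test_bounded_supp tdf.
(* Beyond radius [rho] both f(x) and f(x + s e_i) vanish for |s| <= |t|, so the Taylor error is
   dominated by [W] below, of finite L^p norm. *)
pose rho := r + r' + `|t|.
have rho0 : 0 <= rho by rewrite !addr_ge0.
pose W := fun x => B * \1_[set x : 'rV[R]_n | `|x| <= rho] x.
have mW : measurable_fun setT W.
  by apply: measurable_funM => //; apply: measurable_indic; exact: measurable_norm_le.
have NW : (N W < +oo)%E by exact: Lp_norm_cube_lty.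
have small (s : R) : `|s| <= `|t| ->
    (Lp_diff f (s *: basis i) <= `|s|%:E * N (partial i f) + (s ^+ 2)%:E * N W)%E.
  move=> st; rewrite -[s ^+ 2]ger0_norm ?sqr_ge0// -!Lnorm_scale//.
  have m1 : measurable_fun setT (fun x => s * partial i f x) by exact: measurable_funM.
  have m2 : measurable_fun setT (fun x => s ^+ 2 * W x) by exact: measurable_funM.
  have ma : measurable_fun setT (fun x => `|s * partial i f x|) by exact: measurableT_comp.
  apply: (@le_trans _ _ (N (fun x => `|s * partial i f x| + s ^+ 2 * W x))); last first.
    apply: le_trans (Lnorm_triangle mu p1 ma m2) _; apply: leeD => //.
    by apply: le_Lnorm => // x; rewrite normr_id.
  apply: le_Lnorm => //; [exact: measurable_diff_fun|exact: measurable_funD|].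
  move=> x; have W0 : 0 <= W x by rewrite mulr_ge0.
  rewrite [leRHS]ger0_norm; last by rewrite addr_ge0// mulr_ge0// sqr_ge0.
  have [xr|xr] := leP `|x| rho.
    rewrite /W indicE mem_set//= mulr1 (addrC x).
    have := hB x s; set a := f _ - f x; set b := s * _ => H.
    rewrite -(subrK b a) (le_trans (ler_normD _ _))// addrC lerD2l//.
    by rewrite (mulrC _ B).
  have fx0 : f x = 0.
    apply/eqP; apply: contraTT xr => /fr xr; rewrite -leNgt (le_trans xr)//.
    by rewrite /rho -addrA lerDl addr_ge0.
  have fxs0 : f (x + s *: basis i) = 0.
    apply/eqP; apply: contraTT xr => /fr xr; rewrite -leNgt.
    rewrite -[x](addrK (s *: basis i)) (le_trans (ler_normB _ _))//.
    apply: lerD; first by rewrite (le_trans xr)// lerDl.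
    exact: le_trans (norm_basis_scale _ _) st.
  by rewrite fx0 fxs0 subrr normr0 addr_ge0// mulr_ge0// sqr_ge0.
apply/lee_addgt0Pr => e e0.
have Nd := test_Lnorm_lty p1 tdf.
have NWE : (fine (N W))%:E = N W by rewrite fineK// ge0_fin_numE// Lnorm_ge0.
have NdE : (fine (N (partial i f)))%:E = N (partial i f) by rewrite fineK// ge0_fin_numE// Lnorm_ge0.
have fW0 : 0 <= fine (N W) by rewrite fine_ge0// Lnorm_ge0.
(* The k+1 errors (t/(k+1))^2 |W| add up to t^2 |W| / (k+1), less than e for this k. *)
have [k hk] : exists k : nat, t ^+ 2 * fine (N W) / e < k.+1%:R.
  exists (Num.bound (t ^+ 2 * fine (N W) / e)).
  rewrite (lt_trans (archi_boundP _))//; last by rewrite ltr_nat.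
  by apply: divr_ge0; [rewrite mulr_ge0// sqr_ge0|exact: ltW].
have k0 : 0 < k.+1%:R :> R by [].
pose s := t / k.+1%:R.
have -> : t *: basis i = (s *: basis i) *+ k.+1.
  by rewrite -scaler_nat scalerA /s mulrC divfK// gt_eqF.
apply: le_trans (Lp_diffMn _ _ mf) _.
have st : `|s| <= `|t|.
  by rewrite normrM normfV (gtr0_norm k0) ler_pdivrMr// ler_peMr// ler1n.
apply: le_trans (lee_wpmul2l _ (small s st)) _; first by rewrite lee_fin.
rewrite -NWE -NdE -!(EFinM, EFinD) lee_fin.
have -> : k.+1%:R * (`|s| * fine (N (partial i f)) + s ^+ 2 * fine (N W)) =
   `|t| * fine (N (partial i f)) + t ^+ 2 * fine (N W) / k.+1%:R.
  rewrite /s normrM normfV (gtr0_norm k0); field.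
  by rewrite gt_eqF.
by rewrite lerD2l ler_pdivrMr// -ler_pdivrMl// mulrC ltW.
Qed.

(** For |h| > 1 the trivial bound by twice the norm is used; otherwise h is reached along the
    coordinate axes, each contributing |h_i| times the norm of a partial derivative. *)
Lemma Lp_diff_bound O f h : is_test O f ->
  (Lp_diff f h <= (Num.min 1 `|h|)%:E * (2%:E * N f + \sum_(i < n) N (partial i f)))%E.
Proof.
move=> tf; have mf := test_measurable tf.
have S0 : (0 <= \sum_(i < n) N (partial i f))%E by apply: sume_ge0 => i _; exact: Lnorm_ge0.
have N0 : (0 <= 2%:E * N f)%E by rewrite mule_ge0// Lnorm_ge0.
rewrite /Order.min; case: ifPn => _.
  by rewrite mul1e (le_trans (Lp_diff_le2 _ mf))// leeDl.
apply: (@le_trans _ _ (`|h|%:E * \sum_(i < n) N (partial i f))%E); last first.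
  by apply: lee_wpmul2l; [rewrite lee_fin|rewrite leeDr].
rewrite -big_enum ge0_sume_distrr; last by move=> i _; exact: Lnorm_ge0.
rewrite {1}(row_sum_basis h); elim: (enum _) => [|i r ih].
  by rewrite !big_nil Lp_diff0.
rewrite !big_cons (le_trans (Lp_diffD _ _ mf))// leeD//.
apply: le_trans (Lp_diff_basis _ _ tf) _.
by apply: lee_wpmul2r; [exact: Lnorm_ge0|rewrite lee_fin coord_le_norm].
Qed.

(** With y = x + h and the integrals exchanged, the p-th power of the seminorm is the integral over
    h of [Lp_diff f h] to the power p divided by |h|^q, and the hypothesis turns this into the
    integral of [kernel]. *)
Lemma slob_le_diff (theta K : R) f : 0 < theta < 1 -> 0 <= K -> measurable_fun setT f ->
  (forall h, (Lp_diff f h <= (Num.min 1 `|h| * K)%:E)%E) ->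
  (slobodeckij setT p theta f <= (@kernel_const R n p theta * K)%:E)%E.
Proof.
move=> t01 K0 mf fK.
rewrite slobE// LnormE.
have mq := measurable_slob_quotient p theta measurableT mf.
have mqp := measurable_powR_norm p mq.
rewrite fubini_tonelli1//.
rewrite /fubini_F.
pose G (z : 'rV[R]_n * 'rV[R]_n) := (`|slob_quotient p theta setT f (z.1, z.2 + z.1)| `^ p)%:E.
have mG : measurable_fun setT G.
  have mt : measurable_fun setT (fun z : 'rV[R]_n * 'rV[R]_n => (z.1, z.2 + z.1)).
    apply: measurable_fun_pair; first exact: measurable_fst.
    apply: measurable_fun_coordP => i.
    rewrite (_ : (fun _ => _) = (fun z : 'rV[R]_n * 'rV[R]_n => z.2 ord0 i + z.1 ord0 i)).
      apply: measurable_funD.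
        exact: measurableT_comp (measurable_coord i) measurable_snd.
      exact: measurableT_comp (measurable_coord i) measurable_fst.
    by apply/funext => z; rewrite !mxE.
  exact: measurableT_comp mqp mt.
have G0 z : (0 <= G z)%E by rewrite lee_fin powR_ge0.
have -> : (\int[mu]_x \int[mu]_y (`|slob_quotient p theta setT f (x, y)| `^ p)%:E =
    \int[mu]_x \int[mu]_h G (x, h))%E.
  apply: eq_integral => x _; rewrite /G/=; apply/esym.
  apply: (ge0_integral_rV_shift x (f := fun y => (`|slob_quotient p theta setT f (x, y)| `^ p)%:E)).
    exact: measurableT_comp mqp (measurable_pair1 x).
  by move=> y; rewrite lee_fin powR_ge0.
rewrite fubini_tonelli//.
have inner h : (\int[mu]_x G (x, h) <= (kernel p (n%:R + theta * p) h * K `^ p)%:E)%E.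
  have GE x : (G (x, h) = (slob_weight p theta (- h) `^ p)%:E * (`|f (x + h) - f x| `^ p)%:E)%E.
    rewrite /G /slob_quotient /= !restrict0E !in_setT /= indicE mem_set// mulr1 opprD addrCA subrr addr0.
    rewrite normrM powRM// (ger0_norm (slob_weight_ge0 _ _ _)) EFinM muleC; congr ((_ * (_ `^ _)%:E)%E).
    by rewrite distrC (addrC h).
  under eq_integral do rewrite GE.
  rewrite ge0_integralZl//; last 2 first.
    exact: measurable_powR_norm (measurable_diff_fun h mf).
    by rewrite lee_fin powR_ge0.
  have -> : (\int[mu]_x (`|f (x + h) - f x| `^ p)%:E = Lp_diff f h `^ p)%E.
    by rewrite poweR_Lnorm ?gt_eqF//; apply: eq_integral.
  rewrite slob_weight_pow// -[enorm (- h)]/(enorm (- h)).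
  apply: (@le_trans _ _ (((enorm (- h) `^ (n%:R + theta * p))^-1)%:E * ((Num.min 1 `|h| * K)%:E `^ p))%E).
    apply: lee_wpmul2l; first by rewrite lee_fin invr_ge0 powR_ge0.
    by apply: lee_poweR; [exact: ltW|exact: Lp_diff_ge0|exact: fK].
  rewrite poweR_EFin -EFinM lee_fin powRM ?min1_norm_ge0// -(kernelN _ _ h) /kernel normrN.
  by rewrite le_eqVlt; apply/orP; left; apply/eqP; ring.
have KE : (K%:E = (K `^ p)%:E `^ p^-1)%E.
  by rewrite poweR_EFin -powRrM mulfV ?gt_eqF// powRr1.
rewrite EFinM kernel_constE// KE.
rewrite -poweRM; last 2 first.
  by apply: integral_ge0 => h _; rewrite lee_fin kernel_ge0.
  by rewrite lee_fin powR_ge0.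
apply: lee_poweR.
- by rewrite invr_ge0 ltW.
- by apply: integral_ge0 => h _; apply: integral_ge0.
rewrite -ge0_integralZr//; last 3 first.
  by apply/measurable_EFinP; exact: measurable_kernel.
  by move=> h _; rewrite lee_fin kernel_ge0.
  by rewrite lee_fin powR_ge0.
apply: ge0_le_integral => //.
- by move=> h _; apply: integral_ge0.
- exact: measurable_fun_fubini_tonelli_G.
- apply: (eq_measurable_fun (fun h => (kernel p (n%:R + theta * p) h * K `^ p)%:E)) => //.
  by apply/measurable_EFinP; apply: measurable_funM => //; exact: measurable_kernel.
Qed.

Lemma slob_test_bound (theta : R) O f : 0 < theta < 1 -> is_test O f ->
  (slobodeckij setT p theta f <=
   (@kernel_const R n p theta)%:E * (2%:E * N f + \sum_(i < n) N (partial i f)))%E.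
Proof.
move=> t01 tf.
have Nf := test_Lnorm_lty p1 tf.
have Sf : (\sum_(i < n) N (partial i f) < +oo)%E.
  by apply: lte_sum_pinfty => i _; exact: test_Lnorm_lty (is_test_partial i tf).
have S0 : (0 <= \sum_(i < n) N (partial i f))%E by apply: sume_ge0 => i _; exact: Lnorm_ge0.
have N0 : (0 <= 2%:E * N f)%E by rewrite mule_ge0// Lnorm_ge0.
have Kfin : (2%:E * N f + \sum_(i < n) N (partial i f))%E \is a fin_num.
  rewrite ge0_fin_numE ?adde_ge0// lte_add_pinfty// lte_mul_pinfty//.
have mf := test_measurable tf.
have K0 : 0 <= fine (2%:E * N f + \sum_(i < n) N (partial i f))%E by rewrite fine_ge0// adde_ge0.
rewrite -(fineK Kfin) -EFinM; apply: slob_le_diff => // h.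
by rewrite EFinM (fineK Kfin); exact: Lp_diff_bound tf.
Qed.

End translation_differences.

(** * Distributions given by functions *)

Section conjugate_exponent.
Context {R : realType}.

Lemma conj_exp_gt1 (p : R) : 1 < p -> 1 < conj_exp p.
Proof.
move=> p1; have p0 : 0 < p by exact: lt_trans p1.
have ip1 : p^-1 < 1 by rewrite invf_lt1.
have ip0 : 0 < p^-1 by rewrite invr_gt0.
by rewrite /conj_exp invf_gt1 ?subr_gt0// gtrBl.
Qed.

Lemma conj_expE (p : R) : p^-1 + (conj_exp p)^-1 = 1.
Proof. by rewrite /conj_exp invrK addrC subrK. Qed.

End conjugate_exponent.

(** * Integration by parts and pairings with test functions *)

Section regular_distributions.
Context {R : realType} {n : nat}.
Local Notation mu := (lebesgue_rV R n).
Implicit Types (f g : 'rV[R]_n -> R) (O V : set 'rV[R]_n) (x y h : 'rV[R]_n) (p : R).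
Local Notation N p f := ('N[mu]_(p%:E)[EFin \o f%R])%E.
Local Notation basis i := (delta_mx ord0 i : 'rV[R]_n).

Lemma test_integrable O f : is_test O f -> mu.-integrable setT (EFin \o f).
Proof.
move=> tf; have [B B0 fB] := is_test_bounded tf; have [r r0 fr] := is_test_bounded_supp tf.
have mf := test_measurable tf.
apply/integrableP; split; first exact/measurable_EFinP.
apply: (@le_lt_trans _ _ (\int[mu]_x (B%:E * (\1_[set x : 'rV[R]_n | `|x| <= r] x)%:E))%E).
  apply: ge0_le_integral => //.
  - by apply: measurableT_comp => //; exact/measurable_EFinP.
  - apply: measurable_funeM; apply/measurable_EFinP; apply: measurable_indic.
    exact: measurable_norm_le.
  move=> x _; rewrite -EFinM lee_fin.
  have [->|fx0] := eqVneq (f x) 0; first by rewrite normr0 mulr_ge0.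
  by rewrite indicE mem_set ?mulr1//=; exact: fr.
rewrite ge0_integralZl//; last first.
  by apply/measurable_EFinP; apply: measurable_indic; exact: measurable_norm_le.
rewrite integral_indic//; last exact: measurable_norm_le.
rewrite [X in (_ * X)%E](_ : _ = ((r *+ 2) ^+ n)%:E); last by rewrite setIT; exact: lebesgue_norm_le.
by rewrite -EFinM ltry.
Qed.

Lemma Rintegral_shift f h : measurable_fun setT f ->
  \int[mu]_x f (x + h) = \int[mu]_x f x.
Proof.
move=> mf; rewrite /Rintegral integralE [in RHS]integralE; apply: (congr1 fine).
have mf' : measurable_fun setT (EFin \o f) by exact/measurable_EFinP.
have -> : (\int[mu]_x ((fun x => (f (x + h))%:E)^\+ x) = \int[mu]_x ((EFin \o f)^\+ x))%E.
  rewrite -[RHS](ge0_integral_rV_shift h (f := (EFin \o f)^\+%E))//.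
    by apply: eq_integral => x _; rewrite !funeposE.
  exact: measurable_funepos.
have -> // : (\int[mu]_x ((fun x => (f (x + h))%:E)^\- x) = \int[mu]_x ((EFin \o f)^\- x))%E.
rewrite -[RHS](ge0_integral_rV_shift h (f := (EFin \o f)^\-%E))//.
  by apply: eq_integral => x _; rewrite !funenegE.
exact: measurable_funeneg.
Qed.

(* By translation invariance the difference quotients of [f] have integral 0. *)
Lemma integral_partial_eq0 O f i : is_test O f -> \int[mu]_x partial i f x = 0.
Proof.
move=> tf; have tdf := is_test_partial i tf.
have mf := test_measurable tf; have mdf := test_measurable tdf.
have [B B0 hB] := test_taylor1 i tf.
have [r r0 fr] := is_test_bounded_supp tf.
have [r' r'0 dfr] := is_test_bounded_supp tdf.
pose rho := r + r' + 1.
have rho0 : 0 <= rho by rewrite !addr_ge0.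
pose M := (rho *+ 2) ^+ n.
have M0 : 0 <= M by rewrite exprn_ge0// mulrn_wge0.
pose I := \int[mu]_x partial i f x.
have sf : measurable_fun setT f by [].
(* Since f(x + t e_i) - f(x) has integral 0, t I is minus the integral of the Taylor remainder,
   which is at most B t^2 on a cube of measure M and vanishes outside. Dividing by t and letting t
   tend to 0 gives I = 0. *)
have key (t : R) : 0 < t <= 1 -> `|I| <= B * M * t.
  move=> /andP[t0 t1].
  have itd : mu.-integrable setT (EFin \o (fun x => t * partial i f x)).
    rewrite (_ : _ \o _ = (fun x => t%:E * (EFin \o partial i f) x)%E); last first.
      by apply/funext => x /=; rewrite EFinM.
    by apply: integrableZl => //; exact: test_integrable tdf.
  have tsf : is_test setT (fun x => f (x + t *: basis i)).
    split=> //; first by apply: smooth_shift; case: tf.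
    apply: bounded_closed_compact; last exact: closed_closure.
    exists (r + `|t *: basis i|); split; first exact: num_real.
    move=> C rC y ys; apply: le_trans (ltW rC).
    suff : closed [set y : 'rV[R]_n | `|y| <= r + `|t *: basis i| ].
      move=> cl; have : fsupp (fun x => f (x + t *: basis i)) `<=` [set y | `|y| <= r + `|t *: basis i| ].
        apply: fsupp_subset => // x /fr xr /=.
        rewrite -[x](addrK (t *: basis i)) (le_trans (ler_normB _ _))//.
        by rewrite lerD2r.
      exact.
    rewrite (_ : [set _ | _] = Num.Def.normr @^-1` [set z : R | z <= r + `|t *: basis i|])//.
    by apply: closed_comp; [move=> x _; exact: norm_continuous|exact: closed_le].
  have isf := test_integrable tsf.
  have i_f := test_integrable tf.
  have idf : mu.-integrable setT (EFin \o (fun x => f (x + t *: basis i) - f x)).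
    rewrite (_ : _ \o _ = ((EFin \o (fun x => f (x + t *: basis i))%R) \- (EFin \o f))%E); last first.
      by apply/funext => x /=; rewrite EFinB.
    exact: integrableB.
  have E : \int[mu]_x (f (x + t *: basis i) - f x - t * partial i f x) = - (t * I).
    rewrite RintegralB// RintegralB// Rintegral_shift// subrr sub0r RintegralZl//.
    exact: test_integrable tdf.
  have idd : mu.-integrable setT (EFin \o (fun x => f (x + t *: basis i) - f x - t * partial i f x)).
    rewrite (_ : _ \o _ = ((EFin \o (fun x => f (x + t *: basis i) - f x)%R) \- (EFin \o (fun x => t * partial i f x)%R))%E); last first.
      by apply/funext => x /=; rewrite EFinB.
    exact: integrableB.
  have : `|t * I| <= B * t ^+ 2 * M.
    rewrite -normrN -E -lee_fin.
    have -> : (`|\int[mu]_x (f (x + t *: basis i) - f x - t * partial i f x)|%:E =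
       `|\int[mu]_x (f (x + t *: basis i) - f x - t * partial i f x)%:E|)%E.
      rewrite -[in RHS](@fineK _ (\int[mu]_x _)%E)//.
      exact: integrable_fin_num idd.
    apply: le_trans (le_abse_integral _ _ _) _ => //.
      exact: measurable_int idd.
    apply: (@le_trans _ _ (\int[mu]_x ((B * t ^+ 2)%:E * (\1_[set x : 'rV[R]_n | `|x| <= rho] x)%:E))%E).
      apply: ge0_le_integral => //.
      - by apply: measurableT_comp => //; exact: measurable_int idd.
      - apply: measurable_funeM; apply/measurable_EFinP; apply: measurable_indic.
        exact: measurable_norm_le.
      move=> x _; rewrite -EFinM lee_fin indicE.
      have [xr|xr] := boolP (x \in [set x | `|x| <= rho]).
        by rewrite mulr1 (addrC x); exact: hB.
      have {}xr : rho < `|x| by rewrite ltNge; apply: contra xr => xr; rewrite inE.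
      rewrite mulr0.
      have fx0 : f x = 0.
        apply/eqP; apply: contraTT xr => /fr xr; rewrite -leNgt (le_trans xr)//.
        by rewrite /rho -addrA lerDl addr_ge0.
      have dfx0 : partial i f x = 0.
        apply/eqP; apply: contraTT xr => /dfr xr; rewrite -leNgt (le_trans xr)//.
        by rewrite /rho addrAC lerDr addr_ge0.
      have fxs0 : f (x + t *: basis i) = 0.
        apply/eqP; apply: contraTT xr => /fr xr; rewrite -leNgt.
        rewrite -[x](addrK (t *: basis i)) (le_trans (ler_normB _ _))//.
        apply: lerD; first by rewrite (le_trans xr)// lerDl.
        by apply: le_trans (norm_basis_scale _ _) _; rewrite gtr0_norm.
      by rewrite fx0 fxs0 dfx0 mulr0 !subr0 normr0.
    rewrite ge0_integralZl//; last 2 first.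
      by apply/measurable_EFinP; apply: measurable_indic; exact: measurable_norm_le.
      by rewrite lee_fin mulr_ge0// sqr_ge0.
    rewrite integral_indic//; last exact: measurable_norm_le.
    rewrite [X in (_ * X)%E](_ : _ = M%:E); last by rewrite setIT; exact: lebesgue_norm_le.
    by rewrite -EFinM lee_fin.
  rewrite normrM (gtr0_norm t0) => H; rewrite -(ler_pM2l t0).
  by apply: le_trans H _; rewrite le_eqVlt; apply/orP; left; apply/eqP; ring.
apply/eqP; rewrite -normr_le0 -/I; apply/ler_addgt0Pr => e e0; rewrite add0r.
have BM1 : 0 < B * M + 1 by rewrite ltr_wpDl// mulr_ge0.
pose t := Num.min 1 (e / (B * M + 1)).
have t0 : 0 < t by rewrite lt_min ltr01 divr_gt0.
have t1 : t <= 1 by rewrite ge_min lexx.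
apply: le_trans (key t _) _; first by rewrite t0.
apply: (@le_trans _ _ ((B * M + 1) * t)); first by rewrite ler_wpM2r ?(ltW t0)// lerDl.
by rewrite mulrC -ler_pdivlMr// ge_min lexx orbT.
Qed.

Lemma integration_by_parts_partial O f g i : is_test O f -> smooth g ->
  \int[mu]_x (partial i f x * g x) = - \int[mu]_x (f x * partial i g x).
Proof.
move=> tf sg; have sf : smooth f by case: tf.
have tfg := is_testM tf sg.
have t1 : is_test O (partial i f * g) by apply: is_testM => //; exact: is_test_partial.
have t2 : is_test O (f * partial i g) by apply: is_testM => //; exact: partial_smooth.
have := integral_partial_eq0 i tfg.
rewrite partialM// => /eqP.
rewrite [X in X == 0](_ : _ = \int[mu]_x (partial i f x * g x) + \int[mu]_x (f x * partial i g x)).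
  by rewrite addr_eq0 => /eqP.
rewrite -RintegralD//; first exact: test_integrable t1.
exact: test_integrable t2.
Qed.

Lemma integration_by_parts_pder O f g s : is_test O f -> smooth g ->
  \int[mu]_x (pder s f x * g x) = (-1) ^+ size s * \int[mu]_x (f x * pder s g x).
Proof.
move=> tf sg; elim: s g sg => [|i s ih] g sg /=; first by rewrite expr0 mul1r.
rewrite (integration_by_parts_partial i (pder_is_test s tf) sg).
rewrite ih; last exact: partial_smooth.
by rewrite pder_partial// exprS mulN1r mulNr.
Qed.

Lemma hoelder_integral p O f (psi : 'rV[R]_n -> R) : 1 < p -> measurable O ->
  measurable_fun O f -> measurable_fun setT psi ->
  (\int[mu]_x `|((f \_ O) x * psi x)%:E| <= Lp_norm O p f * N (conj_exp p) psi)%E.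
Proof.
move=> p1 mO /(measurable_restrictT _ mO) mf mpsi.
have p0 : 0 < p by exact: lt_trans p1.
have p'0 : 0 < conj_exp p by apply: lt_trans (conj_exp_gt1 p1).
have := hoelder mu mf mpsi p0 p'0 (conj_expE p).
by rewrite Lnorm1.
Qed.

Lemma regular_integrable p O f (psi : testfun O) : 1 < p -> measurable O ->
  measurable_fun O f -> (Lp_norm O p f < +oo)%E ->
  mu.-integrable setT (EFin \o (fun x => (f \_ O) x * psi x)).
Proof.
move=> p1 mO mf fp; have tpsi := testfun_is_test psi; have mpsi := test_measurable tpsi.
apply/integrableP; split.
  by apply/measurable_EFinP; apply: measurable_funM => //; exact/(measurable_restrictT _ mO).
apply: le_lt_trans (hoelder_integral p1 mO mf mpsi) _.
rewrite lte_mul_pinfty ?Lp_norm_ge0// ?ge0_fin_numE ?Lp_norm_ge0//.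
exact: (test_Lnorm_lty (conj_exp_gt1 p1) tpsi).
Qed.

Lemma regularE O f (psi : testfun O) : regular f psi = \int[mu]_x ((f \_ O) x * psi x).
Proof.
rewrite /regular Rintegral_mkcond; apply: eq_Rintegral => x _.
by rewrite !restrict0E; case: ifP => // _; rewrite mul0r.
Qed.

Lemma testfun_out O (psi : testfun O) x : ~ O x -> psi x = 0.
Proof.
move=> nOx; have [_ _ sO] := testfun_is_test psi.
by apply: fsupp_eq0 => /sO.
Qed.

Lemma regular_test O (phi psi : testfun O) : regular phi psi = \int[mu]_x (phi x * psi x).
Proof.
rewrite regularE; apply: eq_Rintegral => x _; rewrite restrict0E.
case: (boolP (x \in O)) => // nOx; rewrite mul0r testfun_out ?mul0r//.
by move=> Ox; rewrite mem_set in nOx.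
Qed.

Lemma regularD p O f g : 1 < p -> measurable O ->
  measurable_fun O f -> (Lp_norm O p f < +oo)%E ->
  measurable_fun O g -> (Lp_norm O p g < +oo)%E ->
  regular (fun x => f x + g x) = regular f + regular g :> (testfun O -> R^o).
Proof.
move=> p1 mO mf fp mg gp; apply/funext => psi.
rewrite -[RHS]/(regular f psi + regular g psi) !regularE -RintegralD//.
- apply: eq_Rintegral => x _; rewrite !restrict0E; case: ifP => _; ring.
- exact: regular_integrable fp.
- exact: regular_integrable gp.
Qed.

Lemma regularZ p O (a : R) f : 1 < p -> measurable O ->
  measurable_fun O f -> (Lp_norm O p f < +oo)%E ->
  regular (fun x => a * f x) = a *: regular f :> (testfun O -> R^o).
Proof.
move=> p1 mO mf fp; apply/funext => psi.
rewrite -[RHS]/(a * regular f psi) !regularE -RintegralZl//.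
- apply: eq_Rintegral => x _; rewrite !restrict0E; case: ifP => _; ring.
- exact: regular_integrable fp.
Qed.

Lemma regular_bound p O f (psi : testfun O) : 1 < p -> measurable O ->
  measurable_fun O f -> (Lp_norm O p f < +oo)%E ->
  (`|regular f psi|%:E <= Lp_norm O p f * N (conj_exp p) psi)%E.
Proof.
move=> p1 mO mf fp.
have ifpsi := regular_integrable psi p1 mO mf fp.
apply: le_trans (hoelder_integral p1 mO mf (test_measurable (testfun_is_test psi))).
have -> : (`|regular f psi|%:E = `|\int[mu]_x ((f \_ O) x * psi x)%:E|)%E.
  rewrite regularE -[in RHS](@fineK _ (\int[mu]_x _)%E)//.
  exact: integrable_fin_num ifpsi.
by apply: le_abse_integral => //; exact: measurable_int ifpsi.
Qed.

(** The sign in [dderive] cancels the one produced by integrating by parts. *)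
Lemma dderive_regular_test O (nu : 'I_n -> nat) (phi : testfun O) :
  dderive nu (regular phi : testfun O -> R^o) = regular (tderive nu phi).
Proof.
apply/funext => psi; rewrite /dderive !regular_test !tderiveE.
rewrite (integration_by_parts_pder _ (testfun_is_test phi)).
  by rewrite size_canonical_seq.
by case: (testfun_is_test psi).
Qed.

End regular_distributions.

(** * Exhaustion by compact sets *)

Section exhaustion.
Context {R : realType} {n : nat}.
Implicit Types (O : set 'rV[R]_n).

(** [K j] consists of the points of norm at most j at distance at least 1/(j+1) from the complement
    of O. A compact L lies in some [K j] because a cutoff f equal to 1 on L and 0 off O is
    Lipschitz: 1 = f(x) - f(y) <= C |x - y| keeps L at distance 1/C from the complement. *)
Lemma exists_exhaustion O : open O ->
  exists phi : nat -> testfun O, (forall j x, 0 <= phi j x <= 1) /\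
    forall K, compact K -> K `<=` O -> exists j, forall x, K x -> phi j x = 1.
Proof.
move=> oO.
pose K (j : nat) : set 'rV[R]_n :=
  [set x | `|x| <= j%:R] `&` \bigcap_(y in ~` O) [set x | j.+1%:R^-1 <= `|x - y|].
have cK j : compact (K j).
  apply: bounded_closed_compact.
    exists j%:R; split; first exact: num_real.
    by move=> M jM x [xj _]; apply: le_trans (ltW jM).
  apply: closedI.
    rewrite (_ : [set _ | _] = Num.Def.normr @^-1` [set z : R | z <= j%:R])//.
    by apply: closed_comp; [move=> x _; exact: norm_continuous|exact: closed_le].
  apply: closed_bigI => y _.
  rewrite (_ : [set _ | _] = (fun x => `|x - y|) @^-1` [set z : R | j.+1%:R^-1 <= z])//.
  apply: closed_comp; last exact: closed_ge.
  move=> x _; apply: (@continuous_comp _ _ _ (fun x : 'rV[R]_n => x - y)).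
    by apply: continuousB => //; exact: cst_continuous.
  exact: norm_continuous.
have KO j : K j `<=` O.
  move=> x [_ h]; apply: contrapT => nOx; have /= := h x nOx.
  by rewrite subrr normr0 leNgt invr_gt0 ltr0n.
have /choice[phi hphi] : forall j, exists f : testfun O, (forall x, 0 <= f x <= 1) /\ forall x, K j x -> f x = 1.
  move=> j; have [f [tf f01 [V [_ KV f1]]]] := exists_cutoff (cK j) oO (KO j).
  have pf : f \in test_pred O by rewrite inE.
  by exists (TestFun pf); split=> // x /KV; exact: f1.
exists phi; split; first by move=> j; case: (hphi j).
move=> L cL LO.
have [M [_ hM]] := compact_bounded cL.
have [f [tf f01 [V [_ LV f1]]]] := exists_cutoff cL oO LO.
have [C C0 fC] := test_lipschitz tf.
pose j := Num.bound (`|M| + 1 + C).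
have jM : `|M| + 1 + C < j%:R by apply: archi_boundP; rewrite !addr_ge0.
exists j => x Lx; have [_ ] := hphi j; apply; split.
  apply: (@le_trans _ _ (`|M| + 1)); last by rewrite ltW// (le_lt_trans _ jM)// lerDl.
  by apply: (hM (`|M| + 1)) => //; rewrite (le_lt_trans (ler_norm _))// ltrDl.
move=> y nOy /=.
have fy : f y = 0 by have [_ _ sO] := tf; apply: fsupp_eq0 => /sO.
have := fC x y; rewrite f1; last exact: LV.
rewrite fy subr0 normr1 => H.
have {}H : 1 <= C * `|x - y|.
  by apply: le_trans H _; rewrite ler_wpM2l// ge_min lexx orbT.
have Cj : C <= j.+1%:R.
  by rewrite ltW// (lt_trans (le_lt_trans _ jM))// ?ltr_nat// lerDr addr_ge0.
rewrite -[_^-1]mul1r ler_pdivrMr ?ltr0n// mulrC (le_trans H)//.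
by rewrite ler_wpM2r.
Qed.

End exhaustion.

(** * Functions are determined almost everywhere by their distributions *)

Section fundamental_lemma.
Context {R : realType} {n : nat}.
Local Notation mu := (lebesgue_rV R n).
Implicit Types (f g h : 'rV[R]_n -> R) (O V : set 'rV[R]_n).

(** These sets are stable under intersection, by multiplying the functions, and the indicator of
    each is a pointwise limit of smooth functions, namely of 1 - (1 - psi)^m. *)
Let pos_sets : set (set 'rV[R]_n) :=
  [set E | exists psi, [/\ smooth psi, (forall x, 0 <= psi x <= 1) & E = [set x | 0 < psi x]]].

Let pos_setsI : setI_closed pos_sets.
Proof.
move=> A B [f [sf f01 ->]] [g [sg g01 ->]]; exists (f * g); split.
- exact: smoothM.
- move=> x; rewrite mulrfctE; have /andP[? ?] := f01 x; have /andP[? ?] := g01 x.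
  by rewrite mulr_ge0//= mulr_ile1.
apply/seteqP; split=> x /=; rewrite mulrfctE; first by case=> *; rewrite mulr_gt0.
move=> fg; have /andP[f0 _] := f01 x; have /andP[g0 _] := g01 x.
have fn0 : f x != 0 by apply: contraTneq fg => ->; rewrite mul0r ltxx.
have gn0 : g x != 0 by apply: contraTneq fg => ->; rewrite mulr0 ltxx.
by rewrite !lt_neqAle !(eq_sym 0) fn0 gn0.
Qed.

(** The slab where x_i lies in ]a, b[ is the positivity set of a product of two smooth steps, and
    slabs generate the Borel sets. *)
Let measurable_pos_sets : @measurable _ 'rV[R]_n = <<s pos_sets >>.
Proof.
apply/seteqP; split=> A; last first.
  apply: smallest_sub; first exact: sigma_algebra_measurable.
  move=> _ [psi [spsi _ ->]].
  rewrite -[X in measurable X]setTI (_ : [set x | _] = psi @^-1` `]0, +oo[%classic).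
    by apply: continuous_measurable_rV => //; exact: smooth_continuous.
  by apply/seteqP; split=> x /=; rewrite in_itv/= andbT.
have mid : measurable_fun setT (fun x : g_sigma_algebraType pos_sets => x : 'rV[R]_n).
  apply: measurable_fun_coordP => i.
  apply: (measurability _ (measurable_realfun.RGenOpens.measurableE R)) => //.
  move=> _ [_ [a [b ->] <-]]; rewrite setTI; apply: sub_sigma_algebra.
  exists (fun x => smooth_step (1 * x ord0 i + (- a)) * smooth_step ((-1) * x ord0 i + b)); split.
  - move=> k; apply: (CkM (f := fun x => smooth_step _) (g := fun x => smooth_step _)); exact: Ck_smooth_step.
  - move=> x; rewrite mulr_ge0 ?smooth_step_ge0//=.
    by rewrite mulr_ile1 ?smooth_step_ge0 ?smooth_step_le1.
  apply/seteqP; split=> x /=; rewrite in_itv/=.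
    by move=> /andP[ax xb]; rewrite mulr_gt0// smooth_step_gt0; lra.
  move=> h; have [s0|] := ltP 0 (smooth_step (1 * x ord0 i - a)).
    move: h; rewrite (pmulr_rgt0 _ s0) smooth_step_gt0; move: s0; rewrite smooth_step_gt0 => *.
    by apply/andP; split; lra.
  move=> s0; have s00 : smooth_step (1 * x ord0 i - a) = 0.
    by apply/eqP; rewrite eq_le s0 smooth_step_ge0.
  by move: h; rewrite s00 mul0r ltxx.
by move=> mA; have := mid measurableT A mA; rewrite setTI.
Qed.

(** After multiplication by [phi j] the function is integrable, and the sets over which its integral
    vanishes form a Dynkin system containing [pos_sets], hence all Borel sets. So h [phi j] = 0
    almost everywhere for each j, and countably many null sets are discarded. *)
Lemma integral_test_eq0_ae O h : open O -> measurable_fun setT h ->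
  (forall x, ~ O x -> h x = 0) ->
  (forall psi : testfun O, mu.-integrable setT (EFin \o (fun x => h x * psi x))) ->
  (forall psi : testfun O, \int[mu]_x (h x * psi x) = 0) ->
  {ae mu, forall x, h x = 0}.
Proof.
move=> oO mh hO ih h0; have [phi [phi01 hphi]] := exists_exhaustion oO.
have local j : {ae mu, forall x, h x * phi j x = 0}.
  pose H x := (h x * phi j x)%:E.
  have iH : mu.-integrable setT H by exact: ih.
  have mH : measurable_fun setT H by exact: measurable_int iH.
  have HT : (\int[mu]_x H x = 0)%E.
    rewrite -[LHS](fineK (integrable_fin_num measurableT iH)).
    by have := h0 (phi j); rewrite /Rintegral => ->.
  have HE E : measurable E -> (\int[mu]_(x in E) H x = 0)%E.
    move=> mE; have sE : <<s pos_sets >> E by rewrite -measurable_pos_sets.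
    suff : forall S, <<s pos_sets >> S -> [set S | \int[mu]_(x in S) H x = 0]%E S by apply.
    apply: (dynkin_induction measurable_pos_sets pos_setsI) => {E mE sE}.
    - exact: HT.
    - move=> _ [psi [spsi psi01 ->]].
      set E := [set x | 0 < psi x]; rewrite /=.
      have mE : measurable E.
        rewrite -[X in measurable X]setTI (_ : E = psi @^-1` `]0, +oo[%classic).
          by apply: continuous_measurable_rV => //; exact: smooth_continuous.
        by apply/seteqP; split=> x /=; rewrite in_itv/= andbT.
      (* [gm m] stays in [0, 1] and tends to the indicator of psi > 0, while [phi j] times [gm m] is
         a test function; dominated convergence with majorant |H| carries the zero integrals to the
         limit. *)
      pose gm (m : nat) x := 1 - (1 - psi x) ^+ m.
      have sg m : smooth (gm m).
        apply: smoothB; first exact: smooth_cst.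
        elim: m => [|m ihm]; first by under eq_fun do rewrite expr0; exact: smooth_cst.
        under eq_fun do rewrite exprS.
        by apply: (smoothM (f := fun x => 1 - psi x)) => //; apply: smoothB => //; exact: smooth_cst.
      have gm01 m x : 0 <= gm m x <= 1.
        have /andP[p0 p1] := psi01 x; have q0 : 0 <= 1 - psi x by lra.
        rewrite /gm subr_ge0 gerBl exprn_ge0// andbT exprn_ile1//; lra.
      have pg m : (fun x => phi j x * gm m x) \in test_pred O.
        by rewrite inE; exact: is_testM (testfun_is_test _) (sg m).
      have ig m := ih (TestFun (pg m)).
      have [] := @dominated_convergence _ _ R mu setT measurableT
        (fun m x => (h x * (phi j x * gm m x))%:E) (H \_ E) (fun x => `|H x|)%E.
      + by move=> m; exact: measurable_int (ig m).
      + by apply/(measurable_restrictT _ mE); exact: measurable_funS mH.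
      + apply: aeW => x _; rewrite patchE.
        have [/set_mem /= px|px] := boolP (x \in E).
          rewrite /H -[X in _ --> X](_ : (h x * (phi j x * (1 - 0)))%:E = _); last by rewrite subr0 mulr1.
          apply: cvg_EFin; first exact: nearW.
          apply: cvgM; first exact: cvg_cst.
          apply: cvgM; first exact: cvg_cst.
          apply: cvgB; first exact: cvg_cst.
          have q1 : `|1 - psi x| < 1.
            by have px0 : 0 < psi x := px; have /andP[p0 p1] := psi01 x; rewrite ger0_norm; lra.
          have := cvg_geometric 1 q1.
          by rewrite (_ : geometric _ _ = fun m => (1 - psi x) ^+ m)//; apply/funext => m; rewrite /geometric/= mul1r.
        have px0 : psi x = 0.
          apply/eqP; rewrite eq_le; have /andP[-> _] := psi01 x; rewrite andbT leNgt.
          by apply: contra px => px; rewrite inE.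
        have -> : (fun m => (h x * (phi j x * gm m x))%:E) = cst (0%E : \bar R).
          by apply/funext => m; rewrite /gm px0 subr0 expr1n subrr !mulr0.
        exact: cvg_cst.
      + exact: integrable_abse.
      + apply: aeW => x m _; rewrite lee_fin !normrM mulrA ler_piMr//.
        by have /andP[g0 g1] := gm01 m x; rewrite ger0_norm.
      move=> _ _; rewrite [X in X @ _ --> _](_ : _ = cst 0%E); last first.
        apply/funext => m /=; rewrite -[LHS](fineK (integrable_fin_num measurableT (ig m))).
        by have := h0 (TestFun (pg m)); rewrite /Rintegral => ->.
      move=> /cvg_lim -/(_ (@ereal_hausdorff R)) L.
      by rewrite integral_mkcond -L lim_cst.
    - move=> S mS /= HS; have := HT.
      rewrite -[X in (\int[mu]_(x in X) _)%E](setUv S) integral_setU//.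
      + by rewrite HS add0e.
      + exact: measurableC.
      + by rewrite setUv; exact: mH.
      + by apply/disj_setPS => x [].
    - move=> F mF tF /= HF; rewrite integral_bigcup//.
        by apply: eseries0 => i _ _; exact: HF.
      apply: integrableS iH => //; exact: bigcup_measurable.
  have : ae_eq mu setT H (cst 0%E).
    apply: integral_ae_eq => // E _ mE; rewrite HE// integral0//.
  by apply: filterS => x /(_ I) /= [].
have : {ae mu, forall x, forall j, h x * phi j x = 0} by apply: ae_foralln.
apply: filterS => x hx; have [Ox|nOx] := pselect (O x); last exact: hO.
have xO : [set x] `<=` O by move=> y ->.
have [j hj] := hphi [set x] (@compact_set1 _ x) xO.
by have := hx j; rewrite hj// mulr1.
Qed.

Lemma regular_inj_ae p O f g : 1 < p -> open O ->
  measurable_fun O f -> (Lp_norm O p f < +oo)%E ->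
  measurable_fun O g -> (Lp_norm O p g < +oo)%E ->
  regular f = regular g :> (testfun O -> R^o) ->
  {ae mu, forall x, (f \_ O) x = (g \_ O) x}.
Proof.
move=> p1 oO mf fp mg gp fg; have mO := open_measurable_rV oO.
have mf0 : measurable_fun setT (f \_ O) by exact/(measurable_restrictT _ mO).
have mg0 : measurable_fun setT (g \_ O) by exact/(measurable_restrictT _ mO).
have iB (psi : testfun O) : mu.-integrable setT (EFin \o (fun x => ((f \_ O) x - (g \_ O) x) * psi x)).
  rewrite (_ : _ \o _ = ((EFin \o (fun x => (f \_ O) x * psi x)%R) \- (EFin \o (fun x => (g \_ O) x * psi x)%R))%E); last first.
    by apply/funext => x /=; rewrite -EFinB mulrBl.
  by apply: integrableB => //; [exact: regular_integrable fp|exact: regular_integrable gp].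
have key : {ae mu, forall x, (f \_ O) x - (g \_ O) x = 0}.
  apply: (integral_test_eq0_ae oO) => //.
  - exact: measurable_funB.
  - by move=> x nOx; rewrite !restrict0E memNset// subrr.
  move=> psi; under eq_Rintegral do rewrite mulrBl.
  rewrite RintegralB//; [|exact: regular_integrable fp|exact: regular_integrable gp].
  by rewrite -!regularE fg subrr.
by apply: filterS key => x /eqP; rewrite subr_eq0 => /eqP.
Qed.

Lemma Lp_norm_regular p O f g : 1 < p -> open O ->
  measurable_fun O f -> (Lp_norm O p f < +oo)%E ->
  measurable_fun O g -> (Lp_norm O p g < +oo)%E ->
  regular f = regular g :> (testfun O -> R^o) -> Lp_norm O p f = Lp_norm O p g.
Proof.
move=> p1 oO mf fp mg gp fg; have mO := open_measurable_rV oO.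
rewrite /Lp_norm !LnormE; apply: (congr1 (fun z => z `^ p^-1)%E).
apply: ae_eq_integral => //.
- by apply: measurable_powR_norm; exact/(measurable_restrictT _ mO).
- by apply: measurable_powR_norm; exact/(measurable_restrictT _ mO).
by apply: filterS (regular_inj_ae p1 oO mf fp mg gp fg) => x -> _.
Qed.

End fundamental_lemma.

(** * Norms of distributions *)

Section ereal_infimum.
Context {R : realType}.
Local Open Scope ereal_scope.
Implicit Types A B C : set (\bar R).

(** Passes the triangle inequality from representatives to the infima that define the norms.
    Nonnegativity excludes sums of opposite infinities when one of the sets is empty. *)
Lemma ereal_inf_add A B C : (forall a, A a -> 0 <= a) -> (forall b, B b -> 0 <= b) ->
  (forall a b, A a -> B b -> exists2 c, C c & c <= a + b) ->
  ereal_inf C <= ereal_inf A + ereal_inf B.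
Proof.
move=> A0 B0 ABC.
have iA0 : 0 <= ereal_inf A by apply: le_ereal_inf_tmp => a /A0.
have iB0 : 0 <= ereal_inf B by apply: le_ereal_inf_tmp => b /B0.
have [fA|] := boolP (ereal_inf A \is a fin_num); last first.
  by rewrite ge0_fin_numE// -leNgt leye_eq => /eqP ->; rewrite addye ?leey// gt_eqF// (lt_le_trans _ iB0) ?ltNy0.
have [fB|] := boolP (ereal_inf B \is a fin_num); last first.
  by rewrite ge0_fin_numE// -leNgt leye_eq => /eqP ->; rewrite addey ?leey// gt_eqF// (lt_le_trans _ iA0) ?ltNy0.
apply/lee_addgt0Pr => e e0.
have e20 : (0 < e / 2)%R by rewrite divr_gt0.
have [a Aa ae] := lb_ereal_inf_adherent e20 fA.
have [b Bb be] := lb_ereal_inf_adherent e20 fB.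
have [c Cc cab] := ABC _ _ Aa Bb.
apply: le_trans (ereal_inf_lbound Cc) _; apply: le_trans cab _.
rewrite (splitr e) EFinD addeACA; apply: leeD; exact: ltW.
Qed.

Lemma ereal_inf_scale A C (k : R) : (0 < k)%R ->
  (forall a, A a -> exists2 c, C c & c <= k%:E * a) ->
  ereal_inf C <= k%:E * ereal_inf A.
Proof.
move=> k0 AC.
rewrite -lee_pdivrMl//; apply: le_ereal_inf_tmp => a Aa.
rewrite lee_pdivrMl//; have [c Cc ck] := AC _ Aa.
exact: le_trans (ereal_inf_lbound Cc) ck.
Qed.

Lemma ereal_inf_image_ge0 T (D : set T) (f : T -> \bar R) : (forall x, D x -> 0 <= f x) ->
  0 <= ereal_inf [set f x | x in D].
Proof. by move=> f0; apply: le_ereal_inf_tmp => _ [x Dx <-]; exact: f0. Qed.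

End ereal_infimum.

Section sobolev_norm_facts.
Context {R : realType} {n : nat} (O : set 'rV[R]_n).
Hypothesis oO : open O.
Local Notation mu := (lebesgue_rV R n).
Implicit Types (u v w : testfun O -> R^o) (f g : 'rV[R]_n -> R) (p s theta : R)
  (nu : 'I_n -> nat) (phi psi : testfun O).
Local Notation N p f := ('N[mu]_(p%:E)[EFin \o f%R])%E.

Let mO : measurable O. Proof. exact: open_measurable_rV. Qed.

Lemma representsD p f g u v : 1 < p -> represents p f u -> represents p g v ->
  represents p (fun x => f x + g x) (u + v).
Proof.
move=> p1 [mf fp ->] [mg gp ->]; split; first exact: measurable_funD.
  by apply: le_lt_trans (Lp_normD p1 mO mf mg) _; rewrite lte_add_pinfty.
by rewrite (regularD p1 mO mf fp mg gp).
Qed.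

Lemma representsZ p (a : R) f u : 1 < p -> represents p f u ->
  represents p (fun x => a * f x) (a *: u).
Proof.
move=> p1 [mf fp ->]; split; first exact: measurable_funM.
  by rewrite Lp_normZ// lte_mul_pinfty// lee_fin.
by rewrite (regularZ a p1 mO mf fp).
Qed.

Lemma dLp_norm_ge0 p u : (0 <= dLp_norm p u)%E.
Proof. by apply: ereal_inf_image_ge0 => f _; exact: Lp_norm_ge0. Qed.

Lemma slob_ge0 p theta f : (0 <= slobodeckij O p theta f)%E.
Proof. exact: poweR_ge0. Qed.

Lemma dslob_ge0 p theta u : (0 <= dslobodeckij p theta u)%E.
Proof. by apply: ereal_inf_image_ge0 => f _; exact: slob_ge0. Qed.

Lemma dLp_norm_represents p f u : 1 < p -> represents p f u -> dLp_norm p u = Lp_norm O p f.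
Proof.
move=> p1 rf; have [mf fp uf] := rf.
apply/eqP; rewrite eq_le; apply/andP; split; first by apply: ereal_inf_lbound; exists f.
apply: le_ereal_inf_tmp => _ [g [mg gp ug] <-].
by rewrite (Lp_norm_regular p1 oO mf fp mg gp)// -uf -ug.
Qed.

Lemma dLp_norm_lty p u : (dLp_norm p u < +oo)%E -> exists f, represents p f u.
Proof. by move=> /ereal_inf_lt[_ [f rf _] _]; exists f. Qed.

Lemma dslob_lty p theta u : (dslobodeckij p theta u < +oo)%E -> exists f, represents p f u.
Proof. by move=> /ereal_inf_lt[_ [f rf _] _]; exists f. Qed.

Lemma dLp_normD p u v : 1 < p -> (dLp_norm p (u + v)%R <= dLp_norm p u + dLp_norm p v)%E.
Proof.
move=> p1; apply: ereal_inf_add.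
- by move=> _ [f _ <-]; exact: Lp_norm_ge0.
- by move=> _ [f _ <-]; exact: Lp_norm_ge0.
move=> _ _ [f rf <-] [g rg <-]; have [mf _ _] := rf; have [mg _ _] := rg.
exists (Lp_norm O p (fun x => f x + g x)); last exact: Lp_normD.
by exists (fun x => f x + g x) => //; exact: representsD.
Qed.

Lemma dslobD p theta u v : 1 < p ->
  (dslobodeckij p theta (u + v)%R <= dslobodeckij p theta u + dslobodeckij p theta v)%E.
Proof.
move=> p1; apply: ereal_inf_add.
- by move=> _ [f _ <-]; exact: slob_ge0.
- by move=> _ [f _ <-]; exact: slob_ge0.
move=> _ _ [f rf <-] [g rg <-]; have [mf _ _] := rf; have [mg _ _] := rg.
exists (slobodeckij O p theta (fun x => f x + g x)); last exact: slobD.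
by exists (fun x => f x + g x) => //; exact: representsD.
Qed.

Lemma represents0 p : 1 < p -> represents p (fun=> 0) (0 : testfun O -> R^o).
Proof.
move=> p1; have p0 : p != 0 by rewrite gt_eqF// (lt_trans _ p1).
have L0 : Lp_norm O p (fun=> 0) = 0%E.
  rewrite /Lp_norm (_ : EFin \o _ = cst 0%E) ?Lnorm0 ?eqe//.
  by apply/funext => x /=; rewrite restrict0E; case: ifP.
split; [exact: measurable_cst|by rewrite L0|].
apply/funext => psi; rewrite regularE.
rewrite (_ : (fun x => _) = cst 0); first by rewrite Rintegral_cst// mul0r.
by apply/funext => x; rewrite restrict0E; case: ifP => _; rewrite mul0r.
Qed.

Lemma dLp_norm0 p : 1 < p -> dLp_norm p (0 : testfun O -> R^o) = 0%E.
Proof.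
move=> p1; rewrite (dLp_norm_represents p1 (represents0 p1)).
have mc : measurable_fun O (fun=> 0 : R) by exact: measurable_cst.
have := Lp_normZ p1 0 mO mc; rewrite normr0 mul0e; apply: etrans.
by congr (Lp_norm O p _); apply/funext => x; rewrite mul0r.
Qed.

Lemma dslob0 p theta : 1 < p -> dslobodeckij p theta (0 : testfun O -> R^o) = 0%E.
Proof.
move=> p1; apply/eqP; rewrite eq_le dslob_ge0 andbT.
have mc : measurable_fun O (fun=> 0 : R) by exact: measurable_cst.
have := slobZ theta p1 0 mO mc; rewrite normr0 mul0e => E; rewrite -[leRHS]E.
apply: ereal_inf_lbound; exists (fun=> 0); first exact: represents0.
by congr (slobodeckij O p theta _); apply/funext => x; rewrite mul0r.
Qed.

Lemma dLp_normZ p (a : R) u : 1 < p -> (dLp_norm p (a *: u)%R <= `|a|%:E * dLp_norm p u)%E.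
Proof.
(* For a = 0 the right side is 0 even if u has infinite norm, as 0 times infinity is 0; the zero
   distribution is treated by itself. *)
move=> p1; have [->|a0] := eqVneq a 0.
  by rewrite scale0r dLp_norm0// normr0 mul0e.
apply: ereal_inf_scale; first by rewrite normr_gt0.
move=> _ [f rf <-]; have [mf _ _] := rf.
exists (Lp_norm O p (fun x => a * f x)); last by rewrite Lp_normZ.
by exists (fun x => a * f x) => //; exact: representsZ.
Qed.

Lemma dslobZ p theta (a : R) u : 1 < p ->
  (dslobodeckij p theta (a *: u)%R <= `|a|%:E * dslobodeckij p theta u)%E.
Proof.
move=> p1; have [->|a0] := eqVneq a 0.
  by rewrite scale0r dslob0// normr0 mul0e.
apply: ereal_inf_scale; first by rewrite normr_gt0.
move=> _ [f rf <-]; have [mf _ _] := rf.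
exists (slobodeckij O p theta (fun x => a * f x)); last by rewrite slobZ.
by exists (fun x => a * f x) => //; exact: representsZ.
Qed.

Lemma dderiveD nu u v : dderive nu (u + v) = dderive nu u + dderive nu v.
Proof. by apply/funext => psi; rewrite /dderive -mulrDr. Qed.

Lemma dderiveZ nu (a : R) u : dderive nu (a *: u) = a *: dderive nu u.
Proof.
apply/funext => psi; rewrite /dderive -[RHS]/(a * _) -[(a *: u) _]/(a * u _).
by rewrite mulrCA.
Qed.

Lemma Wnorm_ge0_ge0 s p u : (0 <= Wnorm_ge0 s p u)%E.
Proof.
apply: adde_ge0; first by apply: sume_ge0 => nu _; exact: dLp_norm_ge0.
by case: ifP => // _; apply: sume_ge0 => nu _; exact: dslob_ge0.
Qed.

Lemma Wnorm_ge0D s p u v : 1 < p ->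
  (Wnorm_ge0 s p (u + v)%R <= Wnorm_ge0 s p u + Wnorm_ge0 s p v)%E.
Proof.
move=> p1; rewrite /Wnorm_ge0 /=.
set k := Num.truncn s; set th := s - k%:R.
rewrite addeACA; apply: leeD.
  rewrite -big_split; apply: lee_sum => nu _.
  by rewrite dderiveD; exact: dLp_normD.
case: ifP => _; first by rewrite adde0.
by rewrite -big_split; apply: lee_sum => nu _; rewrite dderiveD; exact: dslobD.
Qed.

Lemma Wnorm_ge0Z s p (a : R) u : 1 < p ->
  (Wnorm_ge0 s p (a *: u)%R <= `|a|%:E * Wnorm_ge0 s p u)%E.
Proof.
move=> p1; rewrite /Wnorm_ge0 /=.
set k := Num.truncn s; set th := s - k%:R.
rewrite ge0_muleDr; last 2 first.
  by apply: sume_ge0 => nu _; exact: dLp_norm_ge0.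
  by case: ifP => // _; apply: sume_ge0 => nu _; exact: dslob_ge0.
apply: leeD.
  rewrite ge0_sume_distrr; last by move=> nu _; exact: dLp_norm_ge0.
  by apply: lee_sum => nu _; rewrite dderiveZ; exact: dLp_normZ.
case: ifP => _; first by rewrite mule0.
rewrite ge0_sume_distrr; last by move=> nu _; exact: dslob_ge0.
by apply: lee_sum => nu _; rewrite dderiveZ; exact: dslobZ.
Qed.

Lemma dLp_norm_le_Wnorm s p (nu : {ffun 'I_n -> 'I_(Num.truncn s).+1}) u :
  (mindex_order (val \o nu) <= Num.truncn s)%N ->
  (dLp_norm p (dderive (val \o nu) u) <= Wnorm_ge0 s p u)%E.
Proof.
move=> nuk; rewrite /Wnorm_ge0 /= (bigD1 nu)//= -addeA leeDl//.
apply: adde_ge0; first by apply: sume_ge0 => ? _; exact: dLp_norm_ge0.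
by case: ifP => // _; apply: sume_ge0 => ? _; exact: dslob_ge0.
Qed.

Lemma dslob_le_Wnorm s p (nu : {ffun 'I_n -> 'I_(Num.truncn s).+1}) u :
  mindex_order (val \o nu) = Num.truncn s -> s - (Num.truncn s)%:R != 0 ->
  (dslobodeckij p (s - (Num.truncn s)%:R) (dderive (val \o nu) u) <= Wnorm_ge0 s p u)%E.
Proof.
move=> nuk th0; rewrite /Wnorm_ge0 /= (negbTE th0) [X in (_ + X)%E](bigD1 nu) ?nuk//=.
rewrite addeCA leeDl//; apply: adde_ge0; first by apply: sume_ge0 => ? _; exact: dLp_norm_ge0.
by apply: sume_ge0 => ? _; exact: dslob_ge0.
Qed.

(** Crude count: each of the two sums in the norm has at most as many terms as there are functions
    [nu], whence the factor 2. *)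
Lemma Wnorm_ge0_le s p u (K : \bar R) : (0 <= K)%E ->
  (forall nu : {ffun 'I_n -> 'I_(Num.truncn s).+1},
    (mindex_order (val \o nu) <= Num.truncn s)%N ->
    (dLp_norm p (dderive (val \o nu) u) <= K)%E) ->
  (forall nu : {ffun 'I_n -> 'I_(Num.truncn s).+1}, s - (Num.truncn s)%:R != 0 ->
    mindex_order (val \o nu) = Num.truncn s ->
    (dslobodeckij p (s - (Num.truncn s)%:R) (dderive (val \o nu) u) <= K)%E) ->
  (Wnorm_ge0 s p u <= (2 * #|{: {ffun 'I_n -> 'I_(Num.truncn s).+1}}|%:R)%:E * K)%E.
Proof.
move=> K0 h1 h2; rewrite mulr_natl mulr2n EFinD ge0_muleDl ?lee_fin//.
have S (P : pred {ffun 'I_n -> 'I_(Num.truncn s).+1}) F :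
    (forall nu : {ffun 'I_n -> 'I_(Num.truncn s).+1}, P nu -> (F nu <= K)%E) ->
    (\sum_(nu | P nu) F nu <= #|{: {ffun 'I_n -> 'I_(Num.truncn s).+1}}|%:R%:E * K)%E.
  move=> FK; apply: (@le_trans _ _ (\sum_(nu : {ffun 'I_n -> 'I_(Num.truncn s).+1}) K)%E).
    rewrite big_mkcond; apply: lee_sum => nu _.
    by case: ifP => // /FK.
  by rewrite sumr_const mule_natl.
apply: leeD; first exact: S.
case: ifPn => th0; first by rewrite mule_ge0// lee_fin.
by apply: S => nu /eqP; exact: h2.
Qed.

End sobolev_norm_facts.

(** * Restriction and extension of distributions *)

Section transport.
Context {R : realType} {n : nat} (V O : set 'rV[R]_n).
Hypothesis VO : V `<=` O.
Implicit Types (phi : testfun V) (psi : testfun O).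

Lemma tincl_subproof phi : (phi : 'rV[R]_n -> R^o) \in test_pred O.
Proof. by rewrite inE; exact: is_test_subset VO (testfun_is_test phi). Qed.

Definition tincl phi : testfun O := TestFun (tincl_subproof phi).

Lemma tcut_subproof phi psi : (fun x => phi x * psi x) \in test_pred V.
Proof.
rewrite inE; apply: is_testM (testfun_is_test phi) _.
by case: (testfun_is_test psi).
Qed.

Definition tcut phi psi : testfun V := TestFun (tcut_subproof phi psi).

Definition drestrict (u : testfun O -> R^o) : testfun V -> R^o := fun phi => u (tincl phi).

(** The extension by zero of the product chi w: since chi psi has its support in V, w can be
    evaluated on it. *)
Definition dextend (chi : testfun V) (w : testfun V -> R^o) : testfun O -> R^o :=
  fun psi => w (tcut chi psi).

End transport.

Section distribution_facts.
Context {R : realType} {n : nat}.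
Local Notation mu := (lebesgue_rV R n).
Implicit Types (f g : 'rV[R]_n -> R) (O V : set 'rV[R]_n) (p : R).
Local Notation N p f := ('N[mu]_(p%:E)[EFin \o f%R])%E.

Lemma testfun_eq O (phi psi : testfun O) : (forall x, phi x = psi x) -> phi = psi.
Proof. by move=> h; apply: val_inj; apply/funext => x; exact: h. Qed.

Lemma testfun_smooth O (phi : testfun O) : smooth phi.
Proof. by case: (testfun_is_test phi). Qed.

Lemma testfunDE O (a : R) (phi psi : testfun O) x : (a *: phi + psi) x = a * phi x + psi x.
Proof. by []. Qed.

(** Only finitely many lists have length at most k, so the sum of B over all of them is a bound. *)
Lemma exists_uniform_seq_bound (B : seq 'I_n -> R) k : (forall s, 0 <= B s) ->
  exists2 L : R, 0 <= L & forall s, (size s <= k)%N -> B s <= L.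
Proof.
move=> B0; exists (\sum_(j < k.+1) \sum_(t : j.-tuple 'I_n) B t).
  by apply: sumr_ge0 => j _; apply: sumr_ge0.
move=> s sk; have sk' : (size s < k.+1)%N by [].
rewrite (bigD1 (Ordinal sk'))//= (bigD1 (in_tuple s))//= -addrA lerDl.
by rewrite addr_ge0// sumr_ge0// => j _; rewrite sumr_ge0.
Qed.

(** L depends on chi and k alone; this gives the continuity that makes [dextend] a distribution. *)
Lemma pder_mul_bound O (chi : 'rV[R]_n -> R) k : is_test O chi ->
  exists2 L : R, 0 <= L & forall f (s : seq 'I_n) (M : R), smooth f -> (size s <= k)%N ->
    (forall t x, (size t <= k)%N -> `|pder t f x| <= M) ->
    forall x, `|pder s (fun x => chi x * f x) x| <= L * M.
Proof.
move=> tchi.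
have /choice[B hB] : forall a : seq 'I_n, exists B : R, 0 <= B /\ forall x, `|pder a chi x| <= B.
  by move=> a; have [B B0 hB] := is_test_bounded (pder_is_test a tchi); exists B.
have [|L L0 hL] := @exists_uniform_seq_bound (fun s => \sum_(ab <- leibniz s) B ab.1) k.
  by move=> s; apply: sumr_ge0 => ab _; case: (hB ab.1).
exists L => // f s M sf sk fM x.
have schi : smooth chi by case: tchi.
have M0 : 0 <= M by apply: le_trans (fM [::] x (leq0n _)); exact: normr_ge0.
have -> : pder s (fun x => chi x * f x) x = \sum_(ab <- leibniz s) pder ab.1 chi x * pder ab.2 f x.
  by rewrite [LHS](congr1 (fun h => h x) (pderM s schi sf)) fct_sumE.
apply: le_trans (ler_norm_sum _ _ _) _.
apply: le_trans (_ : \sum_(ab <- leibniz s) B ab.1 * M <= _); last first.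
  by rewrite -mulr_suml ler_wpM2r// hL.
rewrite big_seq [leRHS]big_seq; apply: ler_sum => ab ab_s; rewrite normrM; apply: ler_pM => //.
  by case: (hB ab.1).
by apply: fM; apply: leq_trans sk; rewrite -(leibniz_size ab_s) leq_addl.
Qed.

Lemma distribution_lin O (a : R) (u v : testfun O -> R^o) :
  distribution u -> distribution v -> distribution (a *: u + v).
Proof.
move=> [lu bu] [lv bv]; split.
  move=> b phi psi; rewrite -[LHS]/(a * u (b *: phi + psi) + v (b *: phi + psi)) lu lv.
  rewrite -[RHS]/(b * (a * u phi + v phi) + (a * u psi + v psi)) -![_ *: _]/(b * _).
  by ring.
move=> K cK KO; have [C [k hu]] := bu K cK KO; have [D [l hv]] := bv K cK KO.
exists (`|a| * C + D), (maxn k l) => phi M phiK phiM.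
rewrite -[(a *: u + v) phi]/(a * u phi + v phi) (le_trans (ler_normD _ _))//.
rewrite mulrDl lerD//.
  rewrite normrM -mulrA ler_wpM2l//; apply: hu => // nu x nuk.
  by apply: phiM; rewrite (leq_trans nuk)// leq_maxl.
by apply: hv => // nu x nuk; apply: phiM; rewrite (leq_trans nuk)// leq_maxr.
Qed.

Lemma distribution_regular O f p : open O -> 1 < p ->
  measurable_fun O f -> (Lp_norm O p f < +oo)%E ->
  distribution (regular f : testfun O -> R^o).
Proof.
move=> oO p1 mf fp; have mO := open_measurable_rV oO; split.
  move=> a phi psi; rewrite !regularE -[_ *: _ in RHS]/(a * _) -RintegralZl//; last first.
    exact: regular_integrable fp.
  rewrite -RintegralD//; last 2 first.
  - have := integrableZl measurableT a (regular_integrable phi p1 mO mf fp).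
    by congr (_.-integrable _ _); apply/funext => x /=; rewrite EFinM.
  - exact: regular_integrable fp.
  by apply: eq_Rintegral => x _; rewrite testfunDE; ring.
move=> K cK KO.
have p'1 := conj_exp_gt1 p1.
have [r r0 Kr] : exists2 r : R, 0 <= r & forall x, K x -> `|x| <= r.
  have [M [_ hM]] := compact_bounded cK; exists (`|M| + 1); first by rewrite addr_ge0.
  by move=> x Kx; apply: (hM (`|M| + 1)) => //; rewrite (le_lt_trans (ler_norm _))// ltrDl.
pose W : 'rV[R]_n -> R := fun x => 1 * \1_[set x : 'rV[R]_n | `|x| <= r] x.
have NW := Lp_norm_cube_lty (n := n) p'1 ler01 r0.
have mW : measurable_fun setT W.
  by apply: measurable_funM => //; apply: measurable_indic; exact: measurable_norm_le.
(* Order 0 suffices: |phi| <= M [W], the indicator of a cube containing K, and Hoelder's inequality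
   applies. *)
exists (fine (Lp_norm O p f) * fine (N (conj_exp p) W)), 0%N => phi M phiK phiM.
have phiM0 x : `|phi x| <= M.
  have := phiM (fun=> 0%N) x; rewrite tderiveE (_ : canonical_seq _ = [::])//.
    by apply; rewrite /mindex_order big1.
  by apply: size0nil; rewrite size_canonical_seq /mindex_order big1.
have M0 : 0 <= M := le_trans (normr_ge0 _) (phiM0 0).
rewrite -lee_fin; apply: le_trans (regular_bound phi p1 mO mf fp) _.
rewrite -mulrA EFinM fineK; last by rewrite ge0_fin_numE// Lp_norm_ge0.
apply: lee_wpmul2l; first exact: Lp_norm_ge0.
rewrite mulrC EFinM fineK; last by rewrite ge0_fin_numE// Lnorm_ge0.
rewrite -[M in leRHS]ger0_norm// -Lnorm_scale//; apply: le_Lnorm => //.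
- exact: test_measurable (testfun_is_test phi).
- exact: measurable_funM.
move=> x; have [->|px] := eqVneq (phi x) 0; first by rewrite normr0.
rewrite /W indicE mem_set ?mulr1; last by apply: Kr; apply: phiK; exact: subset_closure.
by rewrite (ger0_norm M0).
Qed.

Lemma distribution_restrict V O (VO : V `<=` O) (u : testfun O -> R^o) :
  distribution u -> distribution (drestrict VO u).
Proof.
move=> [lu bu]; split.
  by move=> a phi psi; rewrite /drestrict -lu; congr u; exact: testfun_eq.
move=> K cK KV; have [C [k h]] := bu K cK (subset_trans KV VO).
exists C, k => phi M phiK phiM; apply: h => // nu x nuk.
by have := phiM nu x nuk; rewrite !tderiveE.
Qed.

Lemma distribution_extend V O (chi : testfun V) (w : testfun V -> R^o) :
  distribution w -> distribution (dextend (O := O) chi w).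
Proof.
move=> [lw bw]; split.
  move=> a phi psi; rewrite /dextend -lw; congr w; apply: testfun_eq => x /=.
  by rewrite -[LHS]/(chi x * (a * phi x + psi x)) -[RHS]/(a * (chi x * phi x) + chi x * psi x); ring.
move=> K cK KO.
have [_ cchi chiV] := testfun_is_test chi.
have [C [k h]] := bw _ cchi chiV.
have [L L0 hL] := pder_mul_bound k (testfun_is_test chi).
exists (C * L), k => phi M phiK phiM; rewrite -mulrA; apply: h.
  apply: closure_subset => x /=; apply: contra_neq => cx0.
  by rewrite cx0 mul0r.
move=> nu x nuk; rewrite tderiveE; apply: hL.
- exact: testfun_smooth.
- by rewrite size_canonical_seq.
by move=> t y tk; rewrite pder_tderive; apply: phiM; rewrite mindex_order_count.
Qed.

Lemma test_represents O (phi : testfun O) p : 1 < p -> open O ->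
  represents p phi (regular phi : testfun O -> R^o).
Proof.
move=> p1 oO; have mO := open_measurable_rV oO; have tphi := testfun_is_test phi.
have mphi := test_measurable tphi.
split=> //; first exact: measurable_funS mphi.
apply: le_lt_trans (test_Lnorm_lty p1 tphi); rewrite -Lp_norm_setT.
by apply: le_Lp_norm => //; exact: measurable_funS mphi.
Qed.

Lemma truncn_frac (s : R) : 0 <= s -> s - (Num.truncn s)%:R != 0 -> 0 < s - (Num.truncn s)%:R < 1.
Proof.
move=> s0; have /andP[t1 t2] := truncn_itv s0.
by rewrite lt_neqAle eq_sym => ->; rewrite subr_ge0 t1/= ltrBlDl -natr1 in t2 *.
Qed.

Lemma Wnorm_ge0_test_lty O (s : R) p (phi : testfun O) : open O -> 0 <= s -> 1 < p ->
  (Wnorm_ge0 s p (regular phi : testfun O -> R^o) < +oo)%E.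
Proof.
move=> oO s0 p1; have mO := open_measurable_rV oO.
apply: lte_add_pinfty.
  apply: lte_sum_pinfty => nu _; rewrite dderive_regular_test.
  have r := test_represents (tderive (val \o nu) phi) p1 oO.
  by rewrite (dLp_norm_represents oO p1 r); case: r.
case: ifPn => // th0; apply: lte_sum_pinfty => nu _; rewrite dderive_regular_test.
set psi := tderive _ _.
have r := test_represents psi p1 oO; have tpsi := testfun_is_test psi.
apply: le_lt_trans (_ : slobodeckij O p (s - (Num.truncn s)%:R) psi < _)%E.
  by apply: ereal_inf_lbound; exists psi.
have th01 := truncn_frac s0 th0.
have mpsi := test_measurable tpsi.
apply: le_lt_trans (le_slob _ p1 measurableT mO _ mpsi) _ => //.
apply: le_lt_trans (slob_test_bound p1 th01 tpsi) _.
apply: lte_mul_pinfty; rewrite ?lee_fin ?kernel_const_ge0//.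
apply: lte_add_pinfty; last first.
  by apply: lte_sum_pinfty => i _; exact: (test_Lnorm_lty p1 (is_test_partial i tpsi)).
by rewrite lte_mul_pinfty// (test_Lnorm_lty p1 tpsi).
Qed.

Lemma Wspace_ge0_test O (s : R) p (phi : testfun O) : open O -> 0 <= s -> 1 < p ->
  Wspace_ge0 s p (regular phi : testfun O -> R^o).
Proof.
move=> oO s0 p1; split; last exact: Wnorm_ge0_test_lty.
by have [mf fp _] := test_represents phi p1 oO; exact: distribution_regular fp.
Qed.

Lemma Wnorm_ge00 O (s : R) p : open O -> 1 < p -> Wnorm_ge0 s p (0 : testfun O -> R^o) = 0%E.
Proof.
move=> oO p1; apply/eqP; rewrite eq_le Wnorm_ge0_ge0 andbT.
by have := Wnorm_ge0Z oO s 0 (0 : testfun O -> R^o) p1; rewrite scaler0 normr0 mul0e.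
Qed.

Lemma W0space_test O (s : R) p (phi : testfun O) : open O -> 0 <= s -> 1 < p ->
  W0space s p (regular phi : testfun O -> R^o).
Proof.
move=> oO s0 p1; split; first exact: Wspace_ge0_test.
by move=> e e0; exists phi; rewrite subrr Wnorm_ge00.
Qed.

Lemma Wspace_ge0_lin O (s : R) p (a : R) (u v : testfun O -> R^o) : open O -> 1 < p ->
  Wspace_ge0 s p u -> Wspace_ge0 s p v -> Wspace_ge0 s p (a *: u + v).
Proof.
move=> oO p1 [du fu] [dv fv]; split; first exact: distribution_lin.
apply: le_lt_trans (Wnorm_ge0D oO _ _ _ p1) _; apply: lte_add_pinfty => //.
by apply: le_lt_trans (Wnorm_ge0Z oO _ _ _ p1) _; rewrite lte_mul_pinfty// lee_fin.
Qed.

Lemma regular_lin O (a : R) (phi psi : testfun O) : open O ->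
  regular (a *: phi + psi)%R = a *: regular phi + regular psi :> (testfun O -> R^o).
Proof.
move=> oO; have mO := open_measurable_rV oO.
have p1 : 1 < 2 :> R by rewrite ltr1n.
have [m1 l1 _] := test_represents phi p1 oO; have [m2 l2 _] := test_represents psi p1 oO.
rewrite -(regularZ a p1 mO m1 l1) -(regularD p1 mO _ _ m2 l2)//.
- exact: measurable_funM.
- by rewrite Lp_normZ// lte_mul_pinfty// lee_fin.
Qed.

Lemma W0space_lin O (s : R) p (a : R) (u v : testfun O -> R^o) : open O -> 1 < p ->
  W0space s p u -> W0space s p v -> W0space s p (a *: u + v).
Proof.
move=> oO p1 [wu hu] [wv hv]; split; first exact: Wspace_ge0_lin.
move=> e e0.
have a1 : 0 < `|a| + 1 by rewrite ltr_wpDl.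
have e1 : 0 < e / 2 / (`|a| + 1) by rewrite !divr_gt0.
have e2 : 0 < e / 2 by rewrite divr_gt0.
have [phi hphi] := hu _ e1; have [psi hpsi] := hv _ e2.
exists (a *: phi + psi); rewrite regular_lin//.
have -> : a *: u + v - (a *: regular phi + regular psi) =
    a *: (u - regular phi) + (v - regular psi).
  by rewrite opprD addrACA scalerBr.
apply: le_lt_trans (Wnorm_ge0D oO _ _ _ p1) _; rewrite (splitr e) EFinD.
apply: lte_leD; last exact: ltW hpsi.
  by rewrite ge0_fin_numE ?Wnorm_ge0_ge0// (lt_trans hpsi)// ltry.
apply: le_lt_trans (Wnorm_ge0Z oO _ _ _ p1) _.
apply: (@le_lt_trans _ _ ((`|a| + 1)%:E * Wnorm_ge0 s p (u - regular phi)%R)%E).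
  by apply: lee_wpmul2r; [exact: Wnorm_ge0_ge0|rewrite lee_fin lerDl].
by rewrite -lte_pdivlMl// -EFinM mulrC.
Qed.

End distribution_facts.

(** * Dual norms tested on smooth functions *)

Section negative_norms.
Context {R : realType} {n : nat} (O : set 'rV[R]_n).
Hypothesis oO : open O.
Implicit Types (u v w : testfun O -> R^o) (p q s A : R) (phi psi : testfun O).

Lemma linear_lin (a : R) u v : linear u -> linear v -> linear (a *: u + v).
Proof.
move=> lu lv b phi psi; rewrite -[LHS]/(a * u (b *: phi + psi) + v (b *: phi + psi)) lu lv.
rewrite -[RHS]/(b * (a * u phi + v phi) + (a * u psi + v psi)) -![_ *: _]/(b * _).
by ring.
Qed.

Lemma dmul_linear phi u : linear u -> linear (dmul phi u).
Proof.
move=> lu a f g; rewrite /dmul -lu; congr u; apply: testfun_eq => x /=.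
by rewrite -[LHS]/(phi x * (a * f x + g x)) -[RHS]/(a * (phi x * f x) + phi x * g x); ring.
Qed.

Lemma linearBE w phi psi : linear w -> w (phi - psi) = w phi - w psi.
Proof.
move=> lw; have -> : phi - psi = (-1) *: psi + phi by rewrite scaleN1r addrC.
by rewrite lw -[_ *: _]/(-1 * _) mulN1r addrC.
Qed.

Lemma linear0E w : linear w -> w 0 = 0.
Proof. by move=> lw; rewrite -(subrr 0) linearBE// subrr. Qed.

Lemma regular0 : regular (0 : testfun O) = 0 :> (testfun O -> R^o).
Proof.
have := regular_lin 1 (0 : testfun O) 0 oO; rewrite scale1r addr0 scale1r => h.
by apply: (addrI (regular (0 : testfun O) : testfun O -> R^o)); rewrite addr0 -h.
Qed.

Lemma regularBt phi psi :
  regular (phi - psi)%R = regular phi - regular psi :> (testfun O -> R^o).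
Proof.
have := regular_lin (-1) psi phi oO; rewrite !scaleN1r => h.
by rewrite addrC h addrC.
Qed.

Lemma Wnorm_ge0N s p u : 1 < p -> Wnorm_ge0 s p (- u)%R = Wnorm_ge0 s p u.
Proof.
move=> p1; have le v : (Wnorm_ge0 s p (- v)%R <= Wnorm_ge0 s p v)%E.
  have := Wnorm_ge0Z oO s (-1) v p1; rewrite scaleN1r => h.
  by apply: le_trans h _; rewrite normrN1 mul1e.
by apply/eqP; rewrite eq_le le/= -{1}(opprK u) le.
Qed.

Lemma linear_on_dual_bound s p (F : (testfun O -> R^o) -> R) v A : 1 < p ->
  linear_on (W0space s p) F -> (dual_norm s p F <= A%:E)%E -> W0space s p v ->
  (`|F v|%:E <= A%:E * Wnorm_ge0 s p v)%E.
Proof.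
move=> p1 lF FA v0.
have W0 : W0space s p (0 : testfun O -> R^o).
  have := W0space_lin (-1) oO p1 v0 v0; by rewrite scaleN1r addNr.
have F0 : F 0 = 0.
  have := lF 1 0 0 W0 W0; rewrite scale1r addr0 mul1r => /eqP.
  by rewrite -subr_eq0 opprD addNKr oppr_eq0 => /eqP.
have WZ (a : R) : W0space s p (a *: v) by have := W0space_lin a oO p1 v0 W0; rewrite addr0.
have FZ (a : R) : F (a *: v) = a * F v.
  by have := lF a v 0 v0 W0; rewrite addr0 F0 addr0.
have FAZ (a : R) : (Wnorm_ge0 s p (a *: v)%R <= 1)%E -> `|a| * `|F v| <= A.
  move=> aw; rewrite -lee_fin -normrM -FZ; apply: le_trans FA.
  by apply: ereal_sup_ubound; exists (a *: v).
have vfin : Wnorm_ge0 s p v \is a fin_num.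
  by rewrite ge0_fin_numE ?Wnorm_ge0_ge0//; case: v0 => -[].
pose m := fine (Wnorm_ge0 s p v).
have nE : Wnorm_ge0 s p v = m%:E by rewrite fineK.
have nZ (a : R) : (Wnorm_ge0 s p (a *: v)%R <= `|a|%:E * m%:E)%E.
  by rewrite -nE; exact: Wnorm_ge0Z.
have m0 : 0 <= m by rewrite fine_ge0// Wnorm_ge0_ge0.
have A0 : 0 <= A.
  have := FAZ 0; rewrite normr0 mul0r; apply.
  by apply: le_trans (nZ 0) _; rewrite normr0 mul0e.
rewrite nE -EFinM lee_fin.
have [m0'|mn0] := eqVneq m 0.
  rewrite m0' mulr0 leNgt; apply/negP => Fv.
  (* A vector of norm 0 can be scaled freely inside the unit ball; this factor would give F the
     value A + 1 > A in modulus, so F v = 0. *)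
  have := FAZ ((A + 1) / `|F v|); rewrite normrM normfV normr_id (ger0_norm (addr_ge0 A0 ler01)).
  rewrite -mulrA mulVf ?gt_eqF// mulr1 => h.
  suff : A + 1 <= A by rewrite leNgt ltrDl ltr01.
  by apply: h; apply: le_trans (nZ _) _; rewrite m0' mule0 lee01.
have mp : 0 < m by rewrite lt_neqAle eq_sym mn0.
rewrite -ler_pdivrMr// mulrC -[m^-1]ger0_norm ?invr_ge0//; apply: FAZ.
by apply: le_trans (nZ _) _; rewrite ger0_norm ?invr_ge0// -EFinM mulVf.
Qed.

Lemma Wnorm_lt0_bound s p w A psi : s < 0 -> 1 < p -> (Wnorm_lt0 s p w <= A%:E)%E ->
  (`|w psi|%:E <= A%:E * Wnorm_ge0 (- s) (conj_exp p) (regular psi : testfun O -> R^o))%E.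
Proof.
move=> s0 p1 wA; have p'1 := conj_exp_gt1 p1.
have s0' : 0 <= - s by rewrite oppr_ge0 ltW.
have psifin : Wnorm_ge0 (- s) (conj_exp p) (regular psi : testfun O -> R^o) \is a fin_num.
  by rewrite ge0_fin_numE ?Wnorm_ge0_ge0// Wnorm_ge0_test_lty.
(* The infimum need not be attained, so a functional of norm below A + e is used; as the norm of psi
   is finite, e can tend to 0. *)
suff H e : 0 < e ->
    (`|w psi|%:E <= (A + e)%:E * Wnorm_ge0 (- s) (conj_exp p) (regular psi : testfun O -> R^o))%E.
  move: H; rewrite -(fineK psifin); set m := fine _ => H.
  have m0 : 0 <= m by rewrite fine_ge0// Wnorm_ge0_ge0.
  rewrite -EFinM lee_fin; apply/ler_addgt0Pr => e e0.
  have e1 : 0 < e / (m + 1) by rewrite divr_gt0// ltr_wpDl.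
  have := H _ e1; rewrite -EFinM lee_fin => /le_trans; apply.
  rewrite mulrDl lerD2l mulrAC ler_pdivrMr ?ltr_wpDl// ler_wpM2l ?ltW//.
  by rewrite ltrDl.
move=> e0; have : (Wnorm_lt0 s p w < (A + e)%:E)%E.
  by apply: le_lt_trans wA _; rewrite lte_fin ltrDl.
move=> /ereal_inf_lt[_ [F [lF Fw] <-] FA]; rewrite -Fw.
by apply: linear_on_dual_bound => //; [exact: ltW|exact: W0space_test].
Qed.

(** Density of test functions extends w to a functional F on W_0 with the same constant A, and F is
    then a competitor in the infimum. *)
Lemma Wnorm_lt0_le s p w A : s < 0 -> 1 < p -> linear w -> 0 <= A ->
  (forall psi, `|w psi|%:E <= A%:E * Wnorm_ge0 (- s) (conj_exp p) (regular psi : testfun O -> R^o))%E ->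
  (Wnorm_lt0 s p w <= A%:E)%E.
Proof.
move=> s0 p1 lw A0 wA; have p'1 := conj_exp_gt1 p1.
have s0' : 0 <= - s by rewrite oppr_ge0 ltW.
set sg := - s in s0' wA *; set q := conj_exp p in p'1 wA *.
pose nm v := fine (Wnorm_ge0 sg q v).
have nmE v : Wspace_ge0 sg q v -> Wnorm_ge0 sg q v = (nm v)%:E.
  by case=> _ fv; rewrite fineK// ge0_fin_numE// Wnorm_ge0_ge0.
have Wt psi : Wspace_ge0 sg q (regular psi : testfun O -> R^o) by exact: Wspace_ge0_test.
have WB v psi : Wspace_ge0 sg q v -> Wspace_ge0 sg q (v - regular psi).
  by move=> Wv; rewrite addrC -scaleN1r; exact: Wspace_ge0_lin.
have nm0 v : 0 <= nm v by rewrite fine_ge0// Wnorm_ge0_ge0.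
have nmA psi : `|w psi| <= A * nm (regular psi) by have := wA psi; rewrite nmE.
have nmD v psi chi : Wspace_ge0 sg q v ->
    nm (regular (psi - chi)) <= nm (v - regular psi) + nm (v - regular chi).
  move=> Wv; rewrite -lee_fin EFinD -(nmE _ (WB _ psi Wv)) -(nmE _ (WB _ chi Wv)) -(nmE _ (Wt _)).
  rewrite regularBt -[X in (_ <= X + _)%E]Wnorm_ge0N//.
  rewrite [X in Wnorm_ge0 sg q X](_ : _ = - (v - regular psi) + (v - regular chi)).
    exact: Wnorm_ge0D.
  by rewrite opprB addrA subrK.
(* The extension of w at v is the unique number within A |v - psi| of w psi for
   every psi. *)
pose G v (a : R) := forall psi, `|a - w psi| <= A * nm (v - regular psi).
have exG v : W0space sg q v -> exists a, G v a.
  (* By the triangle inequality every w psi - A |v - psi| lies below every w chi + A |v - chi|; the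
     supremum of the former separates the two families. *)
  move=> [Wv _]; pose L := [set x | exists psi, x = w psi - A * nm (v - regular psi)].
  have ubL chi : ubound L (w chi + A * nm (v - regular chi)).
    move=> _ [psi ->]; rewrite lerBlDr -addrA -mulrDr -lerBlDl -linearBE//.
    apply: le_trans (ler_norm _) _; apply: le_trans (nmA _) _; rewrite ler_wpM2l//.
    by rewrite [leRHS]addrC; exact: nmD.
  have hL : has_sup L by split; [exists (w 0 - A * nm (v - regular 0)); exists 0|exists (w 0 + A * nm (v - regular 0)); exact: ubL].
  exists (sup L) => psi; rewrite ler_norml; apply/andP; split.
    by rewrite lerBrDl; apply: ub_le_sup; [exact: hL.2|exists psi].
  by rewrite lerBlDl; apply: ge_sup; [exact: hL.1|exact: ubL].
pose F v := xget 0 (G v).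
have FP v : W0space sg q v -> G v (F v) by move=> /exG[a Ga]; exact: (xgetPex 0 (ex_intro _ a Ga)).
have Fw psi : F (regular psi) = w psi.
  have := FP _ (W0space_test psi oO s0' p'1) psi; rewrite subrr /nm Wnorm_ge00//= mulr0.
  by rewrite normr_le0 subr_eq0 => /eqP.
have lF : linear_on (W0space sg q) F.
  move=> a v v' Wv Wv'; apply/eqP; rewrite -subr_eq0 -normr_le0; apply/ler_addgt0Pr => e e0.
  (* Approximating v and v' within d costs A (|a| d + d) twice, in all 2 A (|a| + 1) d; the added 1
     keeps the denominator positive when A = 0. *)
  rewrite add0r; pose d := e / (2 * A * (`|a| + 1) + 1).
  have D0 : 0 < 2 * A * (`|a| + 1) + 1 by rewrite ltr_wpDl// !mulr_ge0// addr_ge0.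
  have d0 : 0 < d by rewrite divr_gt0.
  have [Wv1 /(_ _ d0)[phi hphi]] := Wv; have [Wv'1 /(_ _ d0)[phi' hphi']] := Wv'.
  move: hphi hphi'; rewrite !nmE ?lte_fin; [|exact: WB..] => hphi hphi'.
  have h1 := FP _ Wv phi; have h2 := FP _ Wv' phi'.
  have := FP _ (W0space_lin a oO p'1 Wv Wv') (a *: phi + phi').
  rewrite lw -[a *: w phi]/(a * w phi).
  have -> : nm (a *: v + v' - regular (a *: phi + phi')) =
      nm (a *: (v - regular phi) + (v' - regular phi')).
    by congr nm; rewrite regular_lin// opprD addrACA scalerBr.
  have n12 : nm (a *: (v - regular phi) + (v' - regular phi')) <= `|a| * d + d.
    rewrite -lee_fin -nmE; last by apply: Wspace_ge0_lin => //; exact: WB.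
    apply: le_trans (Wnorm_ge0D oO _ _ _ p'1) _; rewrite EFinD EFinM; apply: leeD.
      apply: le_trans (Wnorm_ge0Z oO _ _ _ p'1) _; apply: lee_wpmul2l; first by rewrite lee_fin.
      by rewrite (nmE _ (WB _ _ Wv1)) lee_fin (ltW hphi).
    by rewrite (nmE _ (WB _ _ Wv'1)) lee_fin (ltW hphi').
  move=> h3.
  have -> : F (a *: v + v') - (a * F v + F v') =
     (F (a *: v + v') - (a * w phi + w phi')) - (a * (F v - w phi) + (F v' - w phi')) by ring.
  apply: le_trans (ler_normB _ _) _.
  apply: (@le_trans _ _ (A * (`|a| * d + d) + (`|a| * (A * d) + A * d))).
    apply: lerD; first by apply: le_trans h3 _; rewrite ler_wpM2l.
    apply: le_trans (ler_normD _ _) _; rewrite normrM; apply: lerD.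
      rewrite ler_wpM2l//; apply: le_trans h1 _; rewrite ler_wpM2l//; exact: (ltW hphi).
    apply: le_trans h2 _; rewrite ler_wpM2l//; exact: (ltW hphi').
  have -> : A * (`|a| * d + d) + (`|a| * (A * d) + A * d) = 2 * A * (`|a| + 1) * d by ring.
  by rewrite /d mulrA ler_pdivrMr// mulrC ler_pM2l// lerDl.
apply: le_trans (_ : (dual_norm sg q F <= _)%E).
  by apply: ereal_inf_lbound; exists F.
apply: ge_ereal_sup => _ [v [Wv v1] <-]; have [Wv1 _] := Wv.
have := FP _ Wv 0; rewrite linear0E// subr0 regular0 subr0 lee_fin => /le_trans; apply.
by rewrite ler_piMr// -lee_fin -nmE.
Qed.

Lemma dual_norm_ge0 s p (F : (testfun O -> R^o) -> R) : 0 <= s -> 1 < p -> (0 <= dual_norm s p F)%E.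
Proof.
move=> s0 p1; apply: (@le_trans _ _ `|F (regular (0 : testfun O))|%:E); first by rewrite lee_fin.
apply: ereal_sup_ubound; exists (regular (0 : testfun O)) => //.
split; first exact: (W0space_test 0 oO s0 p1).
by rewrite regular0 Wnorm_ge00.
Qed.

Lemma Wnorm_lt0_ge0 s p w : s < 0 -> 1 < p -> (0 <= Wnorm_lt0 s p w)%E.
Proof.
move=> s0 p1; apply: ereal_inf_image_ge0 => F _; apply: dual_norm_ge0; last exact: conj_exp_gt1.
by rewrite oppr_ge0 ltW.
Qed.

Lemma Wnorm_norm_ge0 s p u : 1 < p -> (0 <= Wnorm s p u)%E.
Proof.
move=> p1; rewrite /Wnorm; have [s0|s0] := leP 0 s; first exact: Wnorm_ge0_ge0.
exact: Wnorm_lt0_ge0.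
Qed.

Lemma WnormZ s p (a : R) u : 1 < p -> linear u ->
  (Wnorm s p (a *: u)%R <= `|a|%:E * Wnorm s p u)%E.
Proof.
move=> p1 lu; rewrite /Wnorm; have [s0|s0] := leP 0 s; first exact: Wnorm_ge0Z.
have Z0 : linear (a *: u) by rewrite -[a *: u]addr0; apply: linear_lin => // b ? ?; rewrite [RHS]addr0 scaler0.
have [->|a0] := eqVneq a 0.
  rewrite normr0 mul0e scale0r; apply: Wnorm_lt0_le => //.
    by move=> b ? ?; rewrite [RHS]addr0 scaler0.
  by move=> psi; rewrite -[(0 : _ -> _) _]/0 normr0 mul0e.
have := Wnorm_lt0_ge0 u s0 p1.
case E : (Wnorm_lt0 s p u) => [A| |]; rewrite ?lee_fin//; last by rewrite gt0_muley ?leey// lte_fin normr_gt0.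
move=> A0; apply: Wnorm_lt0_le => //; first by rewrite mulr_ge0.
move=> psi; rewrite -[(a *: u) psi]/(a * u psi) normrM !EFinM -muleA lee_wpmul2l ?lee_fin//.
by apply: Wnorm_lt0_bound => //; rewrite E.
Qed.

Lemma WnormD s p u v : 1 < p -> linear u -> linear v ->
  (Wnorm s p (u + v)%R <= Wnorm s p u + Wnorm s p v)%E.
Proof.
move=> p1 lu lv; rewrite /Wnorm; have [s0|s0] := leP 0 s; first exact: Wnorm_ge0D.
have := Wnorm_lt0_ge0 u s0 p1; have := Wnorm_lt0_ge0 v s0 p1.
case E : (Wnorm_lt0 s p v) => [A| |]; rewrite ?lee_fin//; last first.
  by move=> _ u0; rewrite addey ?leey// gt_eqF// (lt_le_trans _ u0)// ltNy0.
case E' : (Wnorm_lt0 s p u) => [B| |]; rewrite ?lee_fin//; last by move=> _ _; rewrite addye ?leey.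
move=> A0 B0; apply: Wnorm_lt0_le => //; [|by rewrite addr_ge0|].
  by rewrite -[u]scale1r; exact: linear_lin.
move=> psi; rewrite -[(u + v) psi]/(u psi + v psi).
rewrite EFinD ge0_muleDl ?lee_fin//.
apply: (@le_trans _ _ (`|u psi| + `|v psi|)%:E); first by rewrite lee_fin ler_normD.
by rewrite EFinD leeD//; apply: Wnorm_lt0_bound => //; rewrite ?E ?E'.
Qed.

End negative_norms.

(** * Restriction and extension *)

Section multiplication.
Context {R : realType} {n : nat}.
Local Notation mu := (lebesgue_rV R n).
Implicit Types (f g : 'rV[R]_n -> R) (O V : set 'rV[R]_n) (p sg theta C : R).
Local Notation N p f := ('N[mu]_(p%:E)[EFin \o f%R])%E.

Lemma represents_extend V O p f (eta : testfun V) (w : testfun V -> R^o) :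
  1 < p -> open V -> open O -> V `<=` O -> represents p f w ->
  represents p (fun x => eta x * f x) (dextend eta w : testfun O -> R^o).
Proof.
move=> p1 oV oO VO [mf fp wf].
have mV := open_measurable_rV oV; have mO := open_measurable_rV oO.
have teta := testfun_is_test eta.
have E : (fun x => eta x * f x) = (fun x => eta x * (f \_ V) x).
  apply/funext => x; rewrite restrict0E; case: ifPn => // /negP Vx.
  by rewrite (testfun_out eta) ?mul0r// => Vx'; apply: Vx; exact: mem_set.
have mE : measurable_fun setT (fun x => eta x * f x).
  rewrite E; apply: measurable_funM; first exact: test_measurable teta.
  exact/(measurable_restrictT _ mV).
have [B B0 etaB] := is_test_bounded teta.
split.
- exact: measurable_funS mE.
- apply: (@le_lt_trans _ _ (Lp_norm V p (fun x => B * f x))); last first.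
    by rewrite Lp_normZ// lte_mul_pinfty// lee_fin.
  apply: le_Lp_norm => //; [exact: measurable_funS mE|exact: measurable_funM|].
  move=> x Ox; rewrite mulf_eq0 negb_or => /andP[ex _]; split.
    by apply: contrapT => /(testfun_out eta) ex0; rewrite ex0 eqxx in ex.
  by rewrite !normrM ler_wpM2r// (le_trans (etaB x))// ler_norm.
apply/funext => psi; rewrite /dextend wf !regularE; apply: eq_Rintegral => x _.
rewrite !restrict0E /=; have [Vx|Vx] := boolP (x \in V).
  by rewrite mem_set; [ring|exact/VO/set_mem].
rewrite (testfun_out eta) ?mul0r ?mulr0 ?if_same ?mul0r//.
by move=> Vx'; move/negP : Vx; apply; exact: mem_set.
Qed.

Lemma dLp_norm_extend V O p (eta : testfun V) : 1 < p -> open V -> open O -> V `<=` O ->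
  exists2 C, 0 < C & forall w : testfun V -> R^o,
    (dLp_norm p (dextend eta w : testfun O -> R^o) <= C%:E * dLp_norm p w)%E.
Proof.
move=> p1 oV oO VO.
have mV := open_measurable_rV oV; have mO := open_measurable_rV oO.
have teta := testfun_is_test eta.
have [B B0 etaB] := is_test_bounded teta.
(* B may be 0, while [ereal_inf_scale] asks for a positive factor. *)
exists (B + 1) => [|w]; first by rewrite ltr_wpDl.
apply: ereal_inf_scale; first by rewrite ltr_wpDl.
move=> _ [f rf <-]; have [mf _ _] := rf.
have re := represents_extend eta p1 oV oO VO rf; have [me _ _] := re.
exists (Lp_norm O p (fun x => eta x * f x)); first by exists (fun x => eta x * f x).
rewrite -[B + 1]ger0_norm ?addr_ge0// -Lp_normZ//.
apply: le_Lp_norm => //; first exact: measurable_funM.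
move=> x Ox; rewrite mulf_eq0 negb_or => /andP[ex _]; split.
  by apply: contrapT => /(testfun_out eta) ex0; rewrite ex0 eqxx in ex.
rewrite !normrM ler_wpM2r// (le_trans (etaB x))// (le_trans _ (ler_norm _))//.
by rewrite lerDl.
Qed.

Lemma dslob_extend V O p theta (eta : testfun V) :
  1 < p -> 0 < theta < 1 -> open V -> open O -> V `<=` O ->
  exists2 C, 0 < C & forall w : testfun V -> R^o,
    (dslobodeckij p theta (dextend eta w : testfun O -> R^o) <=
     C%:E * (dslobodeckij p theta w + (2 * @kernel_const R n p theta)%:E * dLp_norm p w))%E.
Proof.
move=> p1 th oV oO VO.
have mV := open_measurable_rV oV; have mO := open_measurable_rV oO.
have teta := testfun_is_test eta.
have [B B0 etaB] := is_test_bounded teta; have [L L0 etaL] := test_lipschitz teta.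
pose C := B + L + 1.
have C0 : 0 < C by rewrite ltr_wpDl// addr_ge0.
exists C => // w.
have [w0|w0] := eqVneq (dslobodeckij p theta w) +oo%E.
  rewrite w0 addye; first by rewrite gt0_muley ?leey// lte_fin.
  rewrite gt_eqF// (lt_le_trans ltNy0)// mule_ge0 ?dLp_norm_ge0//.
  by rewrite lee_fin mulr_ge0// kernel_const_ge0.
have [f0 rf0] : exists f, represents p f w.
  by apply: (@dslob_lty _ _ _ p theta); rewrite ltey.
have [_ fp0 _] := rf0.
(* The L^p term is the same number K for every representative, so it can be moved across the
   inequality before taking the infimum of the seminorms. *)
rewrite (dLp_norm_represents oV p1 rf0).
set K := (_ * Lp_norm V p f0)%E.
have Kfin : K \is a fin_num.
  by rewrite fin_numM// ge0_fin_numE// Lp_norm_ge0.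
rewrite -lee_pdivrMl// -leeBlDr//; apply: le_ereal_inf_tmp => _ [f rf <-].
rewrite leeBlDr// lee_pdivrMl//; have [mf _ _] := rf.
have re := represents_extend eta p1 oV oO VO rf.
apply: (@le_trans _ _ (slobodeckij O p theta (fun x => eta x * f x))).
  by apply: ereal_inf_lbound; exists (fun x => eta x * f x).
have -> : K = ((2 * @kernel_const R n p theta)%:E * Lp_norm V p f)%E.
  by rewrite /K -(dLp_norm_represents oV p1 rf0) (dLp_norm_represents oV p1 rf).
apply: slob_mul_extend => //.
- exact: test_measurable teta.
- exact: ltW.
- by move=> x; rewrite (le_trans (etaB x))// /C -addrA lerDl addr_ge0.
- move=> x y; rewrite (le_trans (etaL x y))// ler_wpM2r ?min1_norm_ge0//.
  by rewrite /C addrAC lerDr addr_ge0.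
- by move=> x; exact: testfun_out.
Qed.

(** Isolates the one term in which every derivative falls on the second factor; in all others that
    factor carries fewer than [size s] derivatives. *)
Lemma leibniz_rcons (s : seq 'I_n) : exists l : seq (seq 'I_n * seq 'I_n),
  leibniz s = rcons l ([::], s) /\ all (fun ab => (size ab.2 < size s)%N) l.
Proof.
elim: s => [|i s [l [ih h]]] /=; first by exists [::].
exists ([seq (i :: ab.1, ab.2) | ab <- leibniz s] ++ [seq (ab.1, i :: ab.2) | ab <- l]).
rewrite {2}ih map_rcons rcons_cat; split=> //; rewrite all_cat !all_map; apply/andP; split.
  by apply/allP => ab /leibniz_size h' /=; rewrite ltnS -h' leq_addl.
by apply: sub_all h => ab.
Qed.

Lemma Lp_pder_test_le V sg p (psi : testfun V) (b : seq 'I_n) : open V -> 1 < p ->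
  (size b <= Num.truncn sg)%N ->
  (N p (pder b psi) <= Wnorm_ge0 sg p (regular psi : testfun V -> R^o))%E.
Proof.
move=> oV p1 bk; have mV := open_measurable_rV oV.
pose nu : {ffun 'I_n -> 'I_(Num.truncn sg).+1} := [ffun i => inord (count_mem i b)].
have nuE : val \o nu = (fun i => count_mem i b).
  by apply/funext => i; rewrite /= ffunE inordK// ltnS (leq_trans (count_size _ _)).
have := @dLp_norm_le_Wnorm R n V sg p nu (regular psi).
rewrite nuE mindex_order_count => /(_ bk); apply: le_trans.
rewrite dderive_regular_test (dLp_norm_represents oV p1 (test_represents _ p1 oV)).
rewrite -pder_tderive -Lp_norm_setT; have tb := pder_is_test b (testfun_is_test psi).
have mb := test_measurable tb.
apply: le_Lp_norm => //; first exact: measurable_funS mb.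
move=> x _ bx; split=> //; case: tb => _ _; apply; exact: subset_closure.
Qed.

Lemma Lp_leibniz_le V sg p (eta : 'rV[R]_n -> R) (l : seq (seq 'I_n * seq 'I_n)) :
  is_test V eta -> open V -> 1 < p ->
  all (fun ab => (size ab.2 <= Num.truncn sg)%N) l ->
  exists2 C, 0 <= C & forall psi : testfun V,
    (N p (\sum_(ab <- l) pder ab.1 eta * pder ab.2 psi)%R <=
      C%:E * Wnorm_ge0 sg p (regular psi : testfun V -> R^o))%E.
Proof.
move=> teta oV p1.
elim: l => [_|[a b] l ih /= /andP[bk /ih[C C0 hC]]].
  exists 0 => // psi; rewrite big_nil mul0e.
  by rewrite (_ : EFin \o _ = cst 0%E) ?Lnorm0// eqe gt_eqF// (lt_trans _ p1).
have ta := pder_is_test a teta; have [B B0 aB] := is_test_bounded ta.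
exists (B + C) => [|psi]; first by rewrite addr_ge0.
have tb := pder_is_test b (testfun_is_test psi).
have ml : measurable_fun setT (\sum_(ab <- l) pder ab.1 eta * pder ab.2 psi).
  apply: continuous_measurable_rV; apply: (@Ck_cont _ _ 0).
  apply: sum_smooth => ab _; apply: smoothM; apply: pder_smooth.
    by case: teta.
  exact: testfun_smooth.
rewrite big_cons; apply: le_trans (Lnorm_triangle _ p1 _ ml) _.
  by apply: measurable_funM; [exact: test_measurable ta|exact: test_measurable tb].
rewrite EFinD ge0_muleDl ?lee_fin//; apply: leeD => //=.
apply: le_trans (_ : (B%:E * N p (pder b psi) <= _)%E); last first.
  by apply: lee_wpmul2l; [rewrite lee_fin|exact: Lp_pder_test_le].
rewrite -[B in leRHS]ger0_norm// -Lnorm_scale//; last exact: test_measurable tb.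
apply: le_Lnorm => //.
- by apply: measurable_funM; [exact: test_measurable ta|exact: test_measurable tb].
- by apply: measurable_funM => //; exact: test_measurable tb.
by move=> x; rewrite !normrM ler_wpM2r// (le_trans (aB x))// ler_norm.
Qed.

End multiplication.

(** * Multiplication of test functions by a cutoff *)

Section test_multiplication.
Context {R : realType} {n : nat} (V O : set 'rV[R]_n) (p : R).
Hypotheses (oV : open V) (oO : open O) (VO : V `<=` O) (p1 : 1 < p).
Local Notation mu := (lebesgue_rV R n).
Local Notation N p f := ('N[mu]_(p%:E)[EFin \o f%R])%E.

Lemma dLp_norm_test_le (phi : testfun O) :
  (dLp_norm p (regular phi : testfun O -> R^o) <= N p phi)%E.
Proof.
have mO := open_measurable_rV oO.
have mphi := test_measurable (testfun_is_test phi).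
rewrite (dLp_norm_represents oO p1 (test_represents _ p1 oO)) -Lp_norm_setT.
by apply: le_Lp_norm => //; exact: measurable_funS mphi.
Qed.

Lemma dslob_test_le theta (phi : testfun O) : 0 < theta < 1 ->
  (dslobodeckij p theta (regular phi : testfun O -> R^o) <=
   (@kernel_const R n p theta)%:E * (2 * N p phi + \sum_(i < n) N p (partial i phi)))%E.
Proof.
move=> th; have mO := open_measurable_rV oO.
have tphi := testfun_is_test phi; have mphi := test_measurable tphi.
apply: le_trans (slob_test_bound p1 th tphi).
apply: le_trans _ (le_slob _ p1 measurableT mO _ mphi) => //.
by apply: ereal_inf_lbound; exists phi => //; exact: test_represents.
Qed.

Lemma test_dderive_mul_le sg (eta : testfun V) (nu : {ffun 'I_n -> 'I_(Num.truncn sg).+1}) :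
  (mindex_order (val \o nu) <= Num.truncn sg)%N ->
  exists2 C, 0 <= C & forall psi : testfun V,
    (dLp_norm p (dderive (val \o nu) (regular (tincl VO (tmul eta psi)) : testfun O -> R^o)) <=
       C%:E * Wnorm_ge0 sg p (regular psi : testfun V -> R^o))%E.
Proof.
move=> nuk; have teta := testfun_is_test eta.
set s := canonical_seq (val \o nu).
have [|C C0 hC] := @Lp_leibniz_le R n V sg p eta (leibniz s) teta oV p1.
  apply/allP => ab /leibniz_size h; rewrite (leq_trans _ nuk)// -size_canonical_seq -/s -h.
  exact: leq_addl.
exists C => // psi; rewrite dderive_regular_test; apply: le_trans (dLp_norm_test_le _) _.
apply: le_trans (hC psi); rewrite -pderM ?tderiveE//; last exact: testfun_smooth.
by case: teta.
Qed.

Lemma test_dslob_mul_le sg (eta : testfun V) (nu : {ffun 'I_n -> 'I_(Num.truncn sg).+1}) :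
  0 <= sg -> sg - (Num.truncn sg)%:R != 0 -> mindex_order (val \o nu) = Num.truncn sg ->
  exists2 C, 0 <= C & forall psi : testfun V,
    (dslobodeckij p (sg - (Num.truncn sg)%:R)
       (dderive (val \o nu) (regular (tincl VO (tmul eta psi)) : testfun O -> R^o)) <=
       C%:E * Wnorm_ge0 sg p (regular psi : testfun V -> R^o))%E.
Proof.
move=> sg0 th0 nuk; have th01 := truncn_frac sg0 th0.
set th := sg - _ in th0 th01 *.
have teta := testfun_is_test eta; have seta : smooth eta by case: teta.
set s := canonical_seq (val \o nu).
have ss : size s = Num.truncn sg by rewrite size_canonical_seq.
have [l [ls ltl]] := leibniz_rcons s.
have lel : all (fun ab => (size ab.2 <= Num.truncn sg)%N) l.
  by apply: sub_all ltl => ab; rewrite ss; exact: ltnW.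
have [C0 C00 hC0] := Lp_leibniz_le teta oV p1 lel.
have /choice[D hD] : forall i : 'I_n, exists D, 0 <= D /\ forall psi : testfun V,
    (N p (partial i (\sum_(ab <- l) pder ab.1 eta * pder ab.2 psi)%R) <=
      D%:E * Wnorm_ge0 sg p (regular psi : testfun V -> R^o))%E.
  (* The terms in [l] carry fewer than k derivatives of psi, so the further derivative required by
     [slob_test_bound] keeps them within order k; [l'] lists the resulting terms. *)
  move=> i; pose l' := [seq (i :: ab.1, ab.2) | ab <- l] ++ [seq (ab.1, i :: ab.2) | ab <- l].
  have [|D D0 hD] := @Lp_leibniz_le R n V sg p eta l' teta oV p1.
    rewrite all_cat !all_map; apply/andP; split; first exact: sub_all lel.
    by apply: sub_all ltl => ab; rewrite ss.
  exists D; split=> // psi; apply: le_trans (hD psi).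
  rewrite partial_sum; last first.
    by move=> ab; apply: smoothM; apply: pder_smooth => //; exact: testfun_smooth.
  rewrite big_cat/= !big_map -big_split/= le_eqVlt; apply/orP; left; apply/eqP; apply: Lnorm_eq.
  move=> x; apply: (congr1 (fun h : 'rV[R]_n -> R => h x)); apply: eq_bigr => ab _.
  by rewrite partialM//; apply: pder_smooth => //; exact: testfun_smooth.
have [E E0 hE] := dslob_extend eta p1 th01 oV oO VO.
set kap := @kernel_const R n p th in hE *.
have kap0 : 0 <= kap by exact: kernel_const_ge0.
have D0 : 0 <= \sum_i D i by apply: sumr_ge0 => i _; case: (hD i).
have A0 : 0 <= E * (1 + 2 * kap) by rewrite mulr_ge0 ?(ltW E0)// addr_ge0// mulr_ge0.
have B0 : 0 <= kap * (2 * C0 + \sum_i D i) by rewrite mulr_ge0// addr_ge0// mulr_ge0.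
exists (E * (1 + 2 * kap) + kap * (2 * C0 + \sum_i D i)) => [|psi]; first exact: addr_ge0.
set W := Wnorm_ge0 sg p _.
have W0 : (0 <= W)%E by exact: Wnorm_ge0_ge0.
(* Subtracting eta times the derivative of psi removes the only Leibniz term of top order in psi;
   what is left is the sum over [l]. *)
pose g : testfun V := tderive (val \o nu) (tmul eta psi) - tmul eta (tderive (val \o nu) psi).
have gE : (g : 'rV[R]_n -> R) = \sum_(ab <- l) pder ab.1 eta * pder ab.2 psi.
  apply/funext => x; rewrite -[LHS]/(tderive (val \o nu) (tmul eta psi) x - eta x * tderive (val \o nu) psi x).
  have := pderM s seta (testfun_smooth psi).
  rewrite ls -cats1 big_cat big_seq1/= => /(congr1 (fun h : 'rV[R]_n -> R => h x)).
  by rewrite !tderiveE => -> /=; rewrite -[X in X - _]/(_ + eta x * pder s psi x) addrK.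
have -> : dderive (val \o nu) (regular (tincl VO (tmul eta psi)) : testfun O -> R^o) =
    dextend eta (dderive (val \o nu) (regular psi)) + regular (tincl VO g).
  rewrite !dderive_regular_test.
  have [_ _ ->] := represents_extend eta p1 oV oO VO (test_represents (tderive (val \o nu) psi) p1 oV).
  rewrite -[RHS](_ : regular (tincl VO (tmul eta (tderive (val \o nu) psi)) + tincl VO g) = _).
    congr regular; apply/funext => x.
    rewrite tderiveE -[RHS]/(eta x * tderive (val \o nu) psi x + (tderive (val \o nu) (tmul eta psi) x - eta x * tderive (val \o nu) psi x)).
    by rewrite addrC subrK tderiveE.
  by have := regular_lin 1 (tincl VO (tmul eta (tderive (val \o nu) psi))) (tincl VO g) oO; rewrite !scale1r.
apply: le_trans (dslobD oO _ _ _ p1) _; rewrite EFinD ge0_muleDl//; apply: leeD.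
  apply: le_trans (hE _) _; rewrite [(E * _)%:E]EFinM -muleA; apply: lee_wpmul2l; first by rewrite lee_fin ltW.
  rewrite EFinD ge0_muleDl ?lee_fin ?mulr_ge0// mul1e; apply: leeD; first exact: dslob_le_Wnorm.
  by apply: lee_wpmul2l; [rewrite lee_fin mulr_ge0|apply: dLp_norm_le_Wnorm; rewrite // nuk].
apply: le_trans (dslob_test_le _ th01) _; rewrite [(kap * _)%:E]EFinM -muleA; apply: lee_wpmul2l => //.
have tgE : (tincl VO g : 'rV[R]_n -> R) = \sum_(ab <- l) pder ab.1 eta * pder ab.2 psi := gE.
rewrite tgE [X in (_ <= X * _)%E]EFinD [leRHS]ge0_muleDl ?lee_fin ?mulr_ge0//; apply: leeD.
  by rewrite [(2 * C0)%:E]EFinM -muleA; apply: lee_wpmul2l => //; exact: hC0.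
rewrite -sumEFin ge0_sume_distrl; last by move=> i _; rewrite lee_fin; case: (hD i).
by apply: lee_sum => i _; case: (hD i).
Qed.

Lemma test_mul_le sg (eta : testfun V) : 0 <= sg ->
  exists2 C, 0 <= C & forall psi : testfun V,
    (Wnorm_ge0 sg p (regular (tincl VO (tmul eta psi)) : testfun O -> R^o) <=
       C%:E * Wnorm_ge0 sg p (regular psi : testfun V -> R^o))%E.
Proof.
move=> sg0; set k := Num.truncn sg.
have /choice[C hC] : forall nu : {ffun 'I_n -> 'I_k.+1}, exists C, 0 <= C /\
    forall psi : testfun V,
    ((mindex_order (val \o nu) <= k)%N ->
     (dLp_norm p (dderive (val \o nu) (regular (tincl VO (tmul eta psi)) : testfun O -> R^o)) <=
       C%:E * Wnorm_ge0 sg p (regular psi : testfun V -> R^o))%E) /\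
    (sg - k%:R != 0 -> mindex_order (val \o nu) = k ->
     (dslobodeckij p (sg - k%:R)
       (dderive (val \o nu) (regular (tincl VO (tmul eta psi)) : testfun O -> R^o)) <=
       C%:E * Wnorm_ge0 sg p (regular psi : testfun V -> R^o))%E).
  move=> nu.
  have [nuk|nuk] := leqP (mindex_order (val \o nu)) k; last first.
    by exists 0; split=> // psi; split=> // _ nuk'; rewrite nuk' ltnn in nuk.
  have [C C0 hC] := test_dderive_mul_le eta nuk.
  have [th0|th0] := eqVneq (sg - k%:R) 0.
    by exists C; split=> // psi; split=> // ; rewrite th0 eqxx.
  have [nuk'|nuk'] := eqVneq (mindex_order (val \o nu)) k; last first.
    by exists C; split=> // psi; split=> // _ /eqP; rewrite (negbTE nuk').
  have [D D0 hD] := test_dslob_mul_le eta sg0 th0 nuk'.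
  exists (C + D); split; first by rewrite addr_ge0.
  move=> psi; split=> [_|_ _].
    apply: le_trans (hC psi) _; apply: lee_wpmul2r; first exact: Wnorm_ge0_ge0.
    by rewrite lee_fin lerDl.
  apply: le_trans (hD psi) _; apply: lee_wpmul2r; first exact: Wnorm_ge0_ge0.
  by rewrite lee_fin lerDr.
have C0 nu : 0 <= C nu by case: (hC nu).
have Cle nu : C nu <= \sum_nu C nu by rewrite (bigD1 nu)//= lerDl sumr_ge0.
exists ((2 * #|{: {ffun 'I_n -> 'I_k.+1}}|%:R) * \sum_nu C nu) => [|psi].
  by rewrite mulr_ge0// ?mulr_ge0// sumr_ge0.
rewrite EFinM -muleA; apply: Wnorm_ge0_le => //.
- by rewrite mule_ge0 ?Wnorm_ge0_ge0// lee_fin sumr_ge0.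
- move=> nu nuk; have [_ /(_ psi)[h _]] := hC nu; apply: le_trans (h nuk) _.
  by apply: lee_wpmul2r; [exact: Wnorm_ge0_ge0|rewrite lee_fin].
- move=> nu th0 nuk; have [_ /(_ psi)[_ h]] := hC nu; apply: le_trans (h th0 nuk) _.
  by apply: lee_wpmul2r; [exact: Wnorm_ge0_ge0|rewrite lee_fin].
Qed.

End test_multiplication.

(** * Restriction to a smaller open set *)

Section restriction.
Context {R : realType} {n : nat} (V O : set 'rV[R]_n).
Hypotheses (oV : open V) (oO : open O) (VO : V `<=` O).
Implicit Types (u w : testfun O -> R^o) (p s theta : R).

Lemma represents_restrict p f w : 1 < p -> represents p f w -> represents p f (drestrict VO w).
Proof.
move=> p1 [mf fp wf]; have mV := open_measurable_rV oV; have mO := open_measurable_rV oO.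
have mfV : measurable_fun V f by exact: measurable_funS mf.
split=> //.
  by apply: le_lt_trans fp; apply: le_Lp_norm => // x Vx _; split=> //; exact: VO.
apply/funext => psi; rewrite /drestrict wf !regularE; apply: eq_Rintegral => x _.
rewrite !restrict0E /=; have [Vx|Vx] := boolP (x \in V).
  by rewrite mem_set//; exact/VO/set_mem.
rewrite (testfun_out psi) ?mulr0//.
by move=> Vx'; move/negP : Vx; apply; exact: mem_set.
Qed.

Lemma dLp_norm_restrict p w : 1 < p -> (dLp_norm p (drestrict VO w) <= dLp_norm p w)%E.
Proof.
move=> p1; have mV := open_measurable_rV oV; have mO := open_measurable_rV oO.
apply: le_ereal_inf_tmp => _ [f rf <-]; have [mf _ _] := rf.
apply: (@le_trans _ _ (Lp_norm V p f)).
  by apply: ereal_inf_lbound; exists f => //; exact: represents_restrict.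
apply: le_Lp_norm => //; first exact: measurable_funS mf.
by move=> x Vx _; split=> //; exact: VO.
Qed.

Lemma dslob_restrict p theta w : 1 < p ->
  (dslobodeckij p theta (drestrict VO w) <= dslobodeckij p theta w)%E.
Proof.
move=> p1; have mV := open_measurable_rV oV; have mO := open_measurable_rV oO.
apply: le_ereal_inf_tmp => _ [f rf <-]; have [mf _ _] := rf.
apply: (@le_trans _ _ (slobodeckij V p theta f)); last exact: le_slob.
by apply: ereal_inf_lbound; exists f => //; exact: represents_restrict.
Qed.

Lemma dderive_restrict (nu : 'I_n -> nat) w :
  dderive nu (drestrict VO w) = drestrict VO (dderive nu w).
Proof.
apply/funext => psi; rewrite /dderive /drestrict; congr (_ * w _).
by apply: testfun_eq => x; rewrite /= !tderiveE.
Qed.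

Lemma Wnorm_ge0_restrict s p w : 1 < p ->
  (Wnorm_ge0 s p (drestrict VO w) <= Wnorm_ge0 s p w)%E.
Proof.
move=> p1; apply: leeD.
  by apply: lee_sum => nu _; rewrite dderive_restrict; exact: dLp_norm_restrict.
case: ifP => // _.
by apply: lee_sum => nu _; rewrite dderive_restrict; exact: dslob_restrict.
Qed.

Lemma drestrict_regular (psi : testfun V) :
  drestrict VO (regular (tincl VO psi)) = regular psi.
Proof.
have p1 : 1 < 2 :> R by rewrite ltr1n.
have := represents_restrict p1 (test_represents (tincl VO psi) p1 oO).
by case=> _ _ ->.
Qed.

Lemma drestrict_linear w : linear w -> linear (drestrict VO w).
Proof. by move=> lw a phi psi; rewrite /drestrict -lw; congr w; exact: testfun_eq. Qed.

Lemma Wnorm_restrict s p (phi : testfun O) (chi : testfun V) : 1 < p ->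
  (forall x, phi x != 0 -> chi x = 1) ->
  exists2 C, 0 < C & forall u, linear u ->
    (Wnorm s p (drestrict VO (dmul phi u)) <= C%:E * Wnorm s p (dmul phi u))%E.
Proof.
move=> p1 chi1; rewrite /Wnorm; have [s0|s0] := leP 0 s.
  by exists 1 => // u _; rewrite mul1e; exact: Wnorm_ge0_restrict.
have p'1 := conj_exp_gt1 p1; have s0' : 0 <= - s by rewrite oppr_ge0 ltW.
have [C C0 hC] := test_mul_le oV oO VO p'1 chi s0'.
exists (C + 1) => [|u lu]; first by rewrite ltr_wpDl.
have C1 : 0 < C + 1 by rewrite ltr_wpDl.
have lw := dmul_linear phi lu.
have := Wnorm_lt0_ge0 oO (dmul phi u) s0 p1.
case E : (Wnorm_lt0 s p (dmul phi u)) => [A| |]; rewrite ?lee_fin// => A0; last first.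
  by rewrite gt0_muley ?leey// lte_fin.
apply: Wnorm_lt0_le => //; [exact: drestrict_linear|by rewrite mulr_ge0// ltW|].
move=> psi.
(* As chi = 1 where phi is nonzero, psi may be replaced by chi psi. Extending psi itself by zero
   need not be bounded in fractional norms, whereas [test_mul_le] controls chi psi. *)
have -> : drestrict VO (dmul phi u) psi = dmul phi u (tincl VO (tmul chi psi)).
  rewrite /drestrict /dmul; congr u; apply: testfun_eq => x /=.
  by have [->|/chi1 ->] := eqVneq (phi x) 0; rewrite ?mul0r// mul1r.
apply: (@le_trans _ _ (A%:E * Wnorm_ge0 (- s) (conj_exp p) (regular (tincl VO (tmul chi psi)) : testfun O -> R^o))%E).
  by apply: Wnorm_lt0_bound => //; rewrite E.
rewrite [(_ * A)%:E]EFinM [X in (_ <= X * _)%E]muleC -muleA; apply: lee_wpmul2l => //.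
apply: le_trans (hC psi) _; apply: lee_wpmul2r; first exact: Wnorm_ge0_ge0.
by rewrite lee_fin lerDl.
Qed.

End restriction.

(** * Extension from a smaller open set *)

Section extension.
Context {R : realType} {n : nat} (V O : set 'rV[R]_n).
Hypotheses (oV : open V) (oO : open O) (VO : V `<=` O).
Implicit Types (w : testfun V -> R^o) (p s theta : R).

(** What remains of w = phi u once u is forgotten. Being a condition on pairings, it passes to
    limits, which are no longer given as a product with phi. *)
Definition supported_by (phi : 'rV[R]_n -> R) w : Prop :=
  forall psi : testfun V, (forall x, phi x * psi x = 0) -> w psi = 0.

(** The derivative of chi psi and chi times the derivative of psi agree where phi is nonzero, so w
    does not see their difference. This needs chi = 1 near such points, since derivatives of chi
    occur. *)
Lemma dderive_extend (phi : 'rV[R]_n -> R) (chi : testfun V) (nu : 'I_n -> nat) w :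
  (forall x, phi x != 0 -> \forall y \near x, chi y = 1) ->
  linear w -> supported_by phi w ->
  dderive nu (dextend chi w : testfun O -> R^o) = dextend chi (dderive nu w).
Proof.
move=> chi1 lw sw; apply/funext => psi; rewrite /dderive /dextend; congr (_ * _).
apply/eqP; rewrite -subr_eq0 -linearBE//; apply/eqP/sw => x.
have [->|px] := eqVneq (phi x) 0; first by rewrite mul0r.
rewrite -[X in _ * X = _]/(chi x * tderive nu psi x - tderive nu (tcut chi psi) x).
rewrite (nbhs_singleton (chi1 _ px)) mul1r !tderiveE.
have h : \forall y \near x, (tcut chi psi : 'rV[R]_n -> R) y = psi y.
  by apply: filterS (chi1 _ px) => y /= ->; rewrite mul1r.
by rewrite (nbhs_singleton (pder_near_eq (canonical_seq nu) h)) subrr mulr0.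
Qed.

Lemma Wnorm_ge0_extend s p (phi : 'rV[R]_n -> R) (chi : testfun V) : 0 <= s -> 1 < p ->
  (forall x, phi x != 0 -> \forall y \near x, chi y = 1) ->
  exists2 C, 0 < C & forall w, linear w -> supported_by phi w ->
    (Wnorm_ge0 s p (dextend chi w : testfun O -> R^o) <= C%:E * Wnorm_ge0 s p w)%E.
Proof.
move=> s0 p1 chi1.
have [C C0 hC] := dLp_norm_extend chi p1 oV oO VO.
have [D D0 hD] : exists2 D, 0 < D & forall w,
    s - (Num.truncn s)%:R != 0 -> forall nu : {ffun 'I_n -> 'I_(Num.truncn s).+1},
    mindex_order (val \o nu) = Num.truncn s ->
    (dslobodeckij p (s - (Num.truncn s)%:R) (dextend chi (dderive (val \o nu) w) : testfun O -> R^o) <=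
     D%:E * Wnorm_ge0 s p w)%E.
  have [th0|th0] := eqVneq (s - (Num.truncn s)%:R) 0; first by exists 1.
  have [E E0 hE] := dslob_extend chi p1 (truncn_frac s0 th0) oV oO VO.
  have k0 : 0 <= 2 * @kernel_const R n p (s - (Num.truncn s)%:R).
    by rewrite mulr_ge0// kernel_const_ge0.
  exists (E * (1 + 2 * @kernel_const R n p (s - (Num.truncn s)%:R))) => [|w _ nu nuk].
    by rewrite mulr_gt0// ltr_wpDr.
  apply: le_trans (hE _) _; rewrite [(E * _)%:E]EFinM -muleA; apply: lee_wpmul2l.
    by rewrite lee_fin ltW.
  rewrite EFinD ge0_muleDl ?lee_fin// mul1e; apply: leeD; first exact: dslob_le_Wnorm.
  by apply: lee_wpmul2l; [rewrite lee_fin|apply: dLp_norm_le_Wnorm; rewrite nuk].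
exists (2 * #|{: {ffun 'I_n -> 'I_(Num.truncn s).+1}}|%:R * (C + D)) => [|w lw sw].
  rewrite mulr_gt0 ?addr_gt0// mulr_gt0// ltr0n; apply/card_gt0P.
  by exists [ffun=> ord0].
have W0 : (0 <= Wnorm_ge0 s p w)%E by exact: Wnorm_ge0_ge0.
rewrite EFinM -muleA; apply: Wnorm_ge0_le.
- by rewrite mule_ge0// lee_fin addr_ge0// ltW.
- move=> nu nuk; rewrite (dderive_extend _ chi1 lw sw); apply: le_trans (hC _) _.
  apply: (@le_trans _ _ (C%:E * Wnorm_ge0 s p w)%E).
    by apply: lee_wpmul2l; [rewrite lee_fin ltW|exact: dLp_norm_le_Wnorm].
  by apply: lee_wpmul2r => //; rewrite lee_fin lerDl ltW.
- move=> nu th0 nuk; rewrite (dderive_extend _ chi1 lw sw); apply: le_trans (hD _ th0 _ nuk) _.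
  by apply: lee_wpmul2r => //; rewrite lee_fin lerDr ltW.
Qed.

Lemma dextend_linear (chi : testfun V) w : linear w -> linear (dextend chi w : testfun O -> R^o).
Proof.
move=> lw a phi psi; rewrite /dextend -lw; congr w; apply: testfun_eq => x /=.
by rewrite -[LHS]/(chi x * (a * phi x + psi x)) -[RHS]/(a * (chi x * phi x) + chi x * psi x); ring.
Qed.

Lemma Wnorm_extend s p (phi : 'rV[R]_n -> R) (chi : testfun V) : 1 < p ->
  (s < 0 -> smooth_mult_triple O (- s) (conj_exp p)) ->
  (forall x, phi x != 0 -> \forall y \near x, chi y = 1) ->
  exists2 C, 0 < C & forall w, linear w -> supported_by phi w ->
    (Wnorm s p (dextend chi w : testfun O -> R^o) <= C%:E * Wnorm s p w)%E.
Proof.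
move=> p1 smt chi1; rewrite /Wnorm; have [s0|s0] := leP 0 s; first exact: Wnorm_ge0_extend.
have p'1 := conj_exp_gt1 p1; have s0' : 0 <= - s by rewrite oppr_ge0 ltW.
have [_ [C hC]] := smt s0 (tincl VO chi).
have C1 : 0 < `|C| + 1 by rewrite ltr_wpDl.
exists (`|C| + 1) => // w lw sw.
have := Wnorm_lt0_ge0 oV w s0 p1.
case E : (Wnorm_lt0 s p w) => [A| |]; rewrite ?lee_fin// => A0; last first.
  by rewrite gt0_muley ?leey// lte_fin.
apply: Wnorm_lt0_le => //; [exact: dextend_linear|by rewrite mulr_ge0// ltW|].
move=> psi; rewrite /dextend.
apply: (@le_trans _ _ (A%:E * Wnorm_ge0 (- s) (conj_exp p) (regular (tcut chi psi) : testfun V -> R^o))%E).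
  by apply: Wnorm_lt0_bound => //; rewrite E.
rewrite [(_ * A)%:E]EFinM [X in (_ <= X * _)%E]muleC -muleA; apply: lee_wpmul2l => //.
(* On V, chi psi is the restriction of chi psi on O, and restriction does not increase the norm;
   there the multiplication triple applies. *)
rewrite -(drestrict_regular oV oO VO).
apply: le_trans (Wnorm_ge0_restrict oV oO VO _ _ p'1) _.
have -> : regular (tincl VO (tcut chi psi)) = dmul (tincl VO chi) (regular psi) :> (testfun O -> R^o).
  by apply/funext => f; rewrite /dmul !regular_test; apply: eq_Rintegral => x _ /=; ring.
have := hC (regular psi : testfun O -> R^o); rewrite /Wnorm s0' => h.
apply: le_trans (h _) _.
  have [d f] := Wspace_ge0_test psi oO s0' p'1.
  by split=> //; rewrite /Wnorm s0'.
apply: lee_wpmul2r; first exact: Wnorm_ge0_ge0.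
by rewrite lee_fin (le_trans (ler_norm _))// lerDl.
Qed.

(** Makes norm convergence imply convergence of distributions. For s >= 0 it is Hoelder's inequality
    for the term of order 0 in the norm; for s < 0 it is the duality bound. The added 1 makes the
    constant positive. *)
Lemma Wnorm_pairing_bound s p (psi : testfun V) : 1 < p ->
  exists2 C, 0 < C & forall w, (`|w psi|%:E <= C%:E * Wnorm s p w)%E.
Proof.
move=> p1; rewrite /Wnorm; have p'1 := conj_exp_gt1 p1.
have mV := open_measurable_rV oV; have [s0|s0] := leP 0 s.
  have tpsi := testfun_is_test psi; have Nfin := test_Lnorm_lty p'1 tpsi.
  set K := ('N[_]_ _[_])%E in Nfin.
  have K0 : (0 <= K)%E by exact: Lnorm_ge0.
  exists (fine K + 1) => [|w]; first by rewrite ltr_wpDl// fine_ge0.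
  have K1 : 0 < fine K + 1 by rewrite ltr_wpDl// fine_ge0.
  pose nu : {ffun 'I_n -> 'I_(Num.truncn s).+1} := [ffun=> ord0].
  have nu0 : mindex_order (val \o nu) = 0%N by rewrite /mindex_order big1// => i _; rewrite /= ffunE.
  have dw : dderive (val \o nu) w = w.
    apply/funext => f; rewrite /dderive nu0 expr0 mul1r; congr w; apply: testfun_eq => x.
    rewrite tderiveE (_ : canonical_seq _ = [::])//; apply: size0nil.
    by rewrite size_canonical_seq nu0.
  have := @dLp_norm_le_Wnorm R n V s p nu w; rewrite nu0 dw => /(_ isT) h.
  apply: (@le_trans _ _ ((fine K + 1)%:E * dLp_norm p w)%E); last first.
    by apply: lee_wpmul2l => //; rewrite lee_fin ltW.
  have [->|w0] := eqVneq (dLp_norm p w) +oo%E; first by rewrite gt0_muley ?leey// lte_fin.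
  have [|f rf] := @dLp_norm_lty _ _ V p w; first by rewrite ltey.
  rewrite (dLp_norm_represents oV p1 rf); have [mf fp ->] := rf.
  apply: le_trans (regular_bound psi p1 mV mf fp) _; rewrite muleC -/K; apply: lee_wpmul2r.
    exact: Lp_norm_ge0.
  by rewrite EFinD fineK ?ge0_fin_numE// leeDl.
have s0' : 0 <= - s by rewrite oppr_ge0 ltW.
have Kfin := Wnorm_ge0_test_lty psi oV s0' p'1.
set K := Wnorm_ge0 _ _ _ in Kfin.
have K0 : (0 <= K)%E by exact: Wnorm_ge0_ge0.
have K1 : 0 < fine K + 1 by rewrite ltr_wpDl// fine_ge0.
exists (fine K + 1) => // w.
have := Wnorm_lt0_ge0 oV w s0 p1.
case E : (Wnorm_lt0 s p w) => [A| |]; rewrite ?lee_fin// => A0; last first.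
  by rewrite gt0_muley ?leey// lte_fin.
rewrite -lee_fin EFinM; apply: (@le_trans _ _ (A%:E * K)%E); first by apply: Wnorm_lt0_bound => //; rewrite E.
by rewrite muleC; apply: lee_wpmul2r => //; rewrite EFinD fineK ?ge0_fin_numE// leeDl.
Qed.

End extension.

(** * Extraction of subsequences *)

Section sequences_lemmas.
Context {R : realType}.
Implicit Types (f : nat -> \bar R) (g h : nat -> nat).

Lemma ge0_cvge0P f : (forall i, (0 <= f i)%E) ->
  f @ \oo --> 0%E <-> forall e : R, 0 < e -> exists N : nat, forall i, (N <= i)%N -> (f i < e%:E)%E.
Proof.
move=> f0; split.
  move=> /fine_cvgP[[N1 _ h1] /cvgrPdist_lt h2] e e0; have [N2 _ h3] := h2 _ e0.
  exists (maxn N1 N2) => i; rewrite geq_max => /andP[i1 i2].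
  have := h3 _ i2; rewrite /= sub0r normrN ger0_norm ?fine_ge0// => h.
  by rewrite -(fineK (h1 _ i1)) lte_fin.
move=> H; apply/fine_cvgP; split.
  have [N hN] := H 1 ltr01; exists N => // i /= Ni.
  by rewrite ge0_fin_numE//; apply: lt_trans (hN _ Ni) _; rewrite ltry.
apply/cvgrPdist_lt => e e0; have [N hN] := H e e0; exists N => // i /= Ni.
rewrite sub0r normrN ger0_norm ?fine_ge0// -lte_fin fineK ?hN//.
by rewrite ge0_fin_numE//; apply: lt_trans (hN _ Ni) _; rewrite ltry.
Qed.

Definition increasing g := {homo g : i j / (i < j)%N}.

Lemma increasing_geq g i : increasing g -> (i <= g i)%N.
Proof.
by move=> ig; elim: i => // i ih; apply: leq_ltn_trans ih _; apply: ig.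
Qed.

Lemma increasing_step g : (forall i, (g i < g i.+1)%N) -> increasing g.
Proof. by move=> h; apply: homo_ltn => //; exact: ltn_trans. Qed.

Lemma increasing_comp g h : increasing g -> increasing h -> increasing (g \o h).
Proof. by move=> ig ih i j ij; apply/ig/ih. Qed.

Lemma subsequence_of_frequent (P : nat -> Prop) : (forall N, exists2 i, (N <= i)%N & P i) ->
  exists2 g, increasing g & forall i, P (g i).
Proof.
move=> /(_ _)/cid2-/all_sig2[c c1 c2].
exists (fix g i := if i is i'.+1 then c (g i').+1 else c 0%N).
  by apply: increasing_step => i; exact: c1.
by case=> [|i]; exact: c2.
Qed.

(** The second hypothesis lets [P j] ignore the first j terms, because the diagonal i -> [G i i] is
    a subsequence of [G j] only from index j on. *)
Lemma diagonal_subsequence (P : nat -> (nat -> nat) -> Prop) :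
  (forall j g, increasing g -> exists2 h, increasing h & P j (g \o h)) ->
  (forall j g g' k, P j g -> increasing k -> (forall i, g' (j + i)%N = g (k i)) -> P j g') ->
  exists2 g, increasing g & forall j, P j g.
Proof.
move=> step tail.
have [H Hi HP] : exists2 H : nat -> (nat -> nat) -> (nat -> nat),
    forall j g, increasing g -> increasing (H j g) &
    forall j g, increasing g -> P j (g \o H j g).
  have /choice[H hH] : forall jg : nat * (nat -> nat), exists h,
      increasing jg.2 -> increasing h /\ P jg.1 (jg.2 \o h).
    move=> [j g]; have [ig|ng] := pselect (increasing g); last by exists id.
    by have [h h1 h2] := step j g ig; exists h.
  by exists (fun j g => H (j, g)) => j g /(hH (j, g))[].
pose G := fix G j := if j is j'.+1 then G j' \o H j'.+1 (G j') else H 0%N id.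
have Gi j : increasing (G j).
  elim: j => [|j ih] /=; first exact: Hi.
  by apply: increasing_comp => //; exact: Hi.
have GP j : P j (G j) by case: j => [|j]; [exact: (HP 0%N id)|exact: HP].
(* [K j i] composes the refinements made between stages j and j + i, so that [G (j + i)] is
   [G j \o K j i]. *)
pose K j := fix K i := if i is i'.+1 then K i' \o H (j + i'.+1)%N (G (j + i')%N) else id.
have GK j i : G (j + i)%N = G j \o K j i.
  by elim: i => [|i ih]; [rewrite addn0|rewrite addnS /= ih addnS].
have Ki j i : increasing (K j i).
  by elim: i => //= i ih; apply: increasing_comp => //; exact: Hi.
exists (fun i => G i i).
  apply: increasing_step => i /=; apply: (Gi i).
  by apply: leq_trans (increasing_geq _ (Hi _ _ (Gi _))).
move=> j; apply: (tail j (G j) _ (fun i => K j i (j + i)%N)) => //.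
  apply: increasing_step => i /=; apply: (Ki j i).
  rewrite addnS; apply: leq_trans (increasing_geq _ (Hi _ _ (Gi _))) => //.
by move=> i /=; rewrite GK.
Qed.

End sequences_lemmas.

Section local_compactness.
Context {R : realType} {n : nat} (O : set 'rV[R]_n) (s1 s2 p1 p2 : R).
Hypotheses (oO : open O) (p1_gt1 : 1 < p1) (p2_gt1 : 1 < p2).
Implicit Types (u w l : testfun O -> R^o) (phi psi : testfun O).

Lemma dmulB phi u w : dmul phi (u - w) = dmul phi u - dmul phi w.
Proof. by []. Qed.

Lemma dmulZ phi (a : R) u : dmul phi (a *: u) = a *: dmul phi u.
Proof. by []. Qed.

Lemma distribution0 : distribution (0 : testfun O -> R^o).
Proof.
split; first by move=> a f g; rewrite [RHS]addr0 scaler0.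
by move=> K _ _; exists 0, 0%N => phi M _ _; rewrite mul0r normr0.
Qed.

Lemma Wnorm0 s p : 1 < p -> Wnorm s p (0 : testfun O -> R^o) = 0%E.
Proof.
move=> p_gt1; apply/eqP; rewrite eq_le Wnorm_norm_ge0// andbT.
have l0 : linear (0 : testfun O -> R^o) by case: distribution0.
by have := WnormZ oO s 0 p_gt1 l0; rewrite scaler0 normr0 mul0e.
Qed.

Hypothesis il : interior_lipschitz O.
Hypothesis mult2 : s2 < 0 -> smooth_mult_triple O (- s2) (conj_exp p2).
Hypothesis emb : forall U : set 'rV[R]_n, open U -> bounded_set U -> lipschitz_boundary U ->
  compactly_embedded U s1 p1 s2 p2.

(* Restrict phi u to a bounded Lipschitz neighbourhood of the support of phi,
   and extend back by a cutoff. *)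
Lemma localize phi : exists V (oV : open V) (VO : V `<=` O) (chi : testfun V) (C D : R),
  [/\ compactly_embedded V s1 p1 s2 p2, 0 < C, 0 < D &
  [/\ forall u, linear u ->
        (Wnorm s1 p1 (drestrict VO (dmul phi u)) <= C%:E * Wnorm s1 p1 (dmul phi u))%E,
      forall u, dextend chi (drestrict VO (dmul phi u)) = dmul phi u,
      forall u, linear u -> supported_by phi (drestrict VO (dmul phi u)) &
      forall w : testfun V -> R^o, linear w -> supported_by phi w ->
        (Wnorm s2 p2 (dextend chi w : testfun O -> R^o) <= D%:E * Wnorm s2 p2 w)%E]].
Proof.
have [_ cphi phiO] := testfun_is_test phi.
have [V [oV bV lV VO phiV]] := il cphi phiO.
have [f [tf _ [U [oU KU fU]]]] := exists_cutoff cphi oV phiV.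
have fp : f \in test_pred V by rewrite inE.
pose chi : testfun V := TestFun fp.
have phiU x : phi x != 0 -> U x by move=> px; apply: KU; exact: subset_closure.
have [C C0 hC] := @Wnorm_restrict _ _ V O oV oO VO s1 p1 phi chi p1_gt1
  (fun x px => fU x (phiU x px)).
have [|D D0 hD] := @Wnorm_extend _ _ V O oV oO VO s2 p2 phi chi p2_gt1 mult2.
  move=> x /phiU Ux; have : nbhs x U by exact: open_nbhs_nbhs.
  by apply: filterS => y Uy; exact: fU.
exists V, oV, VO, chi, C, D; split=> //; first exact: emb.
split=> //.
  move=> u; apply/funext => psi; rewrite /dextend /drestrict /dmul; congr u.
  apply: testfun_eq => x /=; have [->|/phiU /fU cx] := eqVneq (phi x) 0; first by rewrite !mul0r.
  by rewrite cx mul1r.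
move=> u lu psi h; rewrite /drestrict /dmul -[RHS](linear0E lu); congr u.
by apply: testfun_eq => x; exact: h.
Qed.

(** Same passage through V, with boundedness of the embedding space in place of compactness: it
    places the terms of the sequence in the target local space. *)
Lemma Wspace_local phi u : linear u -> Wspace s1 p1 (dmul phi u) -> Wspace s2 p2 (dmul phi u).
Proof.
move=> lu [d f]; have [V [oV [VO [chi [C [D [[emb1 _ _] C0 D0 [hC eE sE hD]]]]]]]] := localize phi.
split=> //; rewrite -(eE u).
have [|_ fV] := emb1 (drestrict VO (dmul phi u)).
  split; first exact: distribution_restrict.
  by apply: le_lt_trans (hC _ lu) _; rewrite lte_mul_pinfty// lee_fin ltW.
apply: le_lt_trans (hD _ _ (sE _ lu)) _; first exact/drestrict_linear/dmul_linear.
by rewrite lte_mul_pinfty// lee_fin ltW.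
Qed.

Lemma local_subsequence phi (u : nat -> testfun O -> R^o) (M : R) :
  (forall i, [/\ linear (u i), Wspace s1 p1 (dmul phi (u i)) &
    (Wnorm s1 p1 (dmul phi (u i)) <= M%:E)%E]) ->
  exists2 g, increasing g & exists2 l, Wspace s2 p2 l &
    Wnorm s2 p2 (dmul phi (u (g i)) - l)%R @[i --> \oo] --> 0%E.
Proof.
move=> hu; have [V [oV [VO [chi [C [D [[_ _ cpt] C0 D0 [hC eE sE hD]]]]]]]] := localize phi.
pose v i := drestrict VO (dmul phi (u i)).
have lv i : linear (v i) by apply/drestrict_linear/dmul_linear; case: (hu i).
have sv i : supported_by phi (v i) by apply: sE; case: (hu i).
have [|g ig [l [dl fl] vl]] := cpt v (C * M).
  move=> i; have [lu [d f] uM] := hu i.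
  have h : (Wnorm s1 p1 (v i) <= (C * M)%:E)%E.
    by apply: le_trans (hC _ lu) _; rewrite EFinM lee_wpmul2l// lee_fin ltW.
  split=> //; split; first exact: distribution_restrict.
  by apply: le_lt_trans h _; rewrite ltry.
have vl0 := (ge0_cvge0P (fun i => Wnorm_norm_ge0 oV s2 (v (g i) - l) p2_gt1)).1 vl.
have ll : linear l by case: dl.
have svl i : linear (v (g i) - l) by rewrite addrC -scaleN1r; exact: linear_lin.
(* The extension bound applies to v (g i) - l only once l is known to be supported by phi; this
   follows by passing to the limit in the pairings. *)
have sl : supported_by phi l.
  move=> psi h; apply/eqP; rewrite -normr_le0; apply/ler_addgt0Pr => e e0; rewrite add0r.
  have [E E0 hE] := Wnorm_pairing_bound oV s2 psi p2_gt1.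
  have [N hN] := vl0 (e / E) (divr_gt0 e0 E0).
  rewrite -lee_fin -normrN; have := hE (v (g N) - l).
  rewrite -[(v (g N) - l) psi]/(v (g N) psi - l psi) (sv (g N) psi h).
  rewrite sub0r => /le_trans; apply.
  apply: (@le_trans _ _ (E%:E * (e / E)%:E)%E).
    by apply: lee_wpmul2l; [rewrite lee_fin ltW|exact/ltW/hN].
  by rewrite -EFinM lee_fin mulrC divfK// gt_eqF.
exists g => //; exists (dextend chi l).
  split; first exact: distribution_extend.
  by apply: le_lt_trans (hD _ ll sl) _; rewrite lte_mul_pinfty// lee_fin ltW.
have E i : dmul phi (u (g i)) - dextend chi l = dextend chi (v (g i) - l).
  by rewrite -(eE (u (g i))).
apply/ge0_cvge0P => [i|e e0]; first exact: Wnorm_norm_ge0.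
have [N hN] := vl0 (e / D) (divr_gt0 e0 D0); exists N => i /hN h; rewrite E.
apply: le_lt_trans (hD _ (svl i) _) _.
  move=> psi hp; by rewrite -[LHS]/(v (g i) psi - l psi) sl// (sv (g i) psi hp) subrr.
by rewrite -lte_pdivlMl// -EFinM mulrC.
Qed.

(** Topological boundedness is tested on the unit ball [U] of the seminorm of phi, open by the
    triangle inequality with radius 1 - N; the scaling factor t is the bound. *)
Lemma wloc_bounded_Wnorm (Y : set (Wloc s1 p1 O)) : wloc_bounded Y ->
  forall phi, exists M : R, forall y, Y y -> (Wnorm s1 p1 (dmul phi (wloc_val y)) <= M%:E)%E.
Proof.
move=> bY phi.
have lin (w : Wloc s1 p1 O) : linear (dmul phi (wloc_val w)).
  by apply: dmul_linear; case: (wloc_distribution w).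
pose U := [set w : Wloc s1 p1 O | (Wnorm s1 p1 (dmul phi (wloc_val w)) < 1)%E].
have oU : wloc_open U.
  move=> w Uw; pose N := fine (Wnorm s1 p1 (dmul phi (wloc_val w))).
  have NE : Wnorm s1 p1 (dmul phi (wloc_val w)) = N%:E.
    rewrite fineK// ge0_fin_numE; last exact: Wnorm_norm_ge0.
    by apply: lt_trans Uw _; rewrite ltry.
  have N1 : N < 1 by rewrite -lte_fin -NE.
  exists (1 - N); first by rewrite subr_gt0.
  exists [:: phi] => v /(_ phi (mem_head _ _)) h.
  have -> : U v = (Wnorm s1 p1 (dmul phi (wloc_val v - wloc_val w)%R + dmul phi (wloc_val w))%R < 1)%E.
    by rewrite dmulB subrK.
  apply: le_lt_trans (WnormD oO _ p1_gt1 _ (lin w)) _.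
    by rewrite dmulB addrC -scaleN1r; apply: linear_lin; exact: lin.
  by rewrite NE -lteBrDr// -EFinB.
have W0 psi : Wspace s1 p1 (dmul psi (0 : testfun O -> R^o)).
  have -> : dmul psi (0 : testfun O -> R^o) = 0 by [].
  by split; [exact: distribution0|rewrite Wnorm0].
have [|t t0 ht] := bY U oU.
  by exists (MkWloc distribution0 W0) => //; rewrite /U /= Wnorm0.
exists t => y /ht[w Uw ->]; rewrite dmulZ.
apply: le_trans (WnormZ oO _ _ p1_gt1 (lin w)) _.
by rewrite gtr0_norm// -[leRHS]mule1; apply: lee_wpmul2l; [rewrite lee_fin ltW|exact: ltW].
Qed.

End local_compactness.

Section limits.
Context {R : realType} {n : nat} (O : set 'rV[R]_n) (s p : R).
Hypotheses (oO : open O) (p_gt1 : 1 < p).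
Implicit Types (u w : nat -> testfun O -> R^o) (l : testfun O -> R^o) (phi psi : testfun O).

Lemma Wnorm_cvg_pairing w l psi :
  Wnorm s p (w i - l)%R @[i --> \oo] --> 0%E -> (w i psi : R) @[i --> \oo] --> (l psi : R).
Proof.
move=> /(ge0_cvge0P (fun i => Wnorm_norm_ge0 oO s (w i - l) p_gt1)).1 wl.
have [C C0 hC] := Wnorm_pairing_bound oO s psi p_gt1.
apply/cvgrPdist_lt => e e0; have [N hN] := wl (e / C) (divr_gt0 e0 C0).
exists N => // i /= /hN h; rewrite distrC -lte_fin.
apply: le_lt_trans (hC (w i - l)) _.
by rewrite -lte_pdivlMl// -EFinM mulrC.
Qed.

Lemma Wnorm_limit_unique phi u l l' : (forall psi, (u i psi : R) @[i --> \oo] --> (l psi : R)) ->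
  Wnorm s p (dmul phi (u i) - l')%R @[i --> \oo] --> 0%E -> l' = dmul phi l.
Proof.
move=> ul ul'; apply/funext => psi.
have h1 := Wnorm_cvg_pairing (psi := psi) ul'; have h2 := ul (tmul phi psi).
by rewrite -(cvg_lim (@Rhausdorff R) h1); exact: cvg_lim h2.
Qed.

Lemma cvg_subsequence (T : topologicalType) (a : nat -> T) (b : T) (g : nat -> nat) :
  increasing g -> a @ \oo --> b -> a \o g @ \oo --> b.
Proof.
move=> ig ab; apply: cvg_trans ab => A [N _ hN]; exists N => // i /= Ni; apply: hN => /=.
exact: leq_trans Ni (increasing_geq _ ig).
Qed.

(* Near K the limit is a norm limit, and hence a distribution. *)
Lemma limit_distribution (chi : nat -> testfun O) u l :
  (forall K, compact K -> K `<=` O -> exists j, forall x, K x -> chi j x = 1) ->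
  (forall i, linear (u i)) ->
  (forall psi, (u i psi : R) @[i --> \oo] --> (l psi : R)) ->
  (forall j, distribution (dmul (chi j) l)) -> distribution l.
Proof.
move=> ex lu ul dl; split.
  move=> a f g; rewrite -(cvg_lim (@Rhausdorff R) (ul (a *: f + g))); apply: cvg_lim => //.
  under eq_cvg do rewrite lu.
  by apply: cvgD; [apply: cvgM; [exact: cvg_cst|exact: (ul f)]|exact: (ul g)].
move=> K cK KO; have [j hj] := ex K cK KO.
have [_ /(_ K cK KO)[C [N hC]]] := dl j; exists C, N => phi M phiK phiM.
have -> : l phi = dmul (chi j) l phi; last exact: hC.
rewrite /dmul; congr l; apply: testfun_eq => x /=.
have [->|px] := eqVneq (phi x) 0; first by rewrite mulr0.
by rewrite hj ?mul1r//; apply: phiK; exact: subset_closure.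
Qed.

(** A basic neighbourhood involves only a finite list of cutoffs, so the largest of finitely many
    ranks serves. *)
Lemma cvg_Wloc (v : nat -> Wloc s p O) (l : Wloc s p O) :
  (forall phi, Wnorm s p (dmul phi (wloc_val (v i)) - dmul phi (wloc_val l))%R
     @[i --> \oo] --> 0%E) -> v @ \oo --> l.
Proof.
move=> vl A; rewrite nbhsE => -[B [oB Bl] BA]; have [e e0 [L hL]] := oB l Bl.
suff [N hN] : exists N : nat, forall i, (N <= i)%N -> {in L, forall phi,
    (Wnorm s p (dmul phi (wloc_val (v i)) - dmul phi (wloc_val l))%R < e%:E)%E}.
  by exists N => // i /= Ni; apply/BA/hL; exact: hN.
elim: L {hL} => [|phi L [N1 h1]]; first by exists 0%N.
have [N2 h2] := (ge0_cvge0P (fun i => Wnorm_norm_ge0 oO s _ p_gt1)).1 (vl phi) e e0.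
exists (maxn N1 N2) => i; rewrite geq_max => /andP[i1 i2] psi; rewrite inE => /orP[/eqP ->|pL].
  exact: h2.
exact: h1.
Qed.

End limits.

Theorem theorem5p22 (R : realType) (n : nat) (Omega : set 'rV[R]_n)
    (s1 s2 p1 p2 : R) :
  (0 < n)%N ->
  open Omega -> Omega !=set0 -> interior_lipschitz Omega ->
  1 < p1 -> 1 < p2 ->
  smooth_mult_triple Omega s1 p1 ->
  smooth_mult_triple Omega (- s1) (conj_exp p1) ->
  (s2 < 0 -> smooth_mult_triple Omega (- s2) (conj_exp p2)) ->
  (forall U : set 'rV[R]_n, open U -> bounded_set U -> lipschitz_boundary U ->
    compactly_embedded U s1 p1 s2 p2) ->
  forall u : nat -> Wloc s1 p1 Omega, wloc_bounded (range u) ->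
  exists2 g : nat -> nat, {homo g : i j / (i < j)%N} &
  exists (v : nat -> Wloc s2 p2 Omega) (l : Wloc s2 p2 Omega),
    (forall i, wloc_val (v i) = wloc_val (u (g i))) /\ v @ \oo --> l.
Proof.
move=> _ oO _ il p11 p21 _ _ mult2 emb u bu.
have lu i : linear (wloc_val (u i)) by case: (wloc_distribution (u i)).
have subseq phi (g : nat -> nat) : exists2 h, increasing h & exists2 l, Wspace s2 p2 l &
    Wnorm s2 p2 (dmul phi (wloc_val (u (g (h i)))) - l)%R @[i --> \oo] --> 0%E.
  have [M hM] := wloc_bounded_Wnorm oO p11 bu phi.
  apply: (local_subsequence oO p11 p21 il mult2 emb (u := fun i => wloc_val (u (g i))) (M := M)).
  by move=> i; split=> //; [exact: wlocP|by apply: hM; exists (g i)].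
have [chi [_ exchi]] := exists_exhaustion oO.
(* One subsequence serves all cutoffs [chi j]; their limits are glued afterwards, through
   pairings. *)
have [|j g g' k [l Wl gl] ik gk|g ig hg] := @diagonal_subsequence (fun j g => exists2 l, Wspace s2 p2 l &
    Wnorm s2 p2 (dmul (chi j) (wloc_val (u (g i))) - l)%R @[i --> \oo] --> 0%E).
- by move=> j g _; exact: subseq.
- exists l => //; rewrite -(cvg_shiftn j).
  have := cvg_subsequence ik gl; apply: cvg_trans; apply: near_eq_cvg; apply: nearW => i.
  by rewrite /= addnC gk.
have /choice[l ul] : forall psi : testfun Omega, exists a : R,
    (wloc_val (u (g i)) psi : R) @[i --> \oo] --> a.
  move=> psi; have [_ cpsi psiO] := testfun_is_test psi.
  (* Some [chi j] is 1 on the support of psi, so the pairing with psi does not see the cutoff. *)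
  have [j hj] := exchi _ cpsi psiO; have [l _ gl] := hg j.
  exists (l psi); have := Wnorm_cvg_pairing oO p21 (psi := psi) gl.
  rewrite (_ : (fun i => _ : R) = (fun i => wloc_val (u (g i)) psi))//.
  apply/funext => i; rewrite /dmul; congr (wloc_val _ _); apply: testfun_eq => x /=.
  have [->|px] := eqVneq (psi x) 0; first by rewrite mulr0.
  by rewrite hj ?mul1r//; exact: subset_closure.
have ul_sub phi (k : nat -> nat) : increasing k ->
    exists2 h, increasing h & Wspace s2 p2 (dmul phi (l : testfun Omega -> R^o)) /\
    Wnorm s2 p2 (dmul phi (wloc_val (u (g (k (h i))))) - dmul phi (l : testfun Omega -> R^o))%R
      @[i --> \oo] --> 0%E.
  move=> ik; have [h ih [l' Wl' hl']] := subseq phi (g \o k).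
  have E : l' = dmul phi (l : testfun Omega -> R^o).
    apply: (Wnorm_limit_unique oO p21 _ hl') => psi.
    exact: (cvg_subsequence (increasing_comp ik ih) (ul psi)).
  by exists h => //; rewrite -E.
(* Taking k = id, only the membership of the limit is kept. *)
have Wl phi : Wspace s2 p2 (dmul phi (l : testfun Omega -> R^o)).
  by have [h _ []] := ul_sub phi id (fun i j ij => ij).
have dl : distribution (l : testfun Omega -> R^o).
  apply: (limit_distribution exchi (u := fun i => wloc_val (u (g i)))) => //.
  by move=> j; case: (Wl (chi j)).
(* Elements of the two local spaces have different types, so each u (g i) is repackaged with a proof
   that it lies in the target space. *)
have Wu i phi : Wspace s2 p2 (dmul phi (wloc_val (u (g i)))).
  by apply: (Wspace_local oO p11 p21 il mult2 emb) => //; exact: wlocP.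
exists g => //; exists (fun i => MkWloc (wloc_distribution (u (g i))) (Wu i)), (MkWloc dl Wl).
split=> //; apply: cvg_Wloc => // phi /=.
(* A sequence converges as soon as each of its subsequences has a subsequence
   converging to the same limit. *)
apply/(ge0_cvge0P (fun i => Wnorm_norm_ge0 oO s2 _ p21)) => e e0.
apply: contrapT => /forallNP nN.
have [|k ik hk] := @subsequence_of_frequent (fun i =>
  ~ (Wnorm s2 p2 (dmul phi (wloc_val (u (g i))) - dmul phi (l : testfun Omega -> R^o))%R < e%:E)%E).
  by move=> N; have /existsNP[i /not_implyP[Ni hi]] := nN N; exists i.
have [h _ [_ hl]] := ul_sub phi k ik.
have [N hN] := (ge0_cvge0P (fun i => Wnorm_norm_ge0 oO s2 _ p21)).1 hl e e0.
exact: hk (h N) (hN N (leqnn N)).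
Qed.
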